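(* Let $0<\alpha<n$, $b\in BMO(\mathbb{R}^n)$ and let $\Phi,\Psi$ be Young functions such that $\Phi\in\Delta_2\cap\nabla_2$ and $\Psi\in\Delta_2\cap\nabla_2$. Then the condition $$r^{-\frac{\alpha}{n}}\,\Phi^{-1}(r)\le C\,\Psi^{-1}(r)\quad\text{for all } r>0,$$ where $C>0$ does not depend on $r$, is necessary and sufficient for the boundedness of $M_{b,\alpha}$ from $L^{\Phi}(\mathbb{R}^n)$ to $L^{\Psi}(\mathbb{R}^n)$.
   Context: A function $\Phi:[0,\infty)\to[0,\infty]$ is a Young function if it is convex, left-continuous, $\lim_{r\to+0}\Phi(r)=\Phi(0)=0$ and $\lim_{r\to\infty}\Phi(r)=\infty$. For $0\le s\le\infty$, $\Phi^{-1}(s)=\inf\{r\ge 0:\Phi(r)>s\}$. $\Phi\in\Delta_2$ means that there is $C>1$ with $\Phi(2r)\le C\Phi(r)$ for all $r>0$ (such a $\Phi$ satisfies $0<\Phi(r)<\infty$ for $0<r<\infty$). $\Phi\in\nabla_2$ means that there is $C>1$ with $\Phi(r)\le\frac{1}{2C}\Phi(Cr)$ for all $r\ge 0$. The Orlicz space $L^{\Phi}(\mathbb{R}^n)$ is the set of measurable $f$ with $\int_{\mathbb{R}^n}\Phi(k|f(x)|)\,dx<\infty$ for some $k>0$, with norm $\|f\|_{L^\Phi}=\inf\{\lambda>0:\int_{\mathbb{R}^n}\Phi(|f(x)|/\lambda)\,dx\le 1\}$. $B(x,r)$ is the ball of radius $r$ centered at $x$ and $|B(x,r)|$ its Lebesgue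 measure. $BMO(\mathbb{R}^n)$ is the set of $b\in L^1_{\rm loc}(\mathbb{R}^n)$ with $\|b\|_*=\sup_{x\in\mathbb{R}^n,r>0}\frac{1}{|B(x,r)|}\int_{B(x,r)}|b(y)-b_{B(x,r)}|\,dy<\infty$, where $b_{B(x,r)}$ is the average of $b$ over $B(x,r)$. For a measurable function $b$, the fractional maximal commutator is $M_{b,\alpha}f(x)=\sup_{t>0}|B(x,t)|^{-1+\frac{\alpha}{n}}\int_{B(x,t)}|b(x)-b(y)||f(y)|\,dy$. Boundedness of an operator $T$ from $X$ to $Y$ means that there is a constant $C>0$ with $\|Tf\|_Y\le C\|f\|_X$ for all $f\in X$.
   Formalization: Necessity is stated for boundedness of M_{b,α} for all b in BMO, not for one fixed b: for constant b the operator is zero, hence bounded, while the condition can fail (Φ=Ψ=t²). Sufficiency is for each b. Measurable means Borel measurable. *)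

(* Defs.v *)
From HB Require Import structures.
From mathcomp Require Import all_boot all_order all_algebra.
From mathcomp Require Import all_classical all_reals all_analysis.
From mathcomp Require Import measurable_realfun.
Import Order.TTheory GRing.Theory Num.Theory numFieldNormedType.Exports.

Set Implicit Arguments.
Unset Strict Implicit.
Unset Printing Implicit Defensive.

Local Open Scope classical_set_scope.
Local Open Scope ring_scope.

(* R^n, with the product (= Borel) sigma-algebra carried by tuples. *)
Notation Rn R n := (n.-tuple (measurableTypeR R)).

(* Lebesgue measure on R^n.+1 is the image of the product of Lebesgue measure
   on R and Lebesgue measure on R^n under (a, x) |-> a :: x. *)
Section lebesgue_measure_Rn.
Local Open Scope ereal_scope.
Variable R : realType.

Definition Rn_cons (n : nat) (p : measurableTypeR R * Rn R n) : Rn R n.+1 :=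
  [tuple of p.1 :: p.2].

Lemma measurable_Rn_cons n : measurable_fun [set: _] (@Rn_cons n).
Proof. exact: measurable_cons. Qed.

Section step.
Variables (n : nat) (m : {sigma_finite_measure set (Rn R n) -> \bar R}).

Definition lebesgue_Rn_step : set (Rn R n.+1) -> \bar R :=
  pushforward (@lebesgue_measure R \x m) (@Rn_cons n).

Let step0 : lebesgue_Rn_step set0 = 0.
Proof. by rewrite /lebesgue_Rn_step /pushforward preimage_set0 measure0. Qed.

Let step_ge0 A : 0 <= lebesgue_Rn_step A.
Proof. by rewrite /lebesgue_Rn_step /pushforward; exact: measure_ge0. Qed.

Let step_sigma_additive : semi_sigma_additive lebesgue_Rn_step.
Proof.
move=> F mF tF mUF; rewrite /lebesgue_Rn_step /pushforward preimage_bigcup.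
have mcons A : measurable A -> measurable (@Rn_cons n @^-1` A).
  by move=> mA; rewrite -[X in measurable X]setTI; exact: measurable_Rn_cons.
apply: measure_semi_sigma_additive.
- by move=> k; exact: mcons.
- apply/trivIsetP => /= i j _ _ ij; rewrite -preimage_setI.
  by move/trivIsetP : tF => /(_ _ _ _ _ ij) ->//; rewrite preimage_set0.
- by rewrite -preimage_bigcup; exact: mcons.
Qed.

HB.instance Definition _ := isMeasure.Build _ _ _ lebesgue_Rn_step
  step0 step_ge0 step_sigma_additive.

Let step_sigma_finite : sigma_finite setT lebesgue_Rn_step.
Proof.
have [F TF Foo] : sigma_finite setT (@lebesgue_measure R \x m).
  have /sigma_finiteP[F [TF ndF Foo]] := sigma_finiteT (@lebesgue_measure R).
  have /sigma_finiteP[G [TG ndG Goo]] := sigma_finiteT m.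
  exists (fun k => F k `*` G k) => [|k]; last first.
    have [? ?] := Foo k; have [? ?] := Goo k.
    split; first exact: measurableX.
    by rewrite product_measure1E// lte_mul_pinfty// ge0_fin_numE.
  rewrite -setXTT TF TG predeqE => -[x y]; split.
    move=> [/= [i _ Fix] [j _ Gjy]]; exists (maxn i j) => //; split.
    - by move: x Fix; exact/subsetPset/ndF/leq_maxl.
    - by move: y Gjy; exact/subsetPset/ndG/leq_maxr.
  by move=> [i _ []/= ? ?]; split; exists i.
pose u (x : Rn R n.+1) : measurableTypeR R * Rn R n :=
  (thead x, [tuple of behead x]).
have mu : measurable_fun [set: _] u.
  by apply: measurable_fun_pair;
    [exact: measurable_tnth | exact: measurable_behead].
have consK : cancel (@Rn_cons n) u.
  by case=> a t; rewrite /u /Rn_cons /= theadE; congr pair; exact: val_inj.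
exists (fun i => u @^-1` F i); first by rewrite -preimage_bigcup -TF.
move=> i; have [mFi Fi_oo] := Foo i; split.
  by rewrite -[X in measurable X]setTI; exact: mu.
rewrite /lebesgue_Rn_step /pushforward -comp_preimage.
by rewrite (_ : u \o _ = id) //; exact/funext.
Qed.

HB.instance Definition _ := Measure_isSigmaFinite.Build _ _ _
  lebesgue_Rn_step step_sigma_finite.
End step.

Fixpoint lebesgue_Rn (n : nat) : {sigma_finite_measure set (Rn R n) -> \bar R} :=
  if n is k.+1 then lebesgue_Rn_step (lebesgue_Rn k)
  else \d_([tuple] : Rn R 0).

End lebesgue_measure_Rn.

(* Open Euclidean ball. *)
Definition eball (R : realType) (n : nat) (x : Rn R n) (r : R) : set (Rn R n) :=
  [set y | Num.sqrt (\sum_(i < n) ((tnth x i : R) - tnth y i) ^+ 2) < r].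

Section young_functions.
Local Open Scope ereal_scope.
Variable R : realType.

(* A Young function [0, oo) -> [0, oo] is encoded by Phi : R -> \bar R; its
   values on negative reals are never used. *)
Record young (Phi : R -> \bar R) : Prop := Young {
  young_ge0 : forall r : R, (0 <= r)%R -> 0 <= Phi r ;
  young_convex : forall r s t : R, (0 <= r)%R -> (0 <= s)%R -> (0 <= t <= 1)%R ->
    Phi (t * r + (1 - t) * s)%R <= t%:E * Phi r + (1 - t)%:E * Phi s ;
  young_left_continuous : forall r : R, (0 < r)%R -> Phi x @[x --> r^'-] --> Phi r ;
  young0 : Phi 0%R = 0 ;
  young_cvg0 : Phi x @[x --> 0%R^'+] --> 0 ;
  young_cvgy : Phi x @[x --> +oo%R] --> +oo }.

(* inf of the empty set is +oo *)
Definition young_inv (Phi : R -> \bar R) (s : \bar R) : \bar R :=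
  ereal_inf [set r%:E | r in [set r : R | (0 <= r)%R /\ s < Phi r]].

Definition Delta2 (Phi : R -> \bar R) : Prop :=
  exists2 C : R, (1 < C)%R &
    forall r : R, (0 < r)%R -> Phi (2 * r)%R <= C%:E * Phi r.

Definition nabla2 (Phi : R -> \bar R) : Prop :=
  exists2 C : R, (1 < C)%R &
    forall r : R, (0 <= r)%R -> Phi r <= ((2 * C)^-1)%:E * Phi (C * r)%R.

(* Extension to [0, oo] by Phi(oo) = oo, for functions with values in \bar R. *)
Definition young_ext (Phi : R -> \bar R) (x : \bar R) : \bar R :=
  if x is r%:E then Phi r else +oo.

End young_functions.

Section orlicz.
Local Open Scope ereal_scope.
Variables (R : realType) (n : nat).
Notation mu := (lebesgue_Rn R n).

(* Functions take values in \bar R because maximal functions may be infinite;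
   in_orlicz forces f to be finite almost everywhere. *)
Definition in_orlicz (Phi : R -> \bar R) (f : Rn R n -> \bar R) : Prop :=
  measurable_fun setT f /\
  exists2 k : R, (0 < k)%R & \int[mu]_x young_ext Phi (k%:E * `|f x|) < +oo.

Definition orlicz_norm (Phi : R -> \bar R) (f : Rn R n -> \bar R) : \bar R :=
  ereal_inf [set l%:E | l in [set l : R |
    (0 < l)%R /\ \int[mu]_x young_ext Phi (`|f x| * (l^-1)%:E) <= 1]].

Definition orlicz_bounded (Phi Psi : R -> \bar R)
    (T : (Rn R n -> \bar R) -> Rn R n -> \bar R) : Prop :=
  exists2 C : R, (0 < C)%R & forall f, in_orlicz Phi f ->
    in_orlicz Psi (T f) /\ orlicz_norm Psi (T f) <= C%:E * orlicz_norm Phi f.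

(* Every compact subset of R^n lies in a ball and every ball in a compact set,
   so integrability on balls is local integrability. *)
Definition loc_integrable (b : Rn R n -> R) : Prop :=
  measurable_fun setT b /\
  forall x r, mu.-integrable (eball x r) (EFin \o b).

Definition average (b : Rn R n -> R) (B : set (Rn R n)) : R :=
  ((fine (mu B))^-1 * \int[mu]_(y in B) b y)%R.

(* p ranges over pairs (centre, radius). *)
Definition bmo_norm (b : Rn R n -> R) : \bar R :=
  ereal_sup [set ((fine (mu (eball p.1 p.2)))^-1)%:E *
      \int[mu]_(y in eball p.1 p.2) `|b y - average b (eball p.1 p.2)|%:E
    | p in [set p : Rn R n * R | (0 < p.2)%R]].

Definition bmo (b : Rn R n -> R) : Prop :=
  loc_integrable b /\ bmo_norm b < +oo.

Definition frac_max_commutator (alpha : R) (b : Rn R n -> R)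
    (f : Rn R n -> \bar R) (x : Rn R n) : \bar R :=
  ereal_sup [set (fine (mu (eball x t)) `^ (- 1 + alpha / n%:R))%:E *
      \int[mu]_(y in eball x t) (`|b x - b y|%:E * `|f y|)
    | t in [set t : R | (0 < t)%R]].

End orlicz.

(* Main.v *)
Require Import Defs.
From HB Require Import structures.
From mathcomp Require Import all_boot all_order all_algebra.
From mathcomp Require Import all_classical all_reals all_analysis.
From mathcomp Require Import measurable_realfun ring lra.
Import Order.TTheory GRing.Theory Num.Theory numFieldNormedType.Exports.

Set Implicit Arguments.
Unset Strict Implicit.
Unset Printing Implicit Defensive.

Local Open Scope classical_set_scope.
Local Open Scope ring_scope.

(** The sufficiency proof replaces the oscillation of [b] by exponential weights
    and reduces the whole estimate to a maximal inequality on dyadic grids.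

    Normalise [f] by [int Phi(|f|) <= 1] and let [Q] be a cube of measure [m]
    around [x], [c] an average of [b] near [Q], and
    [a] the average over [Q] of [(1 + |b - c|) |f|]. Then
    [m^(alpha/n - 1) int_Q |b x - b| |f| <= (1 + |b x - c|) m^(alpha/n) a].
    - Since [Phi] is in nabla_2 it grows at least like a power [p = r^2 > 1], so
      large values of [f] pay for the exponentially integrable factors that the
      John-Nirenberg inequality ([john_nirenberg]) controls. This gives
      [Phi(a) m <= K] ([cube_average_le]) and, for [v = exp(e b)] with [e] small,
      [Phi(a) <= K exp(e c) S^r] ([cube_average_weighted]), where [S] is the
      average over [Q], with respect to [v dx], of [(Phi(|f|) / v)^(1/r)].
    - [Phi(a) m <= K] and the condition on the inverses give Hedberg's inequality
      [Psi(m^(alpha/n) a) <= K Phi(a)] ([hedberg_inequality]).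
    - Delta_2 for [Psi] turns the factor [1 + |b x - c|] into a power, which is at
      most a multiple of [exp(e (b x - c)) + exp(- e (b x - c))]. The factor
      [exp(e c)] cancels: [Psi] of the quantity above is at most a constant times
      [v x * S^r] plus the same expression for [- b] ([commutator_cube_le]).
    - The maximal function of the averages [S] is bounded on [L^r(v dx)]
      ([weighted_maximal_inequality]) and [int ((Phi(|f|)/v)^(1/r))^r v] is
      [int Phi(|f|) <= 1]; hence [int Psi(M f / K) <= K] ([modular_bound]).

    Every ball is inside a cube of comparable size of one of [2^n] shifted dyadic
    grids ([one_third_trick]), so all of this is done on grids, where cubes are
    nested and a stopping time splits any open set into disjoint cubes
    ([stopping_le]). The abstract notion of grid also yields the part of
    Lebesgue's differentiation theorem that the John-Nirenberg inequality needs
    ([integral_le_of_averages]).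

    For necessity, one [b] suffices: the indicator of a half-space. It is bounded
    and jumps at every scale, so testing on a cube on one side of the boundary
    and evaluating on the mirror cube gives the condition at every scale. *)

(** * Integrals of nonnegative real functions *)

Section real_integral.
Local Open Scope ereal_scope.
Context d (T : measurableType d) (R : realType).
Variable mu : {measure set T -> \bar R}.
Implicit Types (A B : set T) (f g : T -> R).

Lemma rint_ge0 A f : (forall x, (0 <= f x)%R) -> 0 <= \int[mu]_(x in A) (f x)%:E.
Proof. by move=> f0; apply: integral_ge0 => x _; rewrite lee_fin. Qed.

Lemma measurable_real_integrand A f : measurable_fun [set: T] f ->
  measurable_fun A (fun x => (f x)%:E).
Proof. by move=> mf; apply/measurable_EFinP; exact: measurable_funS mf. Qed.

Lemma rint_le A f g : measurable A -> measurable_fun [set: T] f ->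
  measurable_fun [set: T] g -> (forall x, (0 <= f x)%R) ->
  (forall x, A x -> (f x <= g x)%R) ->
  \int[mu]_(x in A) (f x)%:E <= \int[mu]_(x in A) (g x)%:E.
Proof.
move=> mA mf mg f0 fg; apply: ge0_le_integral => //; [|exact: measurable_real_integrand|exact: measurable_real_integrand].
by move=> x _; rewrite lee_fin.
Qed.

Lemma rintD A f g : measurable A -> measurable_fun [set: T] f ->
  measurable_fun [set: T] g -> (forall x, (0 <= f x)%R) ->
  (forall x, (0 <= g x)%R) ->
  \int[mu]_(x in A) (f x + g x)%:E =
  \int[mu]_(x in A) (f x)%:E + \int[mu]_(x in A) (g x)%:E.
Proof.
move=> mA mf mg f0 g0; rewrite -ge0_integralD//;
  by [move=> *; rewrite lee_fin|exact: measurable_real_integrand].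
Qed.

Lemma rintZ A (k : R) f : measurable A -> measurable_fun [set: T] f ->
  (forall x, (0 <= f x)%R) -> (0 <= k)%R ->
  \int[mu]_(x in A) (k * f x)%:E = k%:E * \int[mu]_(x in A) (f x)%:E.
Proof.
move=> mA mf f0 k0; rewrite -ge0_integralZl//;
  by [move=> *; rewrite lee_fin|exact: measurable_real_integrand].
Qed.

Lemma rint_lin A (k l : R) f g : measurable A -> measurable_fun [set: T] f ->
  measurable_fun [set: T] g -> (forall x, (0 <= f x)%R) ->
  (forall x, (0 <= g x)%R) -> (0 <= k)%R -> (0 <= l)%R ->
  \int[mu]_(x in A) (k * f x + l * g x)%:E =
  k%:E * \int[mu]_(x in A) (f x)%:E + l%:E * \int[mu]_(x in A) (g x)%:E.
Proof.
move=> mA mf mg f0 g0 k0 l0; rewrite -!rintZ// rintD//;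
  by [exact: measurable_funM|move=> x; rewrite mulr_ge0].
Qed.

Lemma rint_subset A B f : measurable A -> measurable B ->
  measurable_fun [set: T] f -> (forall x, (0 <= f x)%R) -> A `<=` B ->
  \int[mu]_(x in A) (f x)%:E <= \int[mu]_(x in B) (f x)%:E.
Proof.
move=> mA mB mf f0 AB; apply: ge0_subset_integral => //; first exact: measurable_real_integrand.
by move=> x _; rewrite lee_fin.
Qed.

Lemma rint_cst A (k : R) : measurable A ->
  \int[mu]_(x in A) k%:E = k%:E * mu A.
Proof. by move=> mA; rewrite (integral_cst mu mA). Qed.

End real_integral.

(** * Grids *)

Section grid.
Local Open Scope ereal_scope.
Context d (T : measurableType d) (R : realType).
Variables (mu : {measure set T -> \bar R}) (C : countType).
Variable code : nat -> T -> C.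

(** A grid is encoded by a labelling of the points at each level; the cubes are
    the classes of points with the same label, so that two cubes of one level
    are equal or disjoint by construction. *)
Definition grid_cube j x : set T := [set y | code j y = code j x].

Notation cube := grid_cube.

Record grid (D : R) : Prop := Grid {
  grid_measurable : forall j c, measurable [set y | code j y = c] ;
  grid_nested : forall j x y, code j.+1 x = code j.+1 y -> code j x = code j y ;
  grid_gt0 : forall j x, 0 < mu (cube j x) ;
  grid_lty : forall j x, mu (cube j x) < +oo ;
  grid_doubling : forall j x, mu (cube j x) <= D%:E * mu (cube j.+1 x) ;
  grid_generates : measurable `<=` <<s [set A | exists j x, A = cube j x] >> }.

Variables (D : R) (G : grid D).

Lemma cube_eq j x y : cube j x y -> cube j y = cube j x.
Proof. by rewrite /grid_cube /= => ->. Qed.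

Lemma measurable_cube j x : measurable (cube j x).
Proof. exact: (grid_measurable G j (code j x)). Qed.
Hint Resolve measurable_cube : core.

Lemma code_nested i j x y : (i <= j)%N -> code j x = code j y -> code i x = code i y.
Proof.
move=> /subnK <-; elim: (j - i)%N => //= k IH /(grid_nested G); exact: IH.
Qed.

Lemma cube_subset i j x : (i <= j)%N -> cube j x `<=` cube i x.
Proof. by move=> ij y /(code_nested ij). Qed.

Lemma measurable_saturated j (S : set T) :
  (forall x, S x -> cube j x `<=` S) -> measurable S.
Proof.
move=> satS.
have -> : S = \bigcup_(c in [set code j x | x in S]) [set y | code j y = c].
  apply/seteqP; split=> [x Sx|x [_ [y Sy <-] /= xy]]; last exact: (satS y).
  by exists (code j x) => //; exists x.
rewrite bigcup_mkcond; apply: countable_bigcupT_measurable => // c.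
by case: ifPn => // _; exact: (grid_measurable G).
Qed.

Lemma measurable_step j (h : T -> R) : (forall x y, cube j x y -> h y = h x) ->
  measurable_fun [set: T] h.
Proof.
move=> hE _ B mB; rewrite setTI; apply: (@measurable_saturated j) => x /= Bx y yx.
by rewrite /= (hE x).
Qed.

Lemma level_le j A (F H : T -> \bar R) :
  (forall x, 0 <= F x) -> (forall x, 0 <= H x) ->
  measurable_fun [set: T] F -> measurable_fun [set: T] H ->
  (forall x, A x -> cube j x `<=` A /\
    \int[mu]_(y in cube j x) F y <= \int[mu]_(y in cube j x) H y) ->
  \int[mu]_(y in A) F y <= \int[mu]_(y in A) H y.
Proof.
move=> F0 H0 mF mH AFH.
pose B (k : nat) := [set y | A y /\ pickle (code j y) = k].
have mB k : measurable (B k).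
  apply: (@measurable_saturated j) => x [Ax xk] y yx; split.
    by have [+ _] := AFH x Ax; apply.
  by rewrite yx.
have AB : A = \bigcup_k B k.
  by apply/seteqP; split=> [x Ax|x [k _ []]//]; exists (pickle (code j x)).
have tB : trivIset setT B by move=> i k _ _ [y [[_ <-] [_ <-]]].
rewrite AB !ge0_integral_bigcup//; [|exact: measurable_funS mH|exact: measurable_funS mF].
apply: lee_nneseries => [k _ _|k _]; first exact: integral_ge0.
have [[x [Ax xk]]|B0] := pselect (exists x, B k x).
  suff -> : B k = cube j x by have [] := AFH x Ax.
  apply/seteqP; split=> y; first by move=> [_]; rewrite -xk => /(pcan_inj pickleK).
  by move=> yx; split; [have [+ _] := AFH x Ax; apply|rewrite yx].
suff -> : B k = set0 by rewrite !integral_set0.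
by apply/seteqP; split=> // y Bky; apply: B0; exists y.
Qed.

(** This replaces maximal-cube decompositions everywhere below.
    The coarsest cubes on which the inequality holds are pairwise disjoint:
    sorting points by the level of that cube reduces to one level. *)
Lemma stopping_le A (F H : T -> \bar R) :
  (forall x, 0 <= F x) -> (forall x, 0 <= H x) ->
  measurable_fun [set: T] F -> measurable_fun [set: T] H ->
  (forall x, A x -> exists j, cube j x `<=` A /\
    \int[mu]_(y in cube j x) F y <= \int[mu]_(y in cube j x) H y) ->
  \int[mu]_(y in A) F y <= \int[mu]_(y in A) H y.
Proof.
move=> F0 H0 mF mH AFH.
pose P j := [set x | cube j x `<=` A /\
    \int[mu]_(y in cube j x) F y <= \int[mu]_(y in cube j x) H y].
have satP i j x y : (i <= j)%N -> cube j x y -> P i y <-> P i x.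
  by move=> ij /(cube_subset ij)/cube_eq yx; rewrite /P /= yx.
have sat j x : seqDU P j x -> cube j x `<=` seqDU P j.
  rewrite /seqDU /= -bigcup_mkord => -[Px nPx] y yx; split; first exact/(satP _ _ _ _ (leqnn j) yx).
  by move=> [i /= ij Piy]; apply: nPx; exists i => //; exact/(satP _ _ _ _ (ltnW ij) yx).
have AP : A = \bigcup_j P j.
  apply/seteqP; split=> [x /AFH[j Pj]|x [j _ [+ _]]]; first by exists j.
  exact.
rewrite AP seqDU_bigcup_eq !ge0_integral_bigcup//; try exact: trivIset_seqDU;
  try exact: (measurable_funS measurableT);
  try by move=> k; apply: (@measurable_saturated k); exact: sat.
apply: lee_nneseries => [k _ _|k _]; first exact: integral_ge0.
apply: (@level_le k) => // x Dx; split; first exact: sat.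
by have [[]] := Dx.
Qed.

End grid.

Section fatou.
Local Open Scope ereal_scope.
Context d (T : measurableType d) (R : realType).
Variable mu : {measure set T -> \bar R}.

(** Fatou's lemma in the form used for truncations: a bound on the integrals of
    the [f n] passes to any [F] that they eventually dominate pointwise. *)
Lemma integral_le_eventually (A : set T) (f : nat -> T -> \bar R) (F : T -> \bar R)
    (K : \bar R) : measurable A ->
  (forall n, measurable_fun A (f n)) -> (forall n x, A x -> 0 <= f n x) ->
  measurable_fun A F -> (forall x, A x -> 0 <= F x) ->
  (forall x (z : R), A x -> z%:E < F x ->
     exists N, forall n, (N <= n)%N -> z%:E <= f n x) ->
  (forall n, \int[mu]_(x in A) f n x <= K) ->
  \int[mu]_(x in A) F x <= K.
Proof.
move=> mA mf f0 mF F0 Ff fK.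
have l0 x : A x -> 0 <= limn_einf (f^~ x).
  move=> Ax; rewrite limn_einf_lim; apply: lime_ge; first exact: is_cvg_einfs.
  by apply: nearW => n; apply: le_ereal_inf_tmp => _ [k _ <-]; exact: f0.
apply: (@le_trans _ _ (\int[mu]_(x in A) limn_einf (f^~ x))).
  apply: ge0_le_integral => //.
    rewrite (_ : (fun x => _) = fun x => - limn_esup (fun n => - f n x)).
      apply: measurableT_comp => //; apply: measurable_fun_limn_esup => n.
      exact: measurableT_comp.
    by [].
  move=> x Ax; rewrite leNgt; apply/negP => xF.
  have {}l0 := l0 x Ax.
  have [z [lz zF]] : exists z : R, limn_einf (f^~ x) < z%:E /\ z%:E < F x.
    move: l0 xF; case: (limn_einf _) => [y||]//; case: (F x) => [w||]// _.
      by rewrite lte_fin => yw; exists ((y + w) / 2)%R; rewrite !lte_fin; split; lra.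
    by exists (y + 1)%R; rewrite lte_fin ltry; split => //; lra.
  have [N Nf] := Ff x z Ax zF.
  move: lz; rewrite limn_einf_lim ltNge => /negP; apply.
  apply: lime_ge; first exact: is_cvg_einfs.
  exists N => // n /= Nn; apply: le_ereal_inf_tmp => _ [k /= nk <-].
  exact/Nf/(leq_trans Nn).
apply: (le_trans (fatou mu mA mf f0)).
rewrite limn_einf_lim; apply: lime_le; first exact: is_cvg_einfs.
apply: nearW => n; apply: ge_ereal_inf.
by exists (\int[mu]_(x in A) f n x) => //; exists n => /=.
Qed.

End fatou.

(** * Differentiation along a grid *)

Section differentiation.
Local Open Scope ereal_scope.
Context d (T : measurableType d) (R : realType).
Variables (mu : {measure set T -> \bar R}) (C : countType).
Variables (code : nat -> T -> C) (D : R) (G : grid mu code D).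
Notation cube := (grid_cube code).

Let mcube j x : measurable (cube j x). Proof. exact: (measurable_cube G). Qed.
Hint Resolve mcube : core.

Section regularity.
Variables (j0 : nat) (x0 : T).
Let Q := cube j0 x0.

(** Openness for the topology generated by the cubes of level at least [j0]: the
    cubes at a point of [Q] then stay inside [Q], which has finite measure. *)
Definition cube_open (U : set T) : Prop :=
  forall x, U x -> exists2 j, (j0 <= j)%N & cube j x `<=` U.

Lemma measurable_cube_open U : cube_open U -> measurable U.
Proof.
move=> oU; pose P j := [set x | (j0 <= j)%N /\ cube j x `<=` U].
have -> : U = \bigcup_j P j.
  apply/seteqP; split => [x /oU[j j0j xU]|x [j _ [_]]]; last exact.
  by exists j.
apply: bigcupT_measurable => j.
apply: (measurable_saturated G (j:=j)) => x [j0j xU] y yx; split => //.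
by rewrite (@cube_eq _ _ _ code j x y).
Qed.

Definition outer_approx (A : set T) : Prop := forall e : R, (0 < e)%R ->
  exists U, [/\ U `<=` Q, Q `&` A `<=` U, cube_open U & mu (U `\` A) <= e%:E].

Let regular (A : set T) : Prop :=
  [/\ measurable A, outer_approx A & outer_approx (~` A)].

Lemma outer_approxT A : Q `<=` A -> outer_approx A.
Proof.
move=> QA e e0; exists Q; split => //; try by move=> y [].
  by move=> y yQ; exists j0; rewrite // (@cube_eq _ _ _ code _ x0 y).
by rewrite (_ : Q `\` A = set0) ?measure0 ?lee_fin ?ltW// setD_eq0.
Qed.

Lemma outer_approx_cubeI j x : outer_approx (cube j x).
Proof.
move=> e e0; exists (Q `&` cube j x); split => //; try by move=> y [].
- move=> y [yQ yx]; exists (maxn j0 j); first exact: leq_maxl.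
  move=> z zy; split.
    rewrite /Q -(@cube_eq _ _ _ code _ x0 y)//.
    by apply: (cube_subset G) zy; exact: leq_maxl.
  rewrite -(@cube_eq _ _ _ code _ x y)//.
  by apply: (cube_subset G) zy; exact: leq_maxr.
- by rewrite (_ : _ `\` _ = set0) ?measure0 ?lee_fin ?ltW// setD_eq0 => y [].
Qed.

Lemma outer_approx_cubeC j x : outer_approx (~` cube j x).
Proof.
move=> e e0; exists (Q `\` cube j x); split => //; try by move=> y [].
- move=> y [yQ yx]; exists (maxn j0 j); first exact: leq_maxl.
  move=> z zy; split.
    rewrite /Q -(@cube_eq _ _ _ code _ x0 y)//.
    by apply: (cube_subset G) zy; exact: leq_maxl.
  move=> zx; apply: yx; rewrite /grid_cube /= -zx; apply/esym.
  exact: (cube_subset G (leq_maxr j0 j) zy).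
- by rewrite (_ : _ `\` _ = set0) ?measure0 ?lee_fin ?ltW// setD_eq0 => y [].
Qed.

Lemma outer_approx_bigcup (F : (set T)^nat) : (forall n, measurable (F n)) ->
  (forall n, outer_approx (F n)) -> outer_approx (\bigcup_n F n).
Proof.
move=> mF aF e e0.
have /choice[U HU] n : exists U, [/\ U `<=` Q, Q `&` F n `<=` U, cube_open U
    & mu (U `\` F n) <= (e / (2 ^ n.+1)%:R)%:E].
  by apply: aF; rewrite divr_gt0// ltr0n expn_gt0.
have mU n : measurable (U n) by apply: measurable_cube_open; have [] := HU n.
exists (\bigcup_n U n); split.
- by move=> y [n _]; have [+ _ _ _] := HU n; apply.
- by move=> y [yQ [n _ yF]]; exists n => //; have [_ + _ _] := HU n; apply.
- move=> y [n _ yU]; have [_ _ oU _] := HU n; have [j j0j jU] := oU y yU.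
  by exists j => // z /jU zU; exists n.
- apply: (@le_trans _ _ (\sum_(n <oo) mu (U n `\` F n))).
    apply: measure_sigma_subadditive => //.
    + by move=> n; exact: measurableD.
    + by apply: measurableD; exact: bigcupT_measurable.
    + move=> y [[n _ yU] nF]; exists n => //; split => // yF; apply: nF.
      by exists n.
  apply: (@le_trans _ _ (\sum_(n <oo) (e / (2 ^ n.+1)%:R)%:E)).
    by apply: lee_nneseries => // n _; have [] := HU n.
  by apply: epsilon_trick0; exact: ltW.
Qed.

(** A countable intersection is not open, but finite ones are, and their measures
    decrease to that of the intersection. *)
Lemma outer_approx_bigcap (F : (set T)^nat) : (forall n, measurable (F n)) ->
  (forall n, outer_approx (F n)) -> outer_approx (\bigcap_n F n).
Proof.
move=> mF aF e e0.
have e20 : (0 < e / 2)%R by rewrite divr_gt0.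
have /choice[V HV] n : exists U, [/\ U `<=` Q, Q `&` F n `<=` U, cube_open U
    & mu (U `\` F n) <= (e / 2 / (2 ^ n.+1)%:R)%:E].
  by apply: aF; rewrite divr_gt0// ltr0n expn_gt0.
have mV n : measurable (V n) by apply: measurable_cube_open; have [] := HV n.
pose W N := \bigcap_(n in [set n | (n <= N)%N]) V n.
have mW N : measurable (W N).
  by apply: bigcap_measurable => [|n _//]; exists 0%N.
have oW N : cube_open (W N).
  elim: N => [|N IH].
    move=> y yW; have [_ _ oV _] := HV 0%N; have [j j0j jV] := oV y (yW 0%N erefl).
    by exists j => // z /jV zV n; rewrite /= leqn0 => /eqP ->.
  move=> y yW; have [_ _ oV _] := HV N.+1; have [j j0j jV] := oV y (yW N.+1 (leqnn _)).
  have [n nN|j' j0j' jW] := IH y; first by apply: yW; exact: leqW.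
  exists (maxn j j'); first by rewrite (leq_trans j0j)// leq_maxl.
  move=> z zy n /=; rewrite leq_eqVlt => /orP[/eqP ->|nN].
    by apply: jV; apply: (cube_subset G) zy; exact: leq_maxl.
  apply: jW => //.
  by apply: (cube_subset G) zy; exact: leq_maxr.
pose B N := W N `\` \bigcap_n F n.
have mIF : measurable (\bigcap_n F n) by exact: bigcapT_measurable.
have mB N : measurable (B N) by exact: measurableD.
have muBoo : mu (\bigcap_N B N) <= (e / 2)%:E.
  apply: (@le_trans _ _ (\sum_(n <oo) mu (V n `\` F n))).
    apply: measure_sigma_subadditive => //.
    + by move=> n; exact: measurableD.
    + exact: bigcapT_measurable.
    + move=> y yB; have [_ nF] := yB 0%N I.
      have [n nFn] : exists n, ~ F n y.
        by apply/existsNP => yF; apply: nF => n _; exact: yF.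
      by exists n => //; split => //; have [+ _] := yB n I; apply => /=.
  apply: (@le_trans _ _ (\sum_(n <oo) (e / 2 / (2 ^ n.+1)%:R)%:E)).
    by apply: lee_nneseries => // n _; have [] := HV n.
  by apply: epsilon_trick0; exact: ltW.
have cvgB : mu (B N) @[N --> \oo] --> mu (\bigcap_N B N).
  apply: nonincreasing_cvg_mu => //.
  - apply: (le_lt_trans _ (grid_lty G j0 x0)).
    apply: le_measure; rewrite ?inE//.
    by move=> y [/(_ 0%N erefl) + _]; have [+ _ _ _] := HV 0%N; apply.
  - exact: bigcapT_measurable.
  - apply/nonincreasing_seqP => N; apply/subsetPset; apply: setSD.
    by move=> y yW n nN; apply: yW; exact: leqW.
have [N BN] : exists N, mu (B N) < e%:E.
  apply: contrapT => /forallNP eB.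
  have : e%:E <= mu (\bigcap_N B N).
    apply: (cvge_to_ge cvgB); apply: nearW => N.
    by rewrite leNgt; apply/negP; exact: eB.
  by move/le_trans => /(_ _ muBoo); rewrite lee_fin; lra.
exists (W N); split => //.
- by move=> y /(_ 0%N erefl); have [+ _ _ _] := HV 0%N; apply.
- by move=> y [yQ yF] n _; have [_ + _ _] := HV n; apply; split => //; exact: yF.
- exact: ltW.
Qed.

(** The sets approximable from outside together with their complement form a
    sigma-algebra that contains the cubes. *)
Lemma measurable_outer_approx A : measurable A -> outer_approx A.
Proof.
move=> /(grid_generates G) mA.
suff : regular A by case.
apply: (mA regular); split.
- split.
  + split => //; last by apply: outer_approxT; rewrite setC0.
    move=> e e0; exists set0; split; rewrite ?setI0 ?set0D ?measure0 ?lee_fin ?ltW//.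
  + move=> B [mB aB aCB]; rewrite setTD; split => //; last by rewrite setCK.
    exact: measurableC.
  + move=> F HF; split.
    * by apply: bigcupT_measurable => n; have [] := HF n.
    * by apply: outer_approx_bigcup => n; have [] := HF n.
    * rewrite setC_bigcup; apply: outer_approx_bigcap => n; have [] := HF n => //.
      by move=> ? _ _; exact: measurableC.
- move=> _ [j [x ->]]; split => //; first exact: outer_approx_cubeI.
  exact: outer_approx_cubeC.
Qed.

End regularity.

(** A weak form of Lebesgue's differentiation theorem. Cover [H] by an open [U]
    with little excess, and keep the cubes of [U] that meet [H]: on those, hence
    on their union, the average of [g] is at most [l]. *)
Lemma integral_le_of_averages j0 x0 (H : set T) (g : T -> R) (l : R) :
  H `<=` cube j0 x0 -> measurable H -> measurable_fun [set: T] g ->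
  (forall x, (0 <= g x)%R) -> (0 <= l)%R ->
  (forall x j, H x -> (j0 <= j)%N ->
    \int[mu]_(y in cube j x) (g y)%:E <= l%:E * mu (cube j x)) ->
  \int[mu]_(y in H) (g y)%:E <= l%:E * mu H.
Proof.
move=> HQ mH mg g0 l0 Hg.
apply/lee_addgt0Pr => e e0.
have e1 : (0 < e / (l + 1))%R by rewrite divr_gt0//; lra.
have [U [UQ HU oU muU]] := measurable_outer_approx j0 x0 mH e1.
have mU := measurable_cube_open oU.
have {}HU : H `<=` U by move=> x Hx; apply: HU; split => //; exact: HQ.
pose V := [set y | exists j, [/\ (j0 <= j)%N, cube j y `<=` U & cube j y `&` H !=set0]].
have oV : cube_open j0 V.
  move=> y [j [j0j jU jH]]; exists j => // z zy; exists j.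
  by rewrite (@cube_eq _ _ _ code j y z).
have HV : H `<=` V.
  by move=> x Hx; have [j ? ?] := oU x (HU _ Hx); exists j; split => //; exists x.
have VU : V `<=` U by move=> y [j [_ jU _]]; exact: jU.
have mV := measurable_cube_open oV.
apply: (@le_trans _ _ (\int[mu]_(y in V) (g y)%:E)); first exact: rint_subset.
apply: (@le_trans _ _ (\int[mu]_(y in V) l%:E)).
  apply: (stopping_le G (A:=V) (F:=fun y => (g y)%:E) (H:=fun=> l%:E)) => //.
  - exact: measurable_real_integrand.
  - move=> y [j [j0j jU [z [zy Hz]]]]; exists j; split.
      by move=> w wy; exists j; rewrite (@cube_eq _ _ _ code j y w)//; split => //; exists z.
    by rewrite rint_cst// -(@cube_eq _ _ _ code j y z)//; exact: Hg.
rewrite rint_cst//.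
apply: (@le_trans _ _ (l%:E * mu U)).
  by apply: lee_pmul => //; apply: le_measure; rewrite ?inE.
have -> : U = H `|` (U `\` H) by rewrite setDUK.
rewrite measureU//; [|exact: measurableD|by rewrite setDIK].
rewrite ge0_muleDr// leeD2l//.
apply: (@le_trans _ _ (l%:E * (e / (l + 1))%:E)); first exact: lee_pmul.
rewrite -EFinM lee_fin mulrA ler_pdivrMr; last lra.
by rewrite mulrC ler_pM2l//; lra.
Qed.

End differentiation.

(** * The John-Nirenberg inequality *)

Section john_nirenberg.
Local Open Scope ereal_scope.
Context d (T : measurableType d) (R : realType).
Variables (mu : {measure set T -> \bar R}) (C : countType).
Variables (code : nat -> T -> C) (D : R) (G : grid mu code D).
Notation cube := (grid_cube code).

Let mcube j x : measurable (cube j x). Proof. exact: (measurable_cube G). Qed.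
Hint Resolve mcube : core.

Lemma cube_measureE j x : exists2 m : R, (0 < m)%R & mu (cube j x) = m%:E.
Proof.
have := grid_gt0 G j x; have := grid_lty G j x.
by case: (mu _) => [m _||//] //; rewrite lte_fin => m0; exists m.
Qed.

Lemma grid_doubling_ge1 (x : T) : (1 <= D)%R.
Proof.
have [m m0 mE] := cube_measureE 0 x; have [m' m'0 mE'] := cube_measureE 1 x.
have : mu (cube 1 x) <= mu (cube 0 x).
  by rewrite le_measure ?inE//; exact: (cube_subset G).
have := grid_doubling G 0 x; rewrite mE mE' -EFinM !lee_fin; nra.
Qed.

Variables (b : T -> R) (c : nat -> T -> R) (A : R).
Hypotheses (A0 : (0 < A)%R) (mb : measurable_fun [set: T] b).
Hypothesis oscb : forall j x,
  \int[mu]_(y in cube j x) `|b y - c j x|%:E <= A%:E * mu (cube j x).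

(** Chosen so that the exponential doubles when its argument grows by the jump
    [a + 4 a k] of the constants between a cube and one stopped inside it. *)
Definition jn_exponent (a k : R) : R := (ln 2 / (a + 4 * a * k))%R.
Let e := jn_exponent A D.
Let L := (A + 4 * A * D)%R.

Let mosc k : measurable_fun [set: T] (fun y => `|b y - k|%R).
Proof. by apply: measurableT_comp => //; apply: measurable_funB. Qed.
Hint Resolve mosc : core.

(* The truncation makes all the integrals finite. *)
Let phi (M t : R) : R := Num.min (expR (e * t)) M.

Let mphi M k : measurable_fun [set: T] (fun y => phi M `|b y - k|%R).
Proof.
apply: measurable_minr => //; apply: measurableT_comp => //.
exact: measurable_funM.
Qed.
Hint Resolve mphi : core.

(** Calderon-Zygmund stopping: inside a cube [Q], stop at the first subcubes on
    which the average of [|b - c|] exceeds [l = 4 A]. They fill at most a quarter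
    of [Q], and on each of them the constant has moved by at most [L], so the
    bound [K] comes back there with a factor [2 / 4]. Outside them
    [|b - c| < 2 l] almost everywhere, by differentiation. *)
Lemma john_nirenberg_step (K M : R) : (0 <= M)%R -> (0 <= K)%R ->
  (forall j x, \int[mu]_(y in cube j x) (phi M `|b y - c j x|%R)%:E <=
               K%:E * mu (cube j x)) ->
  forall j x, \int[mu]_(y in cube j x) (phi M `|b y - c j x|%R)%:E <=
              (4 + K / 2)%:E * mu (cube j x).
Proof.
move=> M0 K0 HK j x.
have D1 := grid_doubling_ge1 x.
have D0 : (0 < D)%R := lt_le_trans ltr01 D1.
have L0 : (0 < L)%R by rewrite addr_gt0// !mulr_gt0.
have e0 : (0 < e)%R by rewrite divr_gt0// ln_gt0// ltr1n.
have eL : expR (e * L) = 2%R by rewrite /e /jn_exponent -/L divfK ?gt_eqF// lnK// posrE.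
have phi0 t : (0 <= phi M t)%R by rewrite le_min expR_ge0.
set Q := cube j x; pose beta y := `|b y - c j x|%R.
pose l := (4 * A)%R.
have l0 : (0 < l)%R by rewrite mulr_gt0.
pose P i y := (j <= i)%N /\ l%:E * mu (cube i y) < \int[mu]_(z in cube i y) (beta z)%:E.
pose S := [set y | Q y /\ exists i, P i y].
have oS : cube_open code j S.
  move=> y [Qy [i [ji Pi]]]; exists i => // z zy; split.
    by rewrite /Q -(cube_eq Qy); apply: (cube_subset G) zy.
  by exists i; split => //; rewrite (cube_eq zy).
have mS : measurable S := measurable_cube_open G oS.
have SQ : S `<=` Q by move=> y [].
have mQ : measurable Q by exact: mcube.
have QE : Q = S `|` (Q `\` S) by rewrite setDUK.
have intS : \int[mu]_(y in S) (phi M (beta y))%:E <= (K / 2)%:E * mu Q.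
  apply: (@le_trans _ _ (\int[mu]_(y in S) (2 * K / l * beta y)%:E)).
    apply: (stopping_le G (A:=S) (F:=fun y => (phi M (beta y))%:E)
      (H:=fun y => (2 * K / l * beta y)%:E)).
    - by move=> y; rewrite lee_fin.
    - by move=> y; rewrite lee_fin mulr_ge0 ?normr_ge0// divr_ge0 ?mulr_ge0// ltW.
    - by apply: measurable_real_integrand; exact: mphi.
    - by apply: measurable_real_integrand; apply: measurable_funM => //; exact: mosc.
    move=> y [Qy exP].
    have : exists i, `[< P i y >] by have [i Pi] := exP; exists i; exact/asboolP.
    move/ex_minnP => [i /asboolP[ji Pi] imin].
    have [ij|ij] := eqVneq i j.
      move: Pi; rewrite ij (cube_eq Qy) => /lt_le_trans /(_ (oscb j x)).
      have [m m0 ->] := cube_measureE j x; rewrite -!EFinM lte_fin ltr_pM2r// /l => lA.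
      have : (A < 4 * A)%R by move: A0; lra.
      by move=> /(lt_trans lA); rewrite ltxx.
    case: i => [|i] in ji Pi imin ij *; first by move: ij; rewrite leqn0 in ji; rewrite eq_sym ji.
    have {}ji : (j <= i)%N by rewrite -ltnS ltn_neqAle eq_sym ij.
    have nPi : \int[mu]_(z in cube i y) (beta z)%:E <= l%:E * mu (cube i y).
      rewrite leNgt; apply/negP => lPi.
      by have /asboolP/imin : P i y by []; rewrite ltnn.
    have yS : cube i.+1 y `<=` S.
      move=> z zy; split.
        by rewrite /Q -(cube_eq Qy); apply: (cube_subset G) zy; exact: leqW.
      by exists i.+1; split; [exact: leqW|rewrite (cube_eq zy)].
    exists i.+1; split => //.
    have [m m0 mE] := cube_measureE i.+1 y.
    have cc : (`|c i.+1 y - c j x| <= L)%R.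
      suff : (`|c i.+1 y - c j x|%:E * m%:E <= L%:E * m%:E)%E.
        by rewrite -!EFinM lee_fin ler_pM2r.
      rewrite -mE -rint_cst//.
      apply: (@le_trans _ _ (\int[mu]_(z in cube i.+1 y)
          (`|b z - c i.+1 y| + beta z)%:E)).
        apply: rint_le => //; first by apply: measurable_funD; exact: mosc.
        move=> z _; rewrite /beta [leRHS]addrC.
        rewrite (_ : c i.+1 y - c j x = (b z - c j x) - (b z - c i.+1 y))%R; last ring.
        exact: ler_normB.
      rewrite rintD//; [|exact: mosc|by move=> z; exact: normr_ge0].
      have mfin : mu (cube i.+1 y) \is a fin_num by rewrite mE.
      rewrite /L EFinD muleDl// ?leeD// ?fin_num_adde_defl//.
      apply: (@le_trans _ _ (\int[mu]_(z in cube i y) (beta z)%:E)).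
        apply: rint_subset => //; [exact: mosc|by move=> z; exact: normr_ge0|].
        exact: (cube_subset G).
      apply: (le_trans nPi); rewrite [in leRHS]EFinM -muleA lee_pmul2l//.
      exact: (grid_doubling G).
    apply: (@le_trans _ _ (\int[mu]_(z in cube i.+1 y)
        (2 * phi M `|b z - c i.+1 y|)%:E)).
      apply: rint_le => //; [exact: mphi|by apply: measurable_funM => //; exact: mphi|].
      move=> z _; have bt : (beta z <= `|b z - c i.+1 y| + L)%R.
        rewrite /beta (_ : b z - c j x = (b z - c i.+1 y) + (c i.+1 y - c j x))%R; last ring.
        by rewrite (le_trans (ler_normD _ _))// lerD2l.
      have eb : (expR (e * beta z) <= 2 * expR (e * `|b z - c i.+1 y|))%R.
        by rewrite -eL -expRD addrC -mulrDr ler_expR ler_pM2l.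
      rewrite /phi /Num.min; case: ifP => [/ltW EM|/negbT ME];
        case: ifP => // _.
      - by apply: (le_trans EM); rewrite ler_peMl// ler1n.
      - by apply: le_trans eb; rewrite leNgt.
      - by rewrite ler_peMl// ler1n.
    rewrite rintZ//.
    apply: (@le_trans _ _ (2%:E * (K%:E * m%:E))).
      by rewrite lee_pmul2l//; rewrite -mE; exact: HK.
    rewrite rintZ//; [|exact: mosc|by move=> z; exact: normr_ge0|].
      apply: (@le_trans _ _ ((2 * K / l)%:E * (l%:E * m%:E))).
        rewrite -!EFinM lee_fin (_ : 2 * K / l * (l * m) = 2 * (K * m))%R//.
        by field; rewrite gt_eqF.
      rewrite -mE; apply: lee_wpmul2l; last exact: ltW.
      by rewrite lee_fin divr_ge0 ?mulr_ge0// ltW.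
    by rewrite divr_ge0 ?mulr_ge0// ltW.
  have kl : (0 <= 2 * K / l)%R by rewrite divr_ge0 ?mulr_ge0// ltW.
  rewrite rintZ//; [|exact: mosc|by move=> z; exact: normr_ge0].
  apply: (@le_trans _ _ ((2 * K / l)%:E * (A%:E * mu Q))).
    apply: lee_wpmul2l; first by rewrite lee_fin.
    apply: le_trans (oscb j x); apply: rint_subset => //; first exact: mosc.
    by move=> z; exact: normr_ge0.
  rewrite muleA -EFinM (_ : 2 * K / l * A = K / 2)%R// /l; field.
  by rewrite gt_eqF.
pose H := (Q `\` S) `&` [set y | (2 * l <= beta y)%R].
have mH : measurable H.
  apply: measurableI; first by apply: measurableD => //; exact: mcube.
  have := mosc (c j x) measurableT (measurable_itv `[(2 * l)%R, +oo[).
  by congr measurable; apply/seteqP; split=> y; rewrite /= in_itv/= andbT => -[].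
have HE : \int[mu]_(y in H) (beta y)%:E <= l%:E * mu H.
  apply: (integral_le_of_averages G (j0:=j) (x0:=x)) => //.
  - by move=> y [[]].
  - exact: mosc.
  - by move=> y; exact: normr_ge0.
  - exact: ltW.
  - move=> y i [[Qy nS] _] ji; rewrite leNgt; apply/negP => lt; apply: nS.
    by split => //; exists i.
have H0 : mu H = 0.
  have muHfin : mu H < +oo.
    apply: (le_lt_trans _ (grid_lty G j x)); rewrite le_measure ?inE//.
    by move=> y [[]].
  have : (2 * l)%:E * mu H <= l%:E * mu H.
    apply: le_trans HE; rewrite -rint_cst//; apply: rint_le => //.
    + exact: mosc.
    + by move=> _; rewrite mulr_ge0// ltW.
    + by move=> y [].
  have muH0 : 0 <= mu H by [].
  move: muHfin muH0; case: (mu H) => [m _||]//.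
  rewrite -!EFinM !lee_fin => m0 lm; congr EFin.
  apply/eqP; rewrite eq_le m0 andbT -(ler_pM2l l0) mulr0; lra.
have intE : \int[mu]_(y in Q `\` S) (phi M (beta y))%:E <= 4%:E * mu Q.
  rewrite (ge0_negligible_integral mH)//; first last.
  - by move=> y _; rewrite lee_fin.
  - by apply: measurable_real_integrand; exact: mphi.
  - exact: measurableD.
  apply: (@le_trans _ _ (\int[mu]_(y in (Q `\` S) `\` H) 4%:E)).
    apply: rint_le => //; first by apply: measurableD => //; exact: measurableD.
    - exact: mphi.
    - move=> y [QSy nHy]; rewrite /phi ge_min; apply/orP; left.
      rewrite (_ : 4 = expR (e * (2 * L)))%R; last first.
        by rewrite mulrCA expRM_natl eL -natrX.
      rewrite ler_expR ler_pM2l//.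
      have [//|bl] := leP (beta y) (2 * L)%R.
      exfalso; apply: nHy; split => //=.
      apply: le_trans (ltW bl); rewrite ler_pM2l// /l /L.
      by have : (A * 1 <= A * D)%R; [rewrite ler_pM2l|move: A0; lra].
  rewrite rint_cst; last by apply: measurableD => //; exact: measurableD.
  rewrite lee_pmul2l// le_measure ?inE//; last by move=> y [[]].
  by apply: measurableD => //; exact: measurableD.
rewrite -/Q QE ge0_integral_setU//; last 4 first.
- exact: measurableD.
- by rewrite -QE; apply: measurable_real_integrand; exact: mphi.
- by move=> y _; rewrite lee_fin.
- by rewrite disj_set2E setDIK.
have [m m0 mE] := cube_measureE j x.
by rewrite -QE /Q mE EFinD muleDl ?fin_num_adde_defl// addeC leeD// -mE.
Qed.

(** The fixed point of [K |-> 4 + K / 2] is 8. Starting from the trivial bound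
    [K = 8 + M], iterating the previous step brings [K] below 9 whatever the
    truncation [M]. *)
Theorem john_nirenberg j x :
  \int[mu]_(y in cube j x) (expR (e * `|b y - c j x|))%:E <= 9%:E * mu (cube j x).
Proof.
have phi0 (M : nat) t : (0 <= phi M%:R t)%R by rewrite le_min expR_ge0 ler0n.
have iter (M k : nat) i y : \int[mu]_(z in cube i y) (phi M%:R `|b z - c i y|%R)%:E <=
    (8 + M%:R / 2 ^+ k)%:E * mu (cube i y).
  elim: k i y => [|k IH] i y.
    rewrite -rint_cst//; apply: rint_le => //.
    by move=> z _; rewrite /phi ge_min; apply/orP; right; rewrite expr0 divr1; lra.
  rewrite (_ : 8 + M%:R / 2 ^+ k.+1 = 4 + (8 + M%:R / 2 ^+ k) / 2)%R.
    by apply: john_nirenberg_step => //; rewrite addr_ge0// divr_ge0// exprn_ge0.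
  by rewrite exprS; field; rewrite expf_neq0.
apply: (integral_le_eventually
    (f:=fun M y => (phi M%:R `|b y - c j x|%R)%:E)) => //.
- by move=> M; apply: measurable_real_integrand; exact: mphi.
- by move=> M y _; rewrite lee_fin.
- by apply: measurable_real_integrand; apply: measurableT_comp => //; exact: measurable_funM.
- move=> y z _; rewrite lte_fin => zE.
  exists (Num.truncn (expR (e * `|b y - c j x|%R))).+1 => n Nn.
  rewrite lee_fin le_min (ltW zE)/= (le_trans (ltW zE))// ltW//.
  by rewrite (lt_le_trans (truncnS_gt _))// ler_nat.
- move=> M; apply: (le_trans (iter M M j x)).
  have [m m0 ->] := cube_measureE j x; rewrite -!EFinM lee_fin ler_pM2r//.
  rewrite (_ : 9 = 8 + 1)%R ?lerD2l; last ring.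
  by rewrite ler_pdivrMr ?exprn_gt0// mul1r -natrX ler_nat ltnW// ltn_expl.
Qed.

End john_nirenberg.

(** * The weighted maximal function of a grid *)

Definition doob_const (R : realType) (r : R) : R :=
  r / (r - 1) * (2 * (r / (r - 1))) `^ (r - 1).

Section maximal_function.
Local Open Scope ereal_scope.
Context d (T : measurableType d) (R : realType).
Variables (mu : {measure set T -> \bar R}) (C : countType).
Variables (code : nat -> T -> C) (D : R) (G : grid mu code D).
Notation cube := (grid_cube code).

Let mcube j x : measurable (cube j x). Proof. exact: (measurable_cube G). Qed.
Hint Resolve mcube : core.

Definition weighted_average (v g : T -> R) j x : R :=
  (fine (\int[mu]_(y in cube j x) (g y * v y)%:E) /
   fine (\int[mu]_(y in cube j x) (v y)%:E))%R.

(** The running maximum [m] is an argument, so that an induction on [N] can start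
    again from a child cube with an updated maximum. *)
Fixpoint max_averages (S : nat -> T -> R) N j m y : R :=
  if N is k.+1 then max_averages S k j.+1 (Num.max m (S j.+1 y)) y else m.

Lemma max_averages_ge S N j m y : (m <= max_averages S N j m y)%R.
Proof.
elim: N j m => //= N IH j m; apply: le_trans (IH _ _).
by rewrite le_max lexx.
Qed.

Lemma le_max_averages S N j i m y : (j < i <= j + N)%N ->
  (S i y <= max_averages S N j m y)%R.
Proof.
elim: N j m => [|N IH] j m /=; first by rewrite addn0 ltnNge => /andP[/negP].
move=> /andP[ji]; have [->|ij] := eqVneq i j.+1.
  by move=> _; apply: le_trans (max_averages_ge _ _ _ _ _); rewrite le_max lexx orbT.
by rewrite addnS -addSn => iN; apply: IH; rewrite iN andbT ltn_neqAle eq_sym ij.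
Qed.

Variables (v g : T -> R) (r : R).
Hypotheses (mv : measurable_fun [set: T] v) (mg : measurable_fun [set: T] g).
Hypotheses (v0 : forall x, (0 < v x)%R) (g0 : forall x, (0 <= g x)%R).
Hypotheses (r1 : (1 < r)%R).
Hypothesis vfin : forall j x, \int[mu]_(y in cube j x) (v y)%:E < +oo.
Hypothesis gfin : \int[mu]_y (g y `^ r * v y)%:E < +oo.

Notation S := (weighted_average v g).
Let r' : R := (r / (r - 1))%R.
Let K : R := doob_const r.

Let gv0 y : (0 <= g y * v y)%R. Proof. by rewrite mulr_ge0// ltW. Qed.
Let grv0 y : (0 <= g y `^ r * v y)%R. Proof. by rewrite mulr_ge0 ?powR_ge0 ?ltW. Qed.
Let mgv : measurable_fun [set: T] (fun y => g y * v y)%R.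
Proof. exact: measurable_funM. Qed.
Let mgrv : measurable_fun [set: T] (fun y => g y `^ r * v y)%R.
Proof. by apply: measurable_funM => //; exact: (measurableT_comp (measurable_powR _) mg). Qed.
Hint Resolve gv0 grv0 mgv mgrv : core.

Lemma integral_weight_gt0 j x : 0 < \int[mu]_(y in cube j x) (v y)%:E.
Proof.
rewrite lt_neqAle rint_ge0 ?andbT; last by move=> y; rewrite ltW.
apply/eqP => /esym; rewrite (eq_integral (fun y => `|(v y)%:E|)); last first.
  by move=> y _; rewrite abse_EFin ger0_norm// ltW.
move/(ae_eq_integral_abs mu (mcube j x) (measurable_real_integrand mv)) => [N [mN N0 sN]].
have xN : cube j x `<=` N.
  by move=> y yx; apply: sN => /= /(_ yx) [] /eqP; rewrite gt_eqF.
have : mu (cube j x) <= mu N by rewrite le_measure ?inE.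
by rewrite N0 leNgt (grid_gt0 G).
Qed.

(** The end of the induction on levels, at a point where the function takes the
    value [t]: if [m] is at least [2 r' t] the left half of [m^r] absorbs the
    product, and otherwise [m] is comparable to [t]. *)
Lemma burkholder_base (m t : R) : (0 <= m)%R -> (0 <= t)%R ->
  (2^-1 * m `^ r + r' * m `^ (r - 1) * t <= K * t `^ r + m `^ r)%R.
Proof.
move=> m0 t0; have r1' := r1; have r0 : (0 < r)%R by lra.
have r'0 : (0 < r')%R by rewrite divr_gt0//; lra.
have r10 : (0 <= r - 1)%R by lra.
have K0 : (0 <= K)%R by rewrite mulr_ge0 ?powR_ge0// ltW.
have [tm|mt] := leP (2 * r' * t)%R m.
  suff : (r' * m `^ (r - 1) * t <= 2^-1 * m `^ r)%R.
    by have : (0 <= K * t `^ r)%R; [rewrite mulr_ge0// powR_ge0|lra].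
  rewrite -(mulr_powRB1 m0 r0).
  have : (0 <= m `^ (r - 1))%R by exact: powR_ge0.
  nra.
suff : (r' * m `^ (r - 1) * t <= K * t `^ r)%R.
  by have : (0 <= m `^ r)%R; [exact: powR_ge0|lra].
have r'20 : (0 <= 2 * r')%R by rewrite mulr_ge0// ltW.
have -> : (K * t `^ r = r' * (2 * r' * t) `^ (r - 1) * t)%R.
  by rewrite -(mulr_powRB1 t0 r0) powRM// /K /doob_const -/r'; ring.
rewrite ler_wpM2r// ler_wpM2l ?(ltW r'0)//.
apply: ge0_ler_powR => //; rewrite ?nnegrE//; [exact: mulr_ge0|exact: ltW].
Qed.

(** Passing to a child cube with average [s]. If the maximum increases to [s],
    this is Young's inequality for [m^(r-1) * s]. *)
Lemma burkholder_step (m s : R) : (0 <= m)%R -> (0 <= s)%R ->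
  (r' * m `^ (r - 1) * s + Num.max m s `^ r <=
   r' * Num.max m s `^ (r - 1) * s + m `^ r)%R.
Proof.
move=> m0 s0; have r1' := r1; have r0 : (0 < r)%R by lra.
have r'0 : (0 < r')%R by rewrite divr_gt0//; lra.
have [sm|ms] := leP s m; first by [].
have rr' : (r'^-1 + r^-1 = 1)%R by rewrite /r' invf_div; field; rewrite gt_eqF.
have := conjugate_powR (powR_ge0 m (r - 1)) s0 r'0 r0 rr'.
rewrite -powRrM (_ : (r - 1) * r' = r)%R; last first.
  by rewrite /r' mulrC divfK// gt_eqF//; lra.
rewrite -(ler_pM2l r'0) => Y.
have ssr : (s `^ (r - 1) * s = s `^ r)%R by rewrite mulrC mulr_powRB1.
rewrite -[X in (X + _ <= _)%R]mulrA -[X in (_ <= X + _)%R]mulrA ssr.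
have : (r' * (m `^ r / r' + s `^ r / r) = m `^ r + (r' - 1) * s `^ r)%R.
  by rewrite /r'; field; apply/andP; split; rewrite gt_eqF//; lra.
lra.
Qed.

Lemma weighted_average_ge0 j x : (0 <= S j x)%R.
Proof. by rewrite divr_ge0// fine_ge0// rint_ge0// => y; rewrite ltW. Qed.

Lemma weighted_averageE j x : exists I V Y : R,
  [/\ \int[mu]_(y in cube j x) (g y * v y)%:E = I%:E,
      \int[mu]_(y in cube j x) (v y)%:E = V%:E,
      \int[mu]_(y in cube j x) (g y `^ r * v y)%:E = Y%:E,
      (0 < V)%R & I = (S j x * V)%R].
Proof.
have vge0 y : (0 <= v y)%R by rewrite ltW.
have fY : \int[mu]_(y in cube j x) (g y `^ r * v y)%:E < +oo.
  by apply: le_lt_trans gfin; exact: rint_subset.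
have fI : \int[mu]_(y in cube j x) (g y * v y)%:E < +oo.
  apply: (@le_lt_trans _ _ (\int[mu]_(y in cube j x) (v y + g y `^ r * v y)%:E)).
    apply: rint_le => //; first exact: measurable_funD.
    move=> y _; have r1' := r1; rewrite -[X in (_ <= X + _)%R]mul1r -mulrDl ler_wpM2r//.
    have [g1|g1] := leP (g y) 1%R; first by rewrite (le_trans g1)// lerDl powR_ge0.
    by rewrite (@le_trans _ _ (g y `^ r)%R)// ?lerDr// le1r_powR// ltW.
  by rewrite rintD// lte_add_pinfty.
have V0 := integral_weight_gt0 j x; have fV := vfin j x.
have I0 : 0 <= \int[mu]_(y in cube j x) (g y * v y)%:E by exact: rint_ge0.
have Y0 : 0 <= \int[mu]_(y in cube j x) (g y `^ r * v y)%:E by exact: rint_ge0.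
rewrite /weighted_average; move: fY fI fV V0 I0 Y0.
case: (\int[mu]_(y in cube j x) (g y * v y)%:E) => [I||]//.
case: (\int[mu]_(y in cube j x) (v y)%:E) => [V||]//.
case: (\int[mu]_(y in cube j x) (g y `^ r * v y)%:E) => [Y||]// _ _ _.
by rewrite lte_fin => V0 _ _; exists I, V, Y; split => //=; rewrite divfK// gt_eqF.
Qed.

Lemma weighted_average_cube j x y : cube j x y -> S j y = S j x.
Proof. by move=> /cube_eq yx; rewrite /weighted_average yx. Qed.

Lemma measurable_max_averages N j (h : T -> R) : measurable_fun [set: T] h ->
  measurable_fun [set: T] (fun y => max_averages S N j (h y) y).
Proof.
elim: N j h => //= N IH j h mh; apply: (IH j.+1 (fun y => Num.max (h y) (S j.+1 y))).
apply: measurable_maxr => //; apply: (measurable_step G (j:=j.+1)) => x y.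
exact: weighted_average_cube.
Qed.

(** Burkholder's method for Doob's inequality. With [m] the maximum of the
    averages met so far, the function [U(t, m) = m^r - r' m^(r-1) t] of the
    current average [t] and of [m] decreases in mean from a cube to its children;
    the statement keeps the negative terms on the other side, so that only
    nonnegative integrals occur. *)
Lemma max_averages_cube N j x m : (0 <= m)%R -> (S j x <= m)%R ->
  \int[mu]_(y in cube j x) (2^-1 * (max_averages S N j m y `^ r * v y) +
                            r' * m `^ (r - 1) * (g y * v y))%:E <=
  \int[mu]_(y in cube j x) (K * (g y `^ r * v y) + m `^ r * v y)%:E.
Proof.
have r1' := r1; have r'0 : (0 < r')%R by rewrite divr_gt0//; lra.
have K0 : (0 <= K)%R by rewrite mulr_ge0 ?powR_ge0// ltW.
have vge0 y : (0 <= v y)%R by rewrite ltW.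
have mx0 k i h y : (0 <= max_averages S k i h y `^ r * v y)%R by rewrite mulr_ge0 ?powR_ge0.
have mmx k i h : measurable_fun [set: T] h ->
    measurable_fun [set: T] (fun y => max_averages S k i (h y) y `^ r * v y)%R.
  move=> mh; apply: measurable_funM => //.
  by apply: (measurableT_comp (measurable_powR _)); exact: measurable_max_averages.
have c0 t p : (0 <= r' * t `^ p)%R by rewrite mulr_ge0 ?powR_ge0// ltW.
have lhs0 k i t y : (0 <= 2^-1 * (max_averages S k i t y `^ r * v y) +
    r' * t `^ (r - 1) * (g y * v y))%R.
  by apply: addr_ge0; apply: mulr_ge0.
have rhs0 t y : (0 <= K * (g y `^ r * v y) + t `^ r * v y)%R.
  by apply: addr_ge0; apply: mulr_ge0 => //; exact: powR_ge0.
elim: N j x m => [|N IH] j x m m0 Sm.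
  apply: rint_le => //.
  - apply: measurable_funD; apply: measurable_funM => //.
    exact: (mmx 0%N j (cst m)).
  - by apply: measurable_funD; apply: measurable_funM.
  - move=> y _ /=; rewrite !mulrA -!mulrDl ler_wpM2r//.
    exact: burkholder_base.
apply: (level_le G (j:=j.+1)
  (F:=fun y => (2^-1 * (max_averages S N.+1 j m y `^ r * v y) +
      r' * m `^ (r - 1) * (g y * v y))%:E)
  (H:=fun y => (K * (g y `^ r * v y) + m `^ r * v y)%:E)).
- by move=> y; rewrite lee_fin; exact: (lhs0 N.+1 j m y).
- by move=> y; rewrite lee_fin.
- apply: measurable_real_integrand; apply: measurable_funD; apply: measurable_funM => //.
  exact: (mmx N.+1 j (cst m)).
- by apply: measurable_real_integrand; apply: measurable_funD; apply: measurable_funM.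
move=> y yx; have yjx : cube j.+1 y `<=` cube j x.
  by rewrite -(cube_eq yx); exact: (cube_subset G).
split => //.
pose s := S j.+1 y; pose h := Num.max m s.
have s0 : (0 <= s)%R by exact: weighted_average_ge0.
have h0 : (0 <= h)%R by rewrite le_max m0.
have := IH j.+1 y h h0; rewrite {1}/h le_max lexx orbT => /(_ isT).
have mmx' : measurable_fun [set: T] (fun z => max_averages S N j.+1 h z `^ r * v z)%R.
  exact: (mmx N j.+1 (cst h)).
have -> : \int[mu]_(z in cube j.+1 y) (2^-1 * (max_averages S N.+1 j m z `^ r * v z) +
        r' * m `^ (r - 1) * (g z * v z))%:E =
    \int[mu]_(z in cube j.+1 y) (2^-1 * (max_averages S N j.+1 h z `^ r * v z) +
        r' * m `^ (r - 1) * (g z * v z))%:E.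
  by apply: eq_integral => z; rewrite inE => zy /=; rewrite (weighted_average_cube zy).
have [I [V [Y [IE VE YE V0 SE]]]] := weighted_averageE j.+1 y.
rewrite !rint_lin ?powR_ge0//.
rewrite IE VE YE.
move: (\int[mu]_(z in _) _); move=> [X||] //; last 2 first.
- by rewrite gt0_muley ?lte_fin ?invr_gt0// -!EFinM -!EFinD addye// leye_eq.
- by rewrite gt0_muleNy ?lte_fin ?invr_gt0// -!EFinM addNye !leNye.
- rewrite -!EFinM -!EFinD !lee_fin SE -/s.
  have := burkholder_step m0 s0; rewrite -/h; nra.
Qed.

(** At the top cube [m] is the average [S] itself, where [U(S, S)] is
    nonpositive. *)
Theorem weighted_maximal_inequality N :
  \int[mu]_y (max_averages S N 0 (S 0%N y) y `^ r * v y)%:E <=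
  (2 * doob_const r)%:E * \int[mu]_y (g y `^ r * v y)%:E.
Proof.
rewrite -/K.
have r1' := r1; have r'1 : (1 <= r')%R.
  by rewrite /r' ler_pdivlMr; lra.
have r'0 : (0 < r')%R by lra.
have K0 : (0 <= K)%R by rewrite mulr_ge0 ?powR_ge0// ltW.
have vge0 y : (0 <= v y)%R by rewrite ltW.
have mx0 m y : (0 <= max_averages S N 0 m y `^ r * v y)%R by rewrite mulr_ge0 ?powR_ge0.
have mmx h : measurable_fun [set: T] h ->
    measurable_fun [set: T] (fun y => max_averages S N 0 (h y) y `^ r * v y)%R.
  move=> mh; apply: measurable_funM => //.
  by apply: (measurableT_comp (measurable_powR _)); exact: measurable_max_averages.
have mS : measurable_fun [set: T] (S 0%N).
  by apply: (measurable_step G (j:=0%N)) => x y; exact: weighted_average_cube.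
rewrite -rintZ//; last by rewrite mulr_ge0.
apply: (level_le G (j:=0%N)
  (F:=fun y => (max_averages S N 0 (S 0%N y) y `^ r * v y)%:E)
  (H:=fun y => (2 * K * (g y `^ r * v y))%:E)) => //.
- by move=> y; rewrite lee_fin.
- by move=> y; rewrite lee_fin mulr_ge0// mulr_ge0.
- by apply: measurable_real_integrand; exact: mmx.
- by apply: measurable_real_integrand; exact: measurable_funM.
move=> x _; split => //.
have := max_averages_cube N (weighted_average_ge0 0 x) (lexx (S 0%N x)).
have -> : \int[mu]_(y in cube 0 x) (max_averages S N 0 (S 0%N y) y `^ r * v y)%:E =
    \int[mu]_(y in cube 0 x) (max_averages S N 0 (S 0%N x) y `^ r * v y)%:E.
  by apply: eq_integral => z; rewrite inE => zx; rewrite (weighted_average_cube zx).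
have [I [V [Y [IE VE YE V0 SE]]]] := weighted_averageE 0 x.
have S0 := weighted_average_ge0 0 x.
have mmx' : measurable_fun [set: T]
    (fun z => max_averages S N 0 (S 0%N x) z `^ r * v z)%R.
  exact: (mmx (cst (S 0%N x))).
have c0 t p : (0 <= r' * t `^ p)%R by rewrite mulr_ge0 ?powR_ge0// ltW.
rewrite !rint_lin ?powR_ge0//.
rewrite rintZ//; last by rewrite mulr_ge0.
rewrite IE VE YE.
have IV : (S 0%N x `^ r * V <= r' * S 0%N x `^ (r - 1) * I)%R.
  have r0 : (0 < r)%R by lra.
  rewrite -(mulr_powRB1 S0 r0) SE.
  rewrite (_ : r' * _ * _ = r' * (S 0%N x * S 0%N x `^ (r - 1) * V))%R; last ring.
  rewrite ler_peMl// mulr_ge0//; last exact: ltW.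
  by rewrite mulr_ge0 ?powR_ge0.
move: (\int[mu]_(z in _) _); move=> [X||] //.
- by rewrite -!EFinM -!EFinD !lee_fin; lra.
- by rewrite gt0_muley ?lte_fin ?invr_gt0// -!EFinM -!EFinD addye// leye_eq.
- by rewrite leNye.
Qed.

End maximal_function.

(** * Functions of power growth and their averages on a cube *)

Section growth.
Variable R : realType.

(** The consequences of being a Young function in Delta_2 and nabla_2 on which
    the estimates rest: [c] and [p] come from nabla_2, [k] and [P] from Delta_2. *)
Record growth (phi : R -> R) (p c P k : R) : Prop := Growth {
  growth0 : phi 0 = 0 ;
  growth_gt0 : forall t, 0 < t -> 0 < phi t ;
  growth_nd : forall s t, 0 <= s -> s <= t -> phi s <= phi t ;
  growth_c : 0 < c ;
  growth_k : 0 < k ;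
  growth_P : 0 <= P ;
  growth_lower : forall l t, 1 <= l -> 0 <= t -> c * l `^ p * phi t <= phi (l * t) ;
  growth_upper : forall l t, 1 <= l -> 0 <= t -> phi (l * t) <= k * l `^ P * phi t }.

Lemma growth_ge0 phi p c P k : growth phi p c P k -> forall t, 0 <= t -> 0 <= phi t.
Proof. by move=> g t t0; rewrite -(growth0 g); exact: growth_nd g _ _ _ t0. Qed.

Lemma add1_le_expR (h t : R) : 0 < h -> 0 <= t -> 1 + t <= (1 + h^-1) * expR (h * t).
Proof.
move=> h0 t0; have ht : 1 + h * t <= expR (h * t) by exact: expR_ge1Dx.
have h'0 : 0 < h^-1 by rewrite invr_gt0.
have e1 : 1 <= expR (h * t) by rewrite -expR0 ler_expR mulr_ge0// ltW.
have : h^-1 * (1 + h * t) <= h^-1 * expR (h * t) by rewrite ler_pM2l.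
by rewrite mulrDr mulrA mulVf ?gt_eqF//; lra.
Qed.

Section pointwise.
Variables (phi : R -> R) (r c P k h e : R).
Hypotheses (gphi : growth phi (r * r) c P k) (r1 : 1 < r) (h0 : 0 < h).
Hypotheses (e0 : 0 <= e) (eh : e <= h * (r - 1) / 2).

(* [1 + t <= K2 * expR (h (r - 1) / 2 * t)] *)
Let K2 : R := 1 + (h * (r - 1) / 2)^-1.

(** Writing [p = r * r] splits the growth of [phi] in two: one factor [r] is the
    exponent of the maximal inequality, and the other leaves the spare power
    [(f / s)^(r-1)], which dominates [exp (h (r - 1) t)] above the threshold. *)
Lemma large_value_power (s t f : R) : 0 < s -> 0 <= t -> 0 <= f ->
  s * expR (h * t) < f ->
  (1 + t) * f <= s * K2 * (f / s) `^ r * expR (- (e * (1 - r^-1) * t)) /\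
  (f / s) `^ (r * r) <= c^-1 * (phi f / phi s).
Proof.
move=> s0 t0 f0 sf; have r1' := r1; have h0' := h0.
have c0 := growth_c gphi.
set X := f / s; have fE : f = X * s by rewrite divfK// gt_eqF.
have XE : expR (h * t) <= X by rewrite ler_pdivlMr// mulrC ltW.
have E1 : 1 <= expR (h * t) by rewrite -expR0 ler_expR mulr_ge0// ltW.
have X1 : 1 <= X by exact: le_trans XE.
have X0 : 0 < X by lra.
have hr0 : 0 < h * (r - 1) / 2 by rewrite divr_gt0// mulr_gt0//; lra.
split; last first.
  have := growth_lower gphi X1 (ltW s0); rewrite -fE.
  have phis := growth_gt0 gphi s0.
  by rewrite mulrA ler_pdivlMr// ler_pdivlMl// mulrA.
have K20 : 0 < K2 by rewrite addr_gt0// invr_gt0.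
have XrE : X * expR (h * (r - 1) * t) <= X `^ r.
  rewrite -(mulr_powRB1 (ltW X0)) ?ler_pM2l//; last lra.
  rewrite (_ : h * (r - 1) * t = (h * t) * (r - 1)); last ring.
  rewrite expRM; apply: ge0_ler_powR => //; rewrite ?nnegrE ?expR_ge0//; lra.
have : (1 + t) * expR (e * (1 - r^-1) * t) <= K2 * expR (h * (r - 1) * t).
  apply: (@le_trans _ _ (K2 * expR (h * (r - 1) / 2 * t) * expR (e * (1 - r^-1) * t))).
    by rewrite ler_wpM2r ?expR_ge0//; exact: add1_le_expR.
  rewrite -mulrA ler_pM2l// -expRD ler_expR -mulrDl ler_wpM2r//.
  have r'1 : 0 <= r^-1 <= 1 by rewrite invr_ge0 invf_le1; lra.
  have : e * (1 - r^-1) <= e * 1 by rewrite ler_wpM2l//; lra.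
  move: eh; lra.
set E := expR (e * _ * t) => tE.
rewrite expRN -/E ler_pdivlMr ?expR_gt0// fE.
rewrite (_ : (1 + t) * (X * s) * E = s * X * ((1 + t) * E)); last ring.
apply: (@le_trans _ _ (s * X * (K2 * expR (h * (r - 1) * t)))).
  by rewrite ler_wpM2l// mulr_ge0// ltW.
rewrite (_ : _ * _ = s * K2 * (X * expR (h * (r - 1) * t))); last ring.
by rewrite ler_wpM2l// mulr_ge0// ltW.
Qed.

Let K1 : R := K2 * (c^-1) `^ r^-1.

(** Values below [s * expR (h * t)] are absorbed by the first term. Above that
    threshold [f / s] is so large that a power of it pays for the weights. *)
Lemma pointwise_weighted (s t f : R) : 0 < s -> 0 <= t -> 0 <= f ->
  (1 + t) * f <= s * ((1 + t) * expR (h * t)) +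
    s * K1 * (phi f / phi s) `^ r^-1 * expR (- (e * (1 - r^-1) * t)).
Proof.
move=> s0 t0 f0; have r1' := r1; have c0 := growth_c gphi.
have phis := growth_gt0 gphi s0; have phif := growth_ge0 gphi f0.
have K20 : 0 <= K2 by rewrite addr_ge0// invr_ge0 divr_ge0// mulr_ge0 ?ltW//; lra.
have [fs|sf] := leP f (s * expR (h * t)).
  apply: (@le_trans _ _ (s * ((1 + t) * expR (h * t)))).
    by rewrite mulrCA ler_wpM2l// addr_ge0.
  by rewrite lerDl !mulr_ge0 ?powR_ge0 ?expR_ge0 ?(ltW s0).
have [tX Xphi] := large_value_power s0 t0 f0 sf.
apply: (le_trans tX); rewrite -[leLHS]add0r lerD//.
  by rewrite !mulr_ge0 ?expR_ge0 ?addr_ge0 ?(ltW s0).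
rewrite ler_wpM2r ?expR_ge0// /K1 -!mulrA ler_wpM2l ?(ltW s0)// ler_wpM2l//.
rewrite -powRM ?invr_ge0 ?(ltW c0)// ?divr_ge0 ?(ltW phis)//.
have -> : (f / s) `^ r = ((f / s) `^ (r * r)) `^ r^-1.
  by rewrite -powRrM mulfK// gt_eqF//; lra.
by apply: ge0_ler_powR; rewrite ?invr_ge0 ?nnegrE ?powR_ge0//
  ?mulr_ge0 ?invr_ge0 ?(ltW c0) ?(ltW phis)//; lra.
Qed.

Let K1' : R := K2 * c^-1.

Lemma pointwise_unweighted (s t f : R) : 0 < s -> 0 <= t -> 0 <= f ->
  (1 + t) * f <= s * ((1 + t) * expR (h * t)) + s * K1' * (phi f / phi s).
Proof.
move=> s0 t0 f0; have r1' := r1; have c0 := growth_c gphi.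
have phis := growth_gt0 gphi s0; have phif := growth_ge0 gphi f0.
have K20 : 0 <= K2 by rewrite addr_ge0// invr_ge0 divr_ge0// mulr_ge0 ?ltW//; lra.
have [fs|sf] := leP f (s * expR (h * t)).
  apply: (@le_trans _ _ (s * ((1 + t) * expR (h * t)))).
    by rewrite mulrCA ler_wpM2l// addr_ge0.
  by rewrite lerDl !mulr_ge0 ?invr_ge0 ?(ltW c0) ?(ltW s0) ?(ltW phis).
have [tX Xphi] := large_value_power s0 t0 f0 sf.
apply: (le_trans tX); rewrite -[leLHS]add0r lerD//.
  by rewrite !mulr_ge0 ?expR_ge0 ?addr_ge0 ?(ltW s0).
rewrite /K1' -!mulrA ler_wpM2l ?(ltW s0)// ler_wpM2l//.
apply: le_trans Xphi.
have X1 : 1 <= f / s.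
  rewrite ler_pdivlMr// mul1r; apply: le_trans (ltW sf).
  by rewrite ler_peMr ?(ltW s0)// -expR0 ler_expR mulr_ge0// ltW.
rewrite -[leRHS]mulr1; apply: ler_pM; rewrite ?powR_ge0 ?expR_ge0//.
  by apply: ler_powR => //; rewrite ler_peMl//; lra.
have r'1 : r^-1 <= 1 by rewrite invf_le1; lra.
by rewrite -[leRHS]expR0 ler_expR oppr_le0 mulr_ge0// mulr_ge0// subr_ge0.
Qed.

End pointwise.
End growth.

Section cube_estimate.
Context d (T : measurableType d) (R : realType).
Variable mu : {measure set T -> \bar R}.
Variables (phi : R -> R) (r c P k e0 : R).
Hypotheses (gphi : growth phi (r * r) c P k) (r1 : 1 < r) (e00 : 0 < e0).

Let h : R := e0 / 2.

(** Half of the exponential integrability [e0] serves as a threshold for the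
    values of [f]; the weight must be weaker still, by the factor [(r - 1) / 2]
    that the spare power of [large_value_power] can pay for. *)
Definition weight_exponent : R := h * (r - 1) / 2.
Let e : R := weight_exponent.
Let Ch : R := 1 + h^-1.
Let kap : R := (18 * Ch)^-1.

Let h0 : 0 < h. Proof. by rewrite divr_gt0. Qed.
Let e_ge0 : 0 <= e.
Proof. by rewrite /e /weight_exponent divr_ge0// mulr_ge0 ?(ltW h0)// subr_ge0 ltW. Qed.
Let Ch1 : 1 <= Ch. Proof. by rewrite lerDl invr_ge0 ltW. Qed.
Let Ch0 : 0 <= Ch. Proof. by apply: le_trans Ch1. Qed.
Let kap0 : 0 < kap. Proof. by rewrite invr_gt0 mulr_gt0// (lt_le_trans ltr01). Qed.

Section one_cube.
Variables (Q : set T) (m : R) (b f : T -> R) (cQ : R).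
Hypotheses (mQ : measurable Q) (m0 : 0 < m).
Hypotheses (mb : measurable_fun [set: T] b) (mf : measurable_fun [set: T] f).
Hypotheses (mphif : measurable_fun [set: T] (phi \o f)) (f0 : forall x, 0 <= f x).
Hypothesis jn : (\int[mu]_(y in Q) (expR (e0 * `|b y - cQ|))%:E <= 9%:E * m%:E)%E.
Hypothesis phif1 : (\int[mu]_(y in Q) (phi (f y))%:E <= 1)%E.

Let beta y : R := `|b y - cQ|.
Let mbeta : measurable_fun [set: T] beta.
Proof. by apply: measurableT_comp => //; apply: measurable_funB. Qed.
Let beta0 y : 0 <= beta y. Proof. exact: normr_ge0. Qed.
Let muf : measurable_fun [set: T] (fun y => (1 + beta y) * f y).
Proof. by apply: measurable_funM => //; exact: measurable_funD. Qed.
Let uf0 y : 0 <= (1 + beta y) * f y. Proof. by rewrite mulr_ge0// addr_ge0. Qed.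
Let mexp l : measurable_fun [set: T] (fun y => expR (l * beta y)).
Proof. by apply: measurableT_comp => //; exact: measurable_funM. Qed.
Let muW : measurable_fun [set: T] (fun y => (1 + beta y) * expR (h * beta y)).
Proof. by apply: measurable_funM => //; exact: measurable_funD. Qed.
Let uW0 y : 0 <= (1 + beta y) * expR (h * beta y).
Proof. by rewrite mulr_ge0 ?expR_ge0// addr_ge0. Qed.
Let phif0 y : 0 <= phi (f y). Proof. exact: (growth_ge0 gphi (f0 y)). Qed.

Let intW : (\int[mu]_(y in Q) ((1 + beta y) * expR (h * beta y))%:E <=
           (Ch * 9 * m)%:E)%E.
Proof.
apply: (@le_trans _ _ (\int[mu]_(y in Q) (Ch * expR (e0 * beta y))%:E)%E).
  apply: rint_le => //; first exact: measurable_funM.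
  move=> y _; have -> : e0 * beta y = h * beta y + h * beta y by rewrite /h; field.
  rewrite expRD mulrA ler_wpM2r ?expR_ge0//.
  exact: add1_le_expR.
rewrite rintZ//.
by rewrite -mulrA EFinM lee_wpmul2l// lee_fin.
Qed.

(** With the threshold [s = kap * a] proportional to the average [a], the first
    term of the pointwise bounds is at most half of the left-hand side. *)
Let absorb (s : R) (a : R) (w : T -> R) : 0 < a -> s = kap * a ->
  (\int[mu]_(y in Q) ((1 + beta y) * f y)%:E = (a * m)%:E)%E ->
  measurable_fun [set: T] w -> (forall y, 0 <= w y) ->
  (forall y, (1 + beta y) * f y <= s * ((1 + beta y) * expR (h * beta y)) + s * w y) ->
  (m%:E <= (2 * kap)%:E * \int[mu]_(y in Q) (w y)%:E)%E.
Proof.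
move=> a0 sE intE mw w0 uw.
have s0 : 0 < s by rewrite sE mulr_gt0.
have : ((a * m)%:E <= \int[mu]_(y in Q)
    (s * ((1 + beta y) * expR (h * beta y)) + s * w y)%:E)%E.
  by rewrite -intE; apply: rint_le => //; apply: measurable_funD; exact: measurable_funM.
rewrite rintD//; try (by apply: measurable_funM); try (by move=> y; rewrite mulr_ge0// ltW).
rewrite !rintZ ?(ltW s0)// => H.
have {}H : ((a * m)%:E <= s%:E * (Ch * 9 * m)%:E + s%:E * \int[mu]_(y in Q) (w y)%:E)%E.
  by apply: (le_trans H); rewrite leeD2r// lee_pmul2l.
have : (0 <= \int[mu]_(y in Q) (w y)%:E)%E by exact: rint_ge0.
move: H; move: (integral _ _ _) => [J||]//; last first.
  by move=> _ _; rewrite gt0_muley ?leey// lte_fin mulr_gt0.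
rewrite -!EFinM -EFinD !lee_fin sE => H J0.
have Chgt0 : 0 < Ch by apply: lt_le_trans Ch1.
have kC : kap * (Ch * 9) = 2^-1 by rewrite /kap; field; rewrite gt_eqF.
rewrite -(ler_pM2l a0); move: H.
rewrite (_ : kap * a * (Ch * 9 * m) = (kap * (Ch * 9)) * (a * m)); last ring.
by rewrite kC; lra.
Qed.

(** The pointwise bound at the threshold [s = 1] shows integrability. *)
Lemma cube_average_finite : exists2 a : R, 0 <= a &
  (\int[mu]_(y in Q) ((1 + beta y) * f y)%:E = (a * m)%:E)%E.
Proof.
have [K K0 ufK] : exists2 K, 0 <= K & forall y, (1 + beta y) * f y <=
    1 * ((1 + beta y) * expR (h * beta y)) + K * phi (f y).
  have phi1 := growth_gt0 gphi ltr01; have c0 := growth_c gphi.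
  pose K := (1 + (h * (r - 1) / 2)^-1) * c^-1 / phi 1.
  have : 0 <= K.
    rewrite /K divr_ge0 ?(ltW phi1)// mulr_ge0 ?invr_ge0 ?(ltW c0)//.
    by rewrite addr_ge0// invr_ge0.
  exists K => // y.
  have := pointwise_unweighted gphi r1 h0 e_ge0 (lexx _) ltr01 (beta0 y) (f0 y).
  by rewrite /K mul1r; move/le_trans; apply; rewrite lerD2l !mulrA mul1r mulrAC.
have fin : (\int[mu]_(y in Q) ((1 + beta y) * f y)%:E < +oo)%E.
  apply: (@le_lt_trans _ _ (\int[mu]_(y in Q)
      (1 * ((1 + beta y) * expR (h * beta y)) + K * phi (f y))%:E)%E).
    by apply: rint_le => //; apply: measurable_funD; exact: measurable_funM.
  rewrite rintD//; try (by apply: measurable_funM); try (by move=> y; rewrite mulr_ge0).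
  rewrite !rintZ// lte_add_pinfty//.
    by rewrite mul1e (le_lt_trans intW)// ltry.
  apply: (@le_lt_trans _ _ (K%:E * 1)%E); first exact: lee_wpmul2l.
  by rewrite mule1 ltry.
have : (0 <= \int[mu]_(y in Q) ((1 + beta y) * f y)%:E)%E by exact: rint_ge0.
move: fin; move: (integral _ _ _) => [J||]// _; rewrite lee_fin => J0.
by exists (J / m); rewrite ?divr_ge0 ?(ltW m0)// divfK// gt_eqF.
Qed.

Let K2 : R := 1 + (h * (r - 1) / 2)^-1.
Let K20 : 0 <= K2.
Proof.
rewrite addr_ge0// invr_ge0 divr_ge0// mulr_ge0 ?(ltW h0)// subr_ge0.
exact: ltW.
Qed.
Let c0 : 0 < c. Proof. exact: growth_c gphi. Qed.
Let Kup : R := k * kap^-1 `^ P.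

Let phi_kap a : 0 <= a -> phi a <= Kup * phi (kap * a).
Proof.
move=> a0; have l1 : 1 <= kap^-1.
  by rewrite /kap invrK; have := Ch1; lra.
have ka0 : 0 <= kap * a by rewrite mulr_ge0// ltW.
have := growth_upper gphi l1 ka0.
by rewrite mulrA mulVf ?mul1r// gt_eqF.
Qed.

Let Kup0 : 0 <= Kup.
Proof. by rewrite mulr_ge0 ?powR_ge0// ltW// (growth_k gphi). Qed.

(** The first term serves [cube_average_le], the second
    [cube_average_weighted]. *)
Definition cube_const : R :=
  Kup * (2 * kap * (K2 * c^-1)) +
  Kup * (18 * kap * (K2 * c^-1 `^ r^-1)) `^ r.

Let cube_const1 : 0 <= Kup * (2 * kap * (K2 * c^-1)).
Proof.
by apply: mulr_ge0 => //; apply: mulr_ge0; apply: mulr_ge0;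
  rewrite ?(ltW kap0) ?invr_ge0 ?(ltW c0).
Qed.
Let cube_const2 : 0 <= Kup * (18 * kap * (K2 * c^-1 `^ r^-1)) `^ r.
Proof. by rewrite mulr_ge0 ?powR_ge0. Qed.

Lemma cube_const_ge0 : 0 <= cube_const.
Proof. exact: addr_ge0. Qed.

Variable a : R.
Hypotheses (a0 : 0 < a).
Hypothesis intE : (\int[mu]_(y in Q) ((1 + beta y) * f y)%:E = (a * m)%:E)%E.

Let s0 : 0 < kap * a. Proof. exact: mulr_gt0. Qed.
Let phis : 0 < phi (kap * a). Proof. exact: (growth_gt0 gphi s0). Qed.

Lemma cube_average_le : phi a * m <= cube_const.
Proof.
have H : (m%:E <= (2 * kap)%:E *
    \int[mu]_(y in Q) (K2 * c^-1 / phi (kap * a) * phi (f y))%:E)%E.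
  apply: (absorb a0 erefl intE).
  - exact: measurable_funM.
  - move=> y; rewrite mulr_ge0// divr_ge0 ?(ltW phis)// mulr_ge0// invr_ge0.
    exact: ltW.
  - move=> y.
    have := pointwise_unweighted gphi r1 h0 e_ge0 (lexx _) s0 (beta0 y) (f0 y).
    move/le_trans; apply; rewrite lerD2l -[leLHS]mulrA ler_wpM2l ?(ltW s0)//.
    by rewrite mulrA mulrAC.
have K0 : 0 <= K2 * c^-1 / phi (kap * a).
  by rewrite divr_ge0 ?(ltW phis)// mulr_ge0// invr_ge0 ltW.
have {}H : m <= 2 * kap * (K2 * c^-1 / phi (kap * a)).
  rewrite -lee_fin; apply: (le_trans H); rewrite rintZ// [leRHS]EFinM.
  rewrite lee_wpmul2l ?lee_fin ?mulr_ge0 ?(ltW kap0)//.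
  by rewrite -[leRHS]mule1 lee_wpmul2l.
rewrite /cube_const -[leLHS]addr0 lerD//.
apply: (@le_trans _ _ (Kup * (phi (kap * a) * m))).
  by rewrite mulrA ler_wpM2r ?(ltW m0)// phi_kap// ltW.
rewrite ler_wpM2l// mulrC -ler_pdivlMr//.
by apply: (le_trans H); rewrite !mulrA.
Qed.

(** The weight [exp (e b)] is comparable to the constant [exp (e cQ)] in mean. *)
Lemma integral_weight_le : e <= e0 ->
  (\int[mu]_(y in Q) (expR (e * b y))%:E <= (9 * m * expR (e * cQ))%:E)%E.
Proof.
move=> ee0.
apply: (@le_trans _ _ (\int[mu]_(y in Q) (expR (e * cQ) * expR (e0 * beta y))%:E)%E).
  apply: rint_le => //.
  - by apply: measurableT_comp => //; exact: measurable_funM.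
  - exact: measurable_funM.
  move=> y _; rewrite -expRD ler_expR.
  rewrite (_ : e * b y = e * cQ + e * (b y - cQ)); last ring.
  rewrite lerD2l; apply: (@le_trans _ _ (e * beta y)).
    by rewrite ler_wpM2l// ler_norm.
  by rewrite ler_wpM2r.
rewrite rintZ ?expR_ge0//.
by rewrite [leRHS]EFinM [leRHS]muleC lee_wpmul2l ?lee_fin ?expR_ge0.
Qed.

(** The weights [exp (- e (1 - 1/r) |b - cQ|)] left by [pointwise_weighted] are
    at most [exp (e (1 - 1/r) (b - cQ))], and [phi(f)^(1/r) v^(1 - 1/r)] is
    [(phi(f) / v)^(1/r) v]. *)
Lemma cube_average_weighted (S V : R) :
  let v y := expR (e * b y) in
  (\int[mu]_(y in Q) ((phi (f y) / v y) `^ r^-1 * v y)%:E = (S * V)%:E)%E ->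
  (\int[mu]_(y in Q) (v y)%:E = V%:E)%E -> 0 <= S -> 0 < V -> e <= e0 ->
  phi a <= cube_const * expR (e * cQ) * S `^ r.
Proof.
move=> v gvE vE S0 V0 ee0.
have r0 : 0 < r by have := r1; lra.
have r'1 : 0 <= 1 - r^-1 by rewrite subr_ge0 invf_le1// ltW.
have v0 y : 0 < v y by exact: expR_gt0.
have mv : measurable_fun [set: T] v.
  by apply: measurableT_comp => //; exact: measurable_funM.
have mphis y : 0 <= phi (f y) / v y by rewrite divr_ge0// ltW.
have mg : measurable_fun [set: T] (fun y => (phi (f y) / v y) `^ r^-1).
  apply: (measurableT_comp (measurable_powR _)); apply: measurable_funM => //.
  apply: (@eq_measurable_fun _ _ _ _ _ (fun y => expR (- (e * b y)))).
    by move=> y _; rewrite expRN.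
  apply: measurableT_comp => //; apply: measurableT_comp => //.
  exact: measurable_funM.
have VE : V <= 9 * m * expR (e * cQ) by rewrite -lee_fin -vE integral_weight_le.
pose K := K2 * c^-1 `^ r^-1.
have K0 : 0 <= K by rewrite mulr_ge0// powR_ge0.
pose p := phi (kap * a) `^ r^-1.
have p0 : 0 < p by rewrite powR_gt0.
have H : (m%:E <= (2 * kap)%:E * \int[mu]_(y in Q)
    (K / p * expR (- (e * (1 - r^-1) * cQ)) * ((phi (f y) / v y) `^ r^-1 * v y))%:E)%E.
  apply: (absorb a0 erefl intE).
  - by apply: measurable_funM => //; exact: measurable_funM.
  - move=> y; rewrite mulr_ge0//.
      by rewrite mulr_ge0 ?expR_ge0// divr_ge0// ltW.
    by rewrite mulr_ge0 ?powR_ge0// ltW.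
  move=> y.
  have := pointwise_weighted gphi r1 h0 e_ge0 (lexx _) s0 (beta0 y) (f0 y).
  move/le_trans; apply; rewrite lerD2l -[leLHS]mulrA -[leLHS]mulrA.
  rewrite ler_wpM2l ?(ltW s0)// -/K.
  rewrite powRM ?invr_ge0 ?(ltW phis)// -(powR_inv1 (ltW phis)) -powRrM mulN1r powRN -/p.
  have -> : (phi (f y) / v y) `^ r^-1 * v y =
      phi (f y) `^ r^-1 * expR (e * (1 - r^-1) * b y).
    rewrite powRM ?invr_ge0 ?(ltW (v0 y))// -expRN -expRM -mulrA -expRD.
    congr (_ * expR _); rewrite mulrBr mulr1 mulrBl mulNr addrC.
    by congr (_ - _); rewrite mulrAC.
  have : expR (- (e * (1 - r^-1) * beta y)) <=
      expR (- (e * (1 - r^-1) * cQ)) * expR (e * (1 - r^-1) * b y).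
    rewrite -expRD ler_expR [leRHS]addrC -mulrBr -mulrN.
    rewrite (ler_wpM2l (mulr_ge0 e_ge0 r'1))//.
    by have /ler_normlP[? ?] := lexx `|b y - cQ|; rewrite /beta; lra.
  have : 0 <= phi (f y) `^ r^-1 by exact: powR_ge0.
  have : 0 <= K / p by rewrite divr_ge0// ltW.
  move: (p^-1) (expR (e * _ * b y)) (expR (- (_ * cQ))) (expR (- _)) (phi (f y) `^ _).
  move=> p' E3 E2 E1 F Kp' F0 E123.
  rewrite (_ : K * (F * p' * E1) = K * p' * F * E1); last ring.
  rewrite (_ : _ * (F * E3) = K * p' * F * (E2 * E3)); last ring.
  by rewrite ler_wpM2l// mulr_ge0.
have {}H : m <= 2 * kap * (K / p * expR (- (e * (1 - r^-1) * cQ)) * (S * V)).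
  rewrite -lee_fin; apply: (le_trans H); rewrite rintZ//; first last.
  - by rewrite mulr_ge0 ?expR_ge0// divr_ge0// ltW.
  - by move=> y; rewrite mulr_ge0 ?powR_ge0// ltW.
  - exact: measurable_funM.
  by rewrite gvE [leRHS]EFinM lee_wpmul2l ?lee_fin ?mulr_ge0 ?(ltW kap0).
have {}H : p <= 18 * kap * K * (expR (e * cQ / r) * S).
  have -> : expR (e * cQ / r) = expR (- (e * (1 - r^-1) * cQ)) * expR (e * cQ).
    by rewrite -expRD; congr expR; field; rewrite gt_eqF.
  rewrite -(ler_pM2r m0).
  apply: (@le_trans _ _ (2 * kap * (K * expR (- (e * (1 - r^-1) * cQ)) * (S * V)))).
    rewrite mulrC -ler_pdivlMr//; apply: (le_trans H).
    by rewrite le_eqVlt; apply/orP; left; apply/eqP; field; rewrite gt_eqF.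
  rewrite [leRHS](_ : _ = 2 * kap * (K * expR (- (e * (1 - r^-1) * cQ)) *
      (S * (9 * m * expR (e * cQ))))); last ring.
  rewrite ler_wpM2l ?mulr_ge0 ?(ltW kap0)//.
  by rewrite (ler_wpM2l (mulr_ge0 K0 (expR_ge0 _)))// ler_wpM2l.
apply: (@le_trans _ _ (Kup * phi (kap * a))); first exact/phi_kap/ltW.
have K180 : 0 <= 18 * kap * K by rewrite mulr_ge0// mulr_ge0// ltW.
have -> : phi (kap * a) = p `^ r by rewrite /p -powRrM mulVf ?powRr1// ?(ltW phis)// gt_eqF.
apply: (@le_trans _ _ (Kup * (18 * kap * K) `^ r * expR (e * cQ) * S `^ r)).
  have -> : expR (e * cQ) = expR (e * cQ / r) `^ r.
    by rewrite -expRM divfK// gt_eqF.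
  rewrite -[leRHS]mulrA -[leRHS]mulrA ler_wpM2l//.
  rewrite -(powRM _ (expR_ge0 _) S0) -(powRM _ K180 (mulr_ge0 (expR_ge0 _) S0)).
  by apply: ge0_ler_powR; rewrite ?nnegrE ?(ltW r0) ?(ltW p0)//
    (mulr_ge0 K180 (mulr_ge0 (expR_ge0 _) S0)).
rewrite -[leLHS]mulrA -[leRHS]mulrA.
rewrite (ler_wpM2r (mulr_ge0 (expR_ge0 _) (powR_ge0 _ _)))//.
by rewrite /cube_const lerDr.
Qed.

End one_cube.
End cube_estimate.

(** * The commutator on one grid *)

Section signed_weight.
Local Open Scope ereal_scope.
Context d (T : measurableType d) (R : realType).
Variables (mu : {measure set T -> \bar R}) (C : countType).
Variables (code : nat -> T -> C) (D : R) (G : grid mu code D).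
Notation cube := (grid_cube code).
Variables (phi : R -> R) (r cl P k A : R).
Hypotheses (gphi : growth phi (r * r) cl P k) (r1 : (1 < r <= 2)%R) (A0 : (0 < A)%R).
Let e0 := jn_exponent A D.
Let e := weight_exponent r e0.
Hypothesis e00 : (0 < e0)%R.
Variable f : T -> R.
Hypotheses (mf : measurable_fun [set: T] f) (f0 : forall x, (0 <= f x)%R).
Hypotheses (mphif : measurable_fun [set: T] (phi \o f)).
Hypothesis phif1 : \int[mu]_y (phi (f y))%:E <= 1.

Let mcube j x : measurable (cube j x). Proof. exact: (measurable_cube G). Qed.
Hint Resolve mcube : core.

Let rgt1 : (1 < r)%R. Proof. by case/andP: r1. Qed.
Let ee0 : (e <= e0)%R.
Proof.
rewrite /e /weight_exponent; move: r1 e00 => /andP[r1' r2] e0'.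
have : (e0 * (r - 1) <= e0 * 1)%R by rewrite ler_pM2l//; lra.
have -> : (e0 / 2 * (r - 1) / 2 = e0 * (r - 1) / 4)%R by field.
lra.
Qed.

Definition weighted_maximal (b : T -> R) (N : nat) (y : T) : R :=
  let v z := expR (e * b z) in
  let S := weighted_average mu code v (fun z => (phi (f z) / v z) `^ r^-1)%R in
  (max_averages S N 0 (S 0%N y) y `^ r * v y)%R.

Lemma weighted_maximal_ge0 b N y : (0 <= weighted_maximal b N y)%R.
Proof. by rewrite mulr_ge0 ?powR_ge0 ?expR_ge0. Qed.

Variables (b : T -> R) (c : nat -> T -> R).
Hypothesis mb : measurable_fun [set: T] b.
Hypothesis oscb : forall j x,
  \int[mu]_(y in cube j x) `|b y - c j x|%:E <= A%:E * mu (cube j x).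

Let v z := expR (e * b z).
Let g z := ((phi (f z) / v z) `^ r^-1)%R.
Let v0 z : (0 < v z)%R. Proof. exact: expR_gt0. Qed.
Let mv : measurable_fun [set: T] v.
Proof. by apply: measurableT_comp => //; exact: measurable_funM. Qed.
Let phif0 y : (0 <= phi (f y))%R. Proof. exact: (growth_ge0 gphi (f0 y)). Qed.
Let g0 z : (0 <= g z)%R. Proof. exact: powR_ge0. Qed.
Let mg : measurable_fun [set: T] g.
Proof.
apply: (measurableT_comp (measurable_powR _)); apply: measurable_funM => //.
apply: (@eq_measurable_fun _ _ _ _ _ (fun y => expR (- (e * b y)))).
  by move=> y _; rewrite expRN.
by apply: measurableT_comp => //; apply: measurableT_comp => //; exact: measurable_funM.
Qed.
Let gv y : (g y `^ r * v y = phi (f y))%R.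
Proof.
have r0 : (0 < r)%R by apply: lt_trans rgt1.
rewrite /g -powRrM mulVf ?gt_eqF// powRr1; first by rewrite divfK// gt_eqF.
by rewrite divr_ge0// ltW.
Qed.
Let gfin : \int[mu]_y (g y `^ r * v y)%:E < +oo.
Proof.
apply: (@le_lt_trans _ _ 1); last exact: ltry.
by under eq_integral do rewrite gv.
Qed.
Let phifQ j x : \int[mu]_(y in cube j x) (phi (f y))%:E <= 1.
Proof. by apply: le_trans phif1; apply: rint_subset. Qed.
Let jn j x m : mu (cube j x) = m%:E ->
  \int[mu]_(y in cube j x) (expR (e0 * `|b y - c j x|))%:E <= 9%:E * m%:E.
Proof. by move=> <-; exact: (john_nirenberg G A0 mb oscb). Qed.
Let vfin j x : \int[mu]_(y in cube j x) (v y)%:E < +oo.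
Proof.
have [m m0 mE] := cube_measureE G j x.
apply: (@le_lt_trans _ _ (9 * m * expR (e * c j x))%:E); last exact: ltry.
exact: (integral_weight_le rgt1 e00 (mcube j x) mb (jn mE) ee0).
Qed.

Lemma measurable_weighted_maximal N :
  measurable_fun [set: T] (weighted_maximal b N).
Proof.
apply: measurable_funM => //; apply: (measurableT_comp (measurable_powR _)).
apply: (measurable_max_averages G); apply: (measurable_step G (j:=0%N)) => x y.
exact: weighted_average_cube.
Qed.

Lemma integral_weighted_maximal N :
  \int[mu]_y (weighted_maximal b N y)%:E <= (2 * doob_const r)%:E.
Proof.
have K0 : (0 <= 2 * doob_const r)%R.
  by rewrite !mulr_ge0 ?powR_ge0 ?invr_ge0 ?subr_ge0 ?(ltW rgt1) ?(le_trans ler01 (ltW rgt1)).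
apply: (le_trans (weighted_maximal_inequality G mv mg v0 g0 rgt1 vfin gfin N)).
rewrite -[leRHS]mule1 lee_wpmul2l ?lee_fin//.
by under eq_integral do rewrite gv.
Qed.

(** [cube_average_weighted] multiplied by [exp (e (b x - c))]: the constant [c] of
    the cube cancels, and what remains depends on the cube only through [S]. *)
Lemma weighted_maximal_ge j x N m a : (j <= N)%N -> (0 < a)%R ->
  mu (cube j x) = m%:E -> (0 < m)%R ->
  \int[mu]_(y in cube j x) ((1 + `|b y - c j x|) * f y)%:E = (a * m)%:E ->
  (phi a * expR (e * (b x - c j x)) <=
   cube_const r cl P k e0 * weighted_maximal b N x)%R.
Proof.
move=> jN a0 mE m0 intE.
have [I [V [Y [IE VE _ V0 SE]]]] := weighted_averageE G mv mg v0 g0 rgt1 vfin gfin j x.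
have S0 := weighted_average_ge0 mu code v0 g0 j x.
set S := weighted_average _ _ _ _ in SE S0.
rewrite SE in IE.
have H := cube_average_weighted gphi rgt1 e00 (mcube j x) m0 mb mf mphif f0 (jn mE)
  a0 intE IE VE S0 V0 ee0.
have Sx : (S j x <= max_averages S N 0 (S 0%N x) x)%R.
  case: j jN {mE intE IE VE SE S0 H} => [_|j jN]; first exact: max_averages_ge.
  exact: le_max_averages.
have cc0 : (0 <= cube_const r cl P k e0)%R.
  exact: cube_const_ge0 gphi rgt1 e00.
apply: (@le_trans _ _ (cube_const r cl P k e0 * expR (e * c j x) * S j x `^ r *
    expR (e * (b x - c j x)))%R).
  by rewrite ler_wpM2r ?expR_ge0.
have -> : (expR (e * (b x - c j x)) = (expR (e * c j x))^-1 * v x)%R.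
  by rewrite -expRN -expRD; congr expR; ring.
rewrite (_ : _ * _ = cube_const r cl P k e0 * (S j x `^ r * v x))%R; last first.
  by field; rewrite gt_eqF ?expR_gt0.
rewrite ler_wpM2l// ler_wpM2r ?expR_ge0//.
apply: ge0_ler_powR; rewrite ?nnegrE ?(le_trans ler01 (ltW rgt1))//.
exact: le_trans Sx.
Qed.

End signed_weight.

Section grid_commutator.
Local Open Scope ereal_scope.
Context d (T : measurableType d) (R : realType).
Variables (mu : {measure set T -> \bar R}) (C : countType).
Variables (code : nat -> T -> C) (D : R) (G : grid mu code D).
Notation cube := (grid_cube code).
Variables (phi psi : R -> R) (r cl P k A : R).
Variables (p' c' P' k' th Kh : R).
Hypotheses (gphi : growth phi (r * r) cl P k) (gpsi : growth psi p' c' P' k').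
Hypotheses (r1 : (1 < r <= 2)%R) (A0 : (0 < A)%R).
Let e0 := jn_exponent A D.
Let e := weight_exponent r e0.
Hypothesis e00 : (0 < e0)%R.
Hypotheses (Kh0 : (0 <= Kh)%R).
Hypothesis hedberg : forall a m, (0 < a)%R -> (0 < m)%R ->
  (phi a * m <= cube_const r cl P k e0)%R -> (psi (m `^ th * a) <= Kh * phi a)%R.
Variable f : T -> R.
Hypotheses (mf : measurable_fun [set: T] f) (f0 : forall x, (0 <= f x)%R).
Hypotheses (mphif : measurable_fun [set: T] (phi \o f)).
Hypothesis phif1 : \int[mu]_y (phi (f y))%:E <= 1.
Variables (b : T -> R) (c : nat -> T -> R).
Hypothesis mb : measurable_fun [set: T] b.
Hypothesis oscb : forall j x,
  \int[mu]_(y in cube j x) `|b y - c j x|%:E <= A%:E * mu (cube j x).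

Let mcube j x : measurable (cube j x). Proof. exact: (measurable_cube G). Qed.
Hint Resolve mcube : core.

(** Both signs of [b] are needed since [b x - c] may have either sign. *)
Definition commutator_majorant N y : R :=
  (weighted_maximal mu code D phi r A f b N y +
   weighted_maximal mu code D phi r A f (fun z => - b z) N y)%R.

Lemma commutator_majorant_ge0 N y : (0 <= commutator_majorant N y)%R.
Proof. by rewrite addr_ge0 ?weighted_maximal_ge0. Qed.

Let mNb : measurable_fun [set: T] (fun z => - b z)%R.
Proof. exact: measurableT_comp. Qed.

Let oscNb j x : \int[mu]_(y in cube j x) `|- b y - - c j x|%:E <= A%:E * mu (cube j x).
Proof.
by under eq_integral do rewrite -opprD normrN.
Qed.

Lemma measurable_commutator_majorant N :
  measurable_fun [set: T] (commutator_majorant N).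
Proof. by apply: measurable_funD; apply: (measurable_weighted_maximal G). Qed.

Lemma integral_commutator_majorant N :
  \int[mu]_y (commutator_majorant N y)%:E <= (4 * doob_const r)%:E.
Proof.
rewrite rintD//; try exact: (measurable_weighted_maximal G);
  try exact: weighted_maximal_ge0.
rewrite (_ : 4 * doob_const r = 2 * doob_const r + 2 * doob_const r)%R; last ring.
rewrite EFinD leeD//.
  exact: (integral_weighted_maximal G gphi r1 A0 e00 f0 mphif phif1 mb oscb).
exact: (integral_weighted_maximal G gphi r1 A0 e00 f0 mphif phif1 mNb oscNb).
Qed.

Let h := (e / (P' + 1))%R.
Definition commutator_const : R :=
  (k' * (1 + h^-1) `^ P' * Kh * cube_const r cl P k e0)%R.

Let e_gt0 : (0 < e)%R.
Proof.
move: r1 e00 => /andP[r1' _] e0'; rewrite /e /weight_exponent.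
apply: divr_gt0 => //; apply: mulr_gt0; first exact: divr_gt0.
by rewrite subr_gt0.
Qed.

Let P'0 : (0 <= P')%R. Proof. exact: growth_P gpsi. Qed.

Let power_le_exp t : (0 <= t)%R -> ((1 + t) `^ P' <= (1 + h^-1) `^ P' * expR (e * t))%R.
Proof.
move=> t0; have P1 : (0 < P' + 1)%R by have := P'0; lra.
have h0 : (0 < h)%R by rewrite divr_gt0.
have h1 : (0 <= 1 + h^-1)%R by rewrite addr_ge0// invr_ge0 ltW.
apply: (@le_trans _ _ (((1 + h^-1) * expR (h * t)) `^ P')%R).
  apply: ge0_ler_powR => //; rewrite ?nnegrE ?addr_ge0// ?mulr_ge0 ?expR_ge0//.
  exact: add1_le_expR.
rewrite powRM ?expR_ge0// ler_wpM2l ?powR_ge0// -expRM ler_expR.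
rewrite /h (_ : e / (P' + 1) * t * P' = e * t * (P' / (P' + 1)))%R; last first.
  by field; rewrite gt_eqF.
apply: ler_piMr; first exact: mulr_ge0 (ltW e_gt0) t0.
by rewrite ler_pdivrMr// mul1r lerDl.
Qed.

(** On a cube around [x] the oscillation splits as
    [`|b x - b y| <= (1 + `|b x - c|) * (1 + `|b y - c|)]. The second factor is
    part of the average [a]; the first one leaves [psi] as a power, hence as an
    exponential of [e (b x - c)] or of its opposite. *)
Lemma commutator_cube_le j x N m : (j <= N)%N -> mu (cube j x) = m%:E -> (0 < m)%R ->
  exists w : R, [/\ (0 <= w)%R,
    (m `^ (th - 1))%:E * \int[mu]_(y in cube j x) (`|b x - b y| * f y)%:E <= w%:E &
    (psi w <= commutator_const * commutator_majorant N x)%R].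
Proof.
move=> jN mE m0.
have rgt1 : (1 < r)%R by case/andP: r1.
have phifQ : \int[mu]_(y in cube j x) (phi (f y))%:E <= 1.
  apply: le_trans phif1; apply: rint_subset => // y.
  exact: (growth_ge0 gphi (f0 y)).
have jn := john_nirenberg G A0 mb oscb j x; rewrite mE -/e0 in jn.
have [a a0 intE] := cube_average_finite gphi rgt1 e00 (mcube j x) m0 mb mf mphif f0 jn phifQ.
pose t := `|b x - c j x|%R.
have t0 : (0 <= t)%R by exact: normr_ge0.
have cc0 := cube_const_ge0 gphi rgt1 e00.
have k'0 := growth_k gpsi.
have Kc0 : (0 <= k' * (1 + h^-1) `^ P' * Kh)%R.
  by rewrite mulr_ge0// mulr_ge0 ?powR_ge0// ltW.
exists ((1 + t) * (m `^ th * a))%R; split.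
- by rewrite mulr_ge0 ?addr_ge0// mulr_ge0 ?powR_ge0.
- apply: (@le_trans _ _ ((m `^ (th - 1))%:E *
      ((1 + t)%:E * \int[mu]_(y in cube j x) ((1 + `|b y - c j x|) * f y)%:E))).
    rewrite lee_wpmul2l ?lee_fin ?powR_ge0// -rintZ//; first last.
    + by rewrite addr_ge0.
    + by move=> y; rewrite mulr_ge0 ?addr_ge0.
    + apply: measurable_funM => //; apply: measurable_funD => //.
      by apply: measurableT_comp => //; exact: measurable_funB.
    apply: rint_le => //.
    + apply: measurable_funM => //.
      by apply: measurableT_comp => //; exact: measurable_funB.
    + apply: measurable_funM => //; apply: measurable_funM => //.
      apply: measurable_funD => //.
      by apply: measurableT_comp => //; exact: measurable_funB.
    + by move=> y; rewrite mulr_ge0.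
    move=> y _; rewrite mulrA ler_wpM2r//.
    have bxy : (`|b x - b y| <= t + `|b y - c j x|)%R.
      rewrite (_ : b x - b y = (b x - c j x) - (b y - c j x))%R; last ring.
      exact: ler_normB.
    apply: (le_trans bxy).
    have : (0 <= t * `|b y - c j x|)%R by rewrite mulr_ge0.
    lra.
  have mm : (m `^ (th - 1) * m = m `^ th)%R.
    rewrite -[X in (_ * X)%R](powRr1 (ltW m0)) -powRD ?subrK//.
    by rewrite (gt_eqF m0) implybT.
  rewrite intE -!EFinM lee_fin -mm le_eqVlt; apply/orP; left; apply/eqP.
  ring.
have [->|aneq0] := eqVneq a 0%R.
  rewrite !mulr0 (growth0 gpsi) mulr_ge0//; last exact: commutator_majorant_ge0.
  by rewrite mulr_ge0.
have agt0 : (0 < a)%R by rewrite lt_neqAle eq_sym aneq0.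
have am := cube_average_le gphi rgt1 e00 (mcube j x) m0 mb mf mphif f0 jn phifQ agt0 intE.
have ma0 : (0 <= m `^ th * a)%R by rewrite mulr_ge0 ?powR_ge0.
have t1 : (1 <= 1 + t)%R by rewrite lerDl.
apply: (le_trans (growth_upper gpsi t1 ma0)).
apply: (@le_trans _ _ (k' * ((1 + h^-1) `^ P' * expR (e * t)) * (Kh * phi a))%R).
  apply: ler_pM => //.
  - by rewrite mulr_ge0 ?powR_ge0// ltW.
  - exact: (growth_ge0 gpsi ma0).
  - by rewrite ler_wpM2l ?(ltW k'0)// power_le_exp.
  - exact: hedberg.
rewrite (_ : _ * _ = k' * (1 + h^-1) `^ P' * Kh * (phi a * expR (e * t)))%R; last ring.
rewrite /commutator_const -[leRHS]mulrA ler_wpM2l//.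
have Wp := weighted_maximal_ge G gphi r1 A0 e00 mf f0 mphif phif1 mb oscb jN agt0 mE m0 intE.
have intNE : \int[mu]_(y in cube j x) ((1 + `|- b y - - c j x|) * f y)%:E = (a * m)%:E.
  by rewrite -intE; apply: eq_integral => y _; rewrite -opprD normrN.
have Wm := weighted_maximal_ge G gphi r1 A0 e00 mf f0 mphif phif1 mNb oscNb jN agt0 mE m0 intNE.
rewrite /commutator_majorant mulrDr.
have phia := growth_ge0 gphi a0.
have [bc|bc] := leP 0%R (b x - c j x)%R.
  rewrite /t ger0_norm// (le_trans Wp)// lerDl mulr_ge0//.
  exact: weighted_maximal_ge0.
rewrite /t ltr0_norm// opprB (_ : c j x - b x = - b x - - c j x)%R; last ring.
rewrite (le_trans Wm)// lerDr mulr_ge0//.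
exact: weighted_maximal_ge0.
Qed.

End grid_commutator.

(** * Boxes, balls and shifted dyadic grids in R^n *)

Section boxes.
Variable R : realType.

Definition box (n : nat) (A : 'I_n -> set R) : set (Rn R n) :=
  [set y | forall i, A i (tnth y i)].

Lemma measurable_box n (A : 'I_n -> set R) : (forall i, measurable (A i)) ->
  measurable (box A).
Proof.
move=> mA.
rewrite (_ : box A = \big[setI/setT]_(i < n) ((fun y : Rn R n => tnth y i) @^-1` (A i))).
  apply: bigsetI_measurable => i _; rewrite -[X in measurable X]setTI.
  by apply: measurable_tnth => //; exact: mA.
rewrite -bigcap_seq; apply/seteqP; split=> y /= yA i; first by move=> _; exact: yA.
by apply: yA => /=; rewrite mem_index_enum.
Qed.

Lemma lebesgue_box n (A : 'I_n -> set R) (l : 'I_n -> R) :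
  (forall i, measurable (A i)) ->
  (forall i, lebesgue_measure (A i) = (l i)%:E) ->
  lebesgue_Rn R n (box A) = (\prod_(i < n) l i)%:E.
Proof.
elim: n A l => [|n IH] A l mA lA.
  rewrite big_ord0 /= /dirac indicE mem_set//.
  by move=> i; have := ltn_ord i; rewrite ltn0.
rewrite big_ord_recl /= /lebesgue_Rn_step /pushforward.
have -> : @Rn_cons R n @^-1` box A =
    A ord0 `*` box (fun i => A (lift ord0 i)).
  apply/seteqP; split=> -[u y] /=.
    move=> yA; split; first by have := yA ord0; rewrite tnth0.
    by move=> i; have := yA (lift ord0 i); rewrite tnthS.
  move=> [u0 yA] i; case: (unliftP ord0 i) => [k ->|->]; first by rewrite tnthS; exact: yA.
  by rewrite tnth0.
rewrite product_measure1E; [|exact: mA|exact: measurable_box].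
rewrite EFinM; congr (_ * _)%E; first exact: lA.
exact: (IH _ (fun i => l (lift ord0 i))).
Qed.

End boxes.

Section balls.
Variables (R : realType) (n : nat).
Notation mu := (lebesgue_Rn R n).
Implicit Types (x y : Rn R n) (t : R).

Definition open_box x t : set (Rn R n) :=
  box (fun i : 'I_n => [set` `](tnth x i : R) - t, (tnth x i : R) + t[]).

Lemma measurable_open_box x t : measurable (open_box x t).
Proof. exact: (measurable_box (fun i => measurable_itv _)). Qed.

Lemma open_boxP x t y : open_box x t y <-> forall i, `|(tnth x i : R) - tnth y i| < t.
Proof.
by split=> xy i; have := xy i; rewrite /= in_itv/= distrC ltr_distl.
Qed.

Lemma lebesgue_open_box x t : 0 < t -> mu (open_box x t) = ((2 * t) ^+ n)%:E.
Proof.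
move=> t0; rewrite (lebesgue_box (l:=fun=> 2 * t))//.
  by rewrite prodr_const card_ord.
move=> i; rewrite lebesgue_measure_itv/= lte_fin.
rewrite ifT -?EFinB; last by rewrite ltrD2l; lra.
by congr EFin; ring.
Qed.

Lemma measurable_eball x t : measurable (eball x t).
Proof.
have mf : measurable_fun [set: Rn R n]
    (fun y => Num.sqrt (\sum_(i < n) ((tnth x i : R) - tnth y i) ^+ 2)).
  apply: measurableT_comp; first by apply: continuous_measurable_fun; exact: sqrt_continuous.
  apply: (@measurable_sum _ (Rn R n) R setT _ _
    (fun i y => ((tnth x i : R) - tnth y i) ^+ 2)) => i.
  by apply: measurable_funX; apply: measurable_funB => //; exact: measurable_tnth.
have := mf measurableT _ (measurable_itv `]-oo, t[).
by congr measurable; apply/seteqP; split=> y; rewrite /eball /= in_itv/= => -[].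
Qed.

Lemma eball_open_box x t : eball x t `<=` open_box x t.
Proof.
move=> y xyt; apply/open_boxP => i; apply: le_lt_trans xyt.
rewrite -sqrtr_sqr ler_wsqrtr// (bigD1 i)//= lerDl sumr_ge0// => k _.
exact: sqr_ge0.
Qed.

(** The divisor [n.+1], rather than the square root of [n], avoids an irrational
    side and keeps the inequality strict for every [n]. *)
Lemma open_box_eball x t : 0 < t -> open_box x (t / n.+1%:R) `<=` eball x t.
Proof.
move=> t0 y /open_boxP xy; rewrite /eball /= -(ger0_norm (ltW t0)) -sqrtr_sqr.
rewrite ltr_sqrt ?exprn_gt0//.
apply: (@le_lt_trans _ _ (\sum_(i < n) (t / n.+1%:R) ^+ 2)).
  apply: ler_sum => i _; rewrite -real_normK ?num_real// ler_sqr ?nnegrE ?divr_ge0 ?(ltW t0)//.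
  exact: ltW.
rewrite sumr_const card_ord expr_div_n -[ltLHS]mulr_natl mulrCA -[ltRHS]mulr1 ltr_pM2l ?exprn_gt0//.
rewrite ltr_pdivrMr ?exprn_gt0// mul1r -natrX ltr_nat.
by rewrite (leq_trans (ltnSn n))// -[leqLHS]expn1 leq_pexp2l.
Qed.

Lemma lebesgue_eballE x t : 0 < t -> exists2 B : R, mu (eball x t) = B%:E &
  (2 * (t / n.+1%:R)) ^+ n <= B <= (2 * t) ^+ n.
Proof.
move=> t0; have tn0 : 0 < t / n.+1%:R by rewrite divr_gt0.
have B1 : (((2 * (t / n.+1%:R)) ^+ n)%:E <= mu (eball x t))%E.
  rewrite -(lebesgue_open_box x)//; apply: le_measure; rewrite ?inE;
    [exact: measurable_open_box|exact: measurable_eball|exact: open_box_eball].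
have B2 : (mu (eball x t) <= ((2 * t) ^+ n)%:E)%E.
  rewrite -(lebesgue_open_box x)//; apply: le_measure; rewrite ?inE;
    [exact: measurable_eball|exact: measurable_open_box|exact: eball_open_box].
move: B1 B2; case: (mu _) => [B||]//; rewrite !lee_fin => B1 B2.
by exists B => //; rewrite B1.
Qed.

End balls.

Section shifted_grid.
Variables (R : realType) (n : nat) (L : R) (sg : {ffun 'I_n -> bool}).
Hypothesis L0 : 0 < L.
Notation mu := (lebesgue_Rn R n).

(** The shift alternates in sign from one scale to the next, so that the
    translated grid is still nested: three times the shift is an integer. *)
Definition grid_shift (j : nat) (i : 'I_n) : R :=
  if sg i then (-1) ^+ j / 3 else 0.

Definition grid_coord (j : nat) (y : Rn R n) (i : 'I_n) : R :=
  2 ^+ j * (tnth y i : R) / L - grid_shift j i.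

Definition grid_code (j : nat) (y : Rn R n) : n.-tuple int :=
  [tuple Num.floor (grid_coord j y i) | i < n].

Notation cube := (grid_cube grid_code).

Lemma grid_codeP j x y : cube j x y <->
  forall i, Num.floor (grid_coord j y i) = Num.floor (grid_coord j x i).
Proof.
rewrite /grid_cube /=; split=> [xy i|xy].
  by have := congr1 (fun t => tnth t i) xy; rewrite /grid_code !tnth_mktuple.
by apply: eq_from_tnth => i; rewrite !tnth_mktuple.
Qed.

Let l j : R := L / 2 ^+ j.
Let l0 j : 0 < l j. Proof. by rewrite divr_gt0 ?exprn_gt0. Qed.

Lemma grid_code_box j (k : n.-tuple int) : [set y | grid_code j y = k] =
  box (fun i => [set` `[((tnth k i)%:~R + grid_shift j i) * l j,
                        ((tnth k i)%:~R + grid_shift j i + 1) * l j[]).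
Proof.
have lE j' : (l j')^-1 = 2 ^+ j' / L by rewrite /l invf_div.
have zE y i : grid_coord j y i = (tnth y i : R) / l j - grid_shift j i.
  by rewrite lE mulrA (mulrC (tnth y i : R)).
apply/seteqP; split=> y /=.
  move=> <- i; rewrite /= in_itv/= tnth_mktuple zE.
  have := floor_itv (((tnth y i : R) / l j) - grid_shift j i).
  rewrite intrD => /andP[h1 h2].
  by rewrite -ler_pdivlMr// -ltr_pdivrMr//; apply/andP; split; lra.
move=> yk; apply: eq_from_tnth => i; rewrite tnth_mktuple zE; apply: floor_def.
have := yk i; rewrite /= in_itv/= -ler_pdivlMr// -ltr_pdivrMr// intrD.
by move=> /andP[? ?]; apply/andP; split; lra.
Qed.

Lemma lebesgue_grid_cube j x : mu (cube j x) = ((l j) ^+ n)%:E.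
Proof.
rewrite /grid_cube grid_code_box (lebesgue_box (l:=fun=> l j)).
- by rewrite prodr_const card_ord.
- by move=> i; exact: measurable_itv.
move=> i; rewrite lebesgue_measure_itv/= lte_fin.
rewrite ifT -?EFinB; last by rewrite ltr_pM2r// ltrDl.
by congr EFin; ring.
Qed.

Lemma grid_code_nested j x y :
  grid_code j.+1 x = grid_code j.+1 y -> grid_code j x = grid_code j y.
Proof.
move=> xy; apply/esym/grid_codeP => i.
have {xy} : Num.floor (grid_coord j.+1 y i) = Num.floor (grid_coord j.+1 x i).
  by move/esym/grid_codeP : xy; apply.
have [p sE] : exists p : int, 3 * grid_shift j i = p%:~R.
  rewrite /grid_shift; case: (sg i); last by exists 0; rewrite mulr0.
  exists ((-1) ^+ j); rewrite rmorphXn/= rmorphN1.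
  by rewrite mulrC divfK.
have s1E : grid_shift j.+1 i = - grid_shift j i.
  by rewrite /grid_shift; case: (sg i); rewrite ?oppr0// exprS mulN1r mulNr.
have zE w : grid_coord j.+1 w i = 2 * grid_coord j w i + p%:~R.
  by rewrite /grid_coord s1E -sE exprS; ring.
move: (grid_coord j.+1 y i) (grid_coord j.+1 x i) (zE y) (zE x) => zy zx zyE zxE zyx.
apply/eqP; rewrite eq_le !floor_ge_int.
have aux (w z : R) (q : int) : Num.floor (2 * w + p%:~R) = Num.floor (2 * z + p%:~R) ->
    q%:~R <= w -> q%:~R <= z.
  move=> wz qw; have : (2 * q + p <= Num.floor (2 * w + p%:~R))%R.
    by rewrite floor_ge_int intrD intrM; lra.
  by rewrite wz floor_ge_int intrD intrM; lra.
by apply/andP; split; [apply: (aux (grid_coord j y i))|apply: (aux (grid_coord j x i))];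
  rewrite -?zyE -?zxE ?zyx// floor_le.
Qed.

Lemma grid_cube_near j x y i : cube j x y -> `|(tnth x i : R) - tnth y i| < l j.
Proof.
rewrite /grid_cube grid_code_box => xy.
have : cube j x x by [].
rewrite /grid_cube grid_code_box => xx.
have := xx i; have := xy i; rewrite /= !in_itv/= => /andP[? ?] /andP[? ?].
by rewrite ltr_distl; apply/andP; split; lra.
Qed.

(** Cubes shrink to points, so an open half-space is a countable union of them,
    and open half-spaces generate the Borel sets. *)
Lemma grid_generates_measurable :
  (@measurable _ (Rn R n)) `<=` <<s [set A | exists j x, A = cube j x] >>.
Proof.
pose T1 := g_sigma_algebraType [set A | exists j x, A = cube j x].
suff mid : measurable_fun [set: T1] (id : T1 -> Rn R n).
  move=> A mA; have := mid measurableT A mA.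
  by rewrite setTI.
apply/measurable_fun_tnthP => i.
apply: (measurability (@RGenOInfty.G R)) => [|_ [_ [a ->] <-]].
  exact: RGenOInfty.measurableE.
rewrite setTI; set S := _ @^-1` _.
have -> : S = \bigcup_j [set y | cube j y `<=` S].
  apply/seteqP; split=> [y Sy|y [j _]]; last exact.
  have ay : 0 < (tnth y i : R) - a.
    by move: Sy; rewrite /S /= in_itv/= andbT subr_gt0.
  have [j jay] : exists j, l j <= (tnth y i : R) - a.
    exists (Num.truncn (L / ((tnth y i : R) - a))).+1.
    rewrite ler_pdivrMr ?exprn_gt0// mulrC -ler_pdivrMr//.
    rewrite (le_trans (ltW (truncnS_gt _)))// -natrX ler_nat.
    by rewrite ltnW// ltn_expl.
  exists j => // z /(grid_cube_near i) zy.
  rewrite /S /= in_itv/= andbT.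
  move: zy; rewrite ltr_distl => /andP[? ?]; lra.
apply: bigcupT_measurable => j.
have -> : [set y | cube j y `<=` S] =
    \bigcup_(k in [set k | exists2 y, cube j y `<=` S & grid_code j y = k])
      [set y | grid_code j y = k].
  apply/seteqP; split=> [y yS|y [_ [z zS <-]] /= yz].
    by exists (grid_code j y) => //; exists y.
  by rewrite (_ : cube j y = cube j z)// /grid_cube yz.
rewrite bigcup_mkcond; apply: countable_bigcupT_measurable => // k.
case: ifPn => // /set_mem [y _ <-].
by apply: sub_sigma_algebra; exists j, y.
Qed.

Lemma shifted_grid : grid mu grid_code (2 ^+ n).
Proof.
have muE j x : (mu : {measure set (Rn R n) -> \bar R}) (cube j x) = ((l j) ^+ n)%:E.
  exact: lebesgue_grid_cube.
split.
- move=> j k; rewrite grid_code_box.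
  exact: (measurable_box (fun i => measurable_itv _)).
- exact: grid_code_nested.
- by move=> j x; rewrite muE lte_fin exprn_gt0.
- by move=> j x; rewrite muE ltry.
- move=> j x; rewrite !muE -EFinM lee_fin -exprMn.
  rewrite (_ : 2 * l j.+1 = l j)// /l exprS; field.
  by rewrite expf_neq0.
- exact: grid_generates_measurable.
Qed.

Lemma grid_cube_eball j x : cube j x `<=` eball x (n.+1%:R * l j).
Proof.
move=> y xy; apply: open_box_eball; first by rewrite mulr_gt0.
apply/open_boxP => i; rewrite mulrC mulKf ?pnatr_eq0//.
exact: grid_cube_near.
Qed.

(** The constant attached to a cube is the mean of [b] on a ball that contains
    it and has comparable measure. *)
Lemma grid_oscillation (b : Rn R n -> R) (B : R) : bmo b -> 0 < B ->
  (bmo_norm b <= B%:E)%E -> forall j x,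
  (\int[mu]_(y in cube j x) `|b y - average b (eball x (n.+1%:R * l j))|%:E <=
   (B * (2 * n.+1%:R) ^+ n)%:E * mu (cube j x))%E.
Proof.
move=> [[mb _] _] B0 bB j x; set t := n.+1%:R * l j.
have t0 : 0 < t by rewrite mulr_gt0.
set c := average _ _.
have mbc : measurable_fun [set: Rn R n] (fun y => `|b y - c|).
  by apply: measurableT_comp => //; exact: measurable_funB.
have [m mE /andP[m1 m2]] := lebesgue_eballE x t0.
have m0 : 0 < m by apply: lt_le_trans m1; rewrite exprn_gt0// mulr_gt0// divr_gt0.
apply: (@le_trans _ _ (\int[mu]_(y in eball x t) `|b y - c|%:E)%E).
  apply: rint_subset => //; last exact: grid_cube_eball.
    exact: (measurable_cube shifted_grid).
  exact: measurable_eball.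
have : (m^-1%:E * \int[mu]_(y in eball x t) `|b y - c|%:E <= B%:E)%E.
  apply: le_trans bB; apply: ereal_sup_ubound.
  by exists (x, t) => //=; rewrite mE.
rewrite lee_pdivrMl// => /le_trans; apply.
rewrite lebesgue_grid_cube -!EFinM lee_fin mulrC -mulrA ler_pM2l//.
by rewrite (le_trans m2)// -exprMn /t mulrA.
Qed.

End shifted_grid.

(** The one-third trick: around a point, the integers and their translates by
    one third cannot both come closer than one sixth. *)
Lemma one_third_trick (R : realType) (n : nat) (L : R) (x : Rn R n) (t : R) (j : nat) :
  0 < L -> 0 < t -> 6 * t * 2 ^+ j <= L ->
  exists sg : {ffun 'I_n -> bool}, open_box x t `<=` grid_cube (grid_code L sg) j x.
Proof.
move=> L0 t0 tL.
pose z (y : Rn R n) (i : 'I_n) := 2 ^+ j * (tnth y i : R) / L.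
pose fr i := z x i - (Num.floor (z x i))%:~R.
exists [ffun i => ~~ (6^-1 <= fr i <= 5 / 6)] => y /open_boxP xy.
apply/grid_codeP => i; rewrite /grid_coord /grid_shift ffunE -!/(z _ i).
have zxy : `|z x i - z y i| < 6^-1.
  rewrite /z -mulrBl -mulrBr normrM normrM (ger0_norm (_ : 0 <= L^-1)) ?invr_ge0 ?ltW//.
  rewrite (ger0_norm (_ : 0 <= 2 ^+ j))// ltr_pdivrMr//.
  apply: (@lt_le_trans _ _ (2 ^+ j * t)); first by rewrite ltr_pM2l ?exprn_gt0.
  by move: tL; lra.
have /andP[f0 f1] := floor_itv (z x i).
rewrite intrD in f1; rewrite /fr.
move: zxy; rewrite ltr_distl => /andP[zy1 zy2].
set k := Num.floor (z x i) in f0 f1 *.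
have [/andP[k1 k2]|] := boolP (6^-1 <= z x i - k%:~R <= 5 / 6).
  rewrite /= !subr0; rewrite -[RHS]/k.
  by apply: floor_def; rewrite intrD; apply/andP; split; lra.
rewrite negb_and -!ltNge /= => /orP k12.
have E q q' (s : R) : q%:~R <= z y i - s < q%:~R + 1 ->
    q'%:~R <= z x i - s < q'%:~R + 1 -> q = q' -> 
    Num.floor (z y i - s) = Num.floor (z x i - s).
  by move=> qy qx qq; rewrite (@floor_def _ _ q) ?(@floor_def _ _ q') ?intrD.
rewrite -signr_odd; case: (odd j) => /=; rewrite ?expr0 ?expr1.
- case: k12 => k12.
    apply: (E k k); rewrite ?intrD //; apply/andP; split; lra.
  apply: (E (k + 1) (k + 1)); rewrite ?intrD //; apply/andP; split; lra.
- case: k12 => k12.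
    apply: (E (k - 1) (k - 1)); rewrite ?intrB //; apply/andP; split; lra.
  apply: (E k k); rewrite ?intrD //; apply/andP; split; lra.
Qed.

(** * Measurability of the maximal commutator *)

Section measurability.
Variables (R : realType) (n : nat) (alpha : R).
Notation mu := (lebesgue_Rn R n).
Notation E := (Rn R n).
Hypothesis alphan : alpha < n%:R.
Variables (b : E -> R) (f : E -> \bar R).
Hypotheses (mb : measurable_fun [set: E] b) (mf : measurable_fun [set: E] f).

Let near_set (t : R) : set (E * E) := [set p | eball p.1 t p.2].

Let measurable_near_set t : measurable (near_set t).
Proof.
have ms : measurable_fun [set: E * E]
    (fun p => Num.sqrt (\sum_(i < n) ((tnth p.1 i : R) - tnth p.2 i) ^+ 2)).
  apply: measurableT_comp; first by apply: continuous_measurable_fun; exact: sqrt_continuous.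
  apply: (@measurable_sum _ (E * E)%type R setT _ _
    (fun i p => ((tnth p.1 i : R) - tnth p.2 i) ^+ 2)) => i.
  apply: measurable_funX; apply: measurable_funB.
    exact: (measurableT_comp (measurable_tnth i) measurable_fst).
  exact: (measurableT_comp (measurable_tnth i) measurable_snd).
have := ms measurableT _ (measurable_itv `]-oo, t[).
by congr measurable; apply/seteqP; split=> y; rewrite /near_set /eball /= in_itv/= => -[].
Qed.

Definition fractional_average (t : R) (x : E) : \bar R :=
  ((fine (mu (eball x t)) `^ (- 1 + alpha / n%:R))%:E *
   \int[mu]_(y in eball x t) (`|b x - b y|%:E * `|f y|))%E.

Lemma fractional_average_ge0 t x : (0 <= fractional_average t x)%E.
Proof.
by rewrite mule_ge0 ?lee_fin ?powR_ge0// integral_ge0// => y _; rewrite mule_ge0.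
Qed.

Let osc (p : E * E) : \bar R := (`|b p.1 - b p.2|%:E * `|f p.2|)%E.

Let mosc : measurable_fun [set: E * E] osc.
Proof.
apply: emeasurable_funM.
  apply/measurable_EFinP; apply: measurableT_comp => //.
  apply: measurable_funB.
    exact: (measurableT_comp mb measurable_fst).
  exact: (measurableT_comp mb measurable_snd).
apply: measurableT_comp => //.
exact: (measurableT_comp mf measurable_snd).
Qed.

Lemma measurable_fractional_average t : measurable_fun [set: E] (fractional_average t).
Proof.
apply: emeasurable_funM.
  apply/measurable_EFinP; apply: (measurableT_comp (measurable_powR _)).
  apply: measurableT_comp => //.
  have := measurable_fun_xsection mu (measurable_near_set t).
  apply: eq_measurable_fun => x _ /=; congr (mu _).
  by apply/seteqP; split=> y; rewrite /xsection/= ?inE.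
have mk : measurable_fun [set: E * E] (osc \_ (near_set t)).
  by apply/(measurable_restrictT _ (measurable_near_set t)); exact: measurable_funS mosc.
have k0 p : (0 <= (osc \_ (near_set t)) p)%E.
  by rewrite /patch; case: ifPn => // _; rewrite mule_ge0.
have := measurable_fun_fubini_tonelli_F (m2:=mu) _ mk k0.
apply: eq_measurable_fun => x _; rewrite /fubini_F [RHS]integral_mkcond.
apply: eq_integral => y _; rewrite /patch.
by congr (if _ then _ else _); apply/idP/idP; rewrite !inE.
Qed.

(** The integral over a ball is left continuous in the radius and the power of
    its measure nonincreasing, so that rational radii suffice. *)
Lemma fractional_average_rational (t : R) (x : E) (s : \bar R) : 0 < t ->
  (forall q : rat, 0 < q -> (fractional_average (ratr q) x <= s)%E) ->
  (fractional_average t x <= s)%E.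
Proof.
move=> t0 qs.
have ex0 : - 1 + alpha / n%:R <= 0.
  have [n0|n0] := posnP n; first by rewrite [in _%:R]n0 invr0 mulr0 addr0 oppr_le0.
  by rewrite addrC subr_le0 ler_pdivrMr ?ltr0n// mul1r ltW.
have [B BE /andP[B1 _]] := lebesgue_eballE x t0.
have B0 : 0 < B by apply: lt_le_trans B1; rewrite exprn_gt0// mulr_gt0// divr_gt0.
set ex := - 1 + _ in ex0.
pose h y := (`|b x - b y|%:E * `|f y|)%E.
have h0 y : (0 <= h y)%E by rewrite mule_ge0.
have mh : measurable_fun [set: E] h.
  apply: emeasurable_funM; last exact: measurableT_comp.
  apply/measurable_EFinP; apply: measurableT_comp => //.
  exact: measurable_funB.
have Gq (q : R) : 0 < q -> q < t -> (exists p : rat, q = ratr p) ->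
    (\int[mu]_(y in eball x q) h y <= (B `^ ex)^-1%:E * s)%E.
  move=> q0 qt [p pE]; rewrite lee_pdivlMl ?powR_gt0//.
  have p0 : 0 < p by move: q0; rewrite pE ltr0q.
  apply: le_trans (qs p p0); rewrite -pE.
  have [Bq BqE /andP[Bq1 _]] := lebesgue_eballE x q0.
  have Bq0 : 0 < Bq by apply: lt_le_trans Bq1; rewrite exprn_gt0// mulr_gt0// divr_gt0.
  rewrite /fractional_average BqE lee_wpmul2r ?integral_ge0// lee_fin -/ex /=.
  have powE (u : R) : u `^ ex = (u `^ (- ex))^-1 by rewrite powRN invrK.
  rewrite !powE lef_pV2 ?posrE ?powR_gt0//.
  apply: ge0_ler_powR; rewrite ?oppr_ge0 ?nnegrE ?(ltW Bq0) ?(ltW B0)//.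
  rewrite -lee_fin -BE -BqE; apply: le_measure; rewrite ?inE; try exact: measurable_eball.
  by move=> y; rewrite /eball /= => /lt_trans; apply.
have /choice[q qP] (k : nat) : exists q : rat, t - t / k.+2%:R < ratr q < t.
  have tk : t - t / k.+2%:R < t by rewrite ltrBlDr ltrDl divr_gt0.
  by have [q] := rat_in_itvoo tk; rewrite in_itv/= => tqt; exists q.
have q0 k : 0 < ratr (q k) :> R.
  have /andP[+ _] := qP k; apply: le_lt_trans.
  by rewrite subr_ge0 ler_pdivrMr// ler_peMr ?(ltW t0)// ler1n.
rewrite /fractional_average BE -/ex /= -lee_pdivlMl ?powR_gt0//.
rewrite integral_mkcond; apply: (integral_le_eventually
  (f:=fun k => h \_ (eball x (ratr (q k))))) => //.
- move=> k; apply/(measurable_restrictT _ (measurable_eball _ _)).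
  exact: measurable_funS mh.
- by move=> k y _; rewrite /patch; case: ifPn.
- apply/(measurable_restrictT _ (measurable_eball _ _)).
  exact: measurable_funS mh.
- by move=> y _; rewrite /patch; case: ifPn.
- move=> y z _; rewrite /patch; case: ifPn => [/set_mem yt zh|_ z0]; last first.
    by exists 0%N => k _; apply: (le_trans (ltW z0)); case: ifPn.
  rewrite /eball /= in yt; set dl := Num.sqrt _ in yt.
  exists (Num.truncn (t / (t - dl))) => k Nk; rewrite ifT; first exact: ltW.
  rewrite inE /eball /= -/dl; have /andP[+ _] := qP k; apply: le_lt_trans.
  have tdl : 0 < t - dl by rewrite subr_gt0.
  rewrite lerBrDl -lerBrDr ler_pdivrMr// mulrC -ler_pdivrMr//.
  rewrite (le_trans (ltW (truncnS_gt _)))// ler_nat ltnS.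
  exact: leqW.
- move=> k; rewrite -integral_mkcond; apply: Gq => //; last by exists (q k).
  by have /andP[] := qP k.
Qed.

Lemma measurable_frac_max_commutator :
  measurable_fun [set: E] (frac_max_commutator alpha b f).
Proof.
pose r (k : nat) : R := 
    if (unpickle k : option rat) is Some q then (if 0 < q then ratr q else 1) else 1.
have r0 k : 0 < r k.
  by rewrite /r; case: (unpickle k) => // q; case: ifPn => // q0; rewrite ltr0q.
have := @measurable_fun_esups _ E R setT (fun k => fractional_average (r k))
  (fun k => measurable_fractional_average (r k)) 0%N.
apply: eq_measurable_fun => x _; rewrite /frac_max_commutator.
apply/eqP; rewrite eq_le; apply/andP; split.
  apply: le_ereal_sup => _ [k _ <-]; exists (r k) => //=.
apply: ub_ereal_sup => _ [t /= t0 <-].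
apply: fractional_average_rational => // q q0.
apply: ereal_sup_ubound; exists (pickle q) => //.
by rewrite /r pickleK q0.
Qed.

End measurability.

(** * Modular bound for the maximal commutator *)

Section measurable_young_ext.
Context d (T : measurableType d) (R : realType).
Variables (psi : R -> R) (Psi : R -> \bar R).
Hypothesis psi_nd : forall s t, 0 <= s -> s <= t -> psi s <= psi t.

Lemma measurable_nd_comp (h : T -> R) : measurable_fun [set: T] h ->
  (forall x, 0 <= h x) -> measurable_fun [set: T] (psi \o h).
Proof.
move=> mh h0.
apply: (@eq_measurable_fun _ _ _ _ _ ((fun u => psi (Num.max 0 u)) \o h)).
  by move=> x _ /=; rewrite max_r.
apply: measurableT_comp mh; apply: nondecreasing_measurable => // s t st.
by apply: psi_nd; [rewrite le_max lexx|rewrite ge_max !le_max lexx st orbT].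
Qed.

Lemma measurable_young_ext (h : T -> \bar R) :
  (forall t, 0 <= t -> Psi t = (psi t)%:E) ->
  measurable_fun [set: T] h -> (forall x, 0 <= h x)%E ->
  measurable_fun [set: T] (fun x => young_ext Psi (h x)).
Proof.
move=> PsiE mh h0.
apply: (@eq_measurable_fun _ _ _ _ _
  (fun x => if h x == +oo%E then +oo%E else (psi (fine (h x)))%:E)).
  move=> x _; case: (h x) (h0 x) => [u||]//=; rewrite lee_fin => u0.
  by rewrite PsiE.
apply: measurable_fun_ifT => //.
  apply: (measurable_fun_bool true).
  rewrite (_ : _ @^-1` _ = h @^-1` [set +oo%E]).
    by exact: (mh measurableT _ (emeasurable_set1 _)).
  by apply/seteqP; split=> x /= /eqP.
apply/measurable_EFinP; apply: measurable_nd_comp.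
  exact: measurableT_comp.
by move=> x; exact: fine_ge0.
Qed.

End measurable_young_ext.

Section modular_bound.
Variables (R : realType) (n : nat) (alpha : R).
Notation E := (Rn R n).
Notation mu := (lebesgue_Rn R n).
Hypotheses (n0 : (0 < n)%N) (alphan : alpha < n%:R).
Variables (phi psi : R -> R) (Psi : R -> \bar R).
Variables (r cl P k p' c' P' k' Kh B : R).
Hypotheses (gphi : growth phi (r * r) cl P k) (gpsi : growth psi p' c' P' k').
Hypotheses (r1 : 1 < r <= 2) (B0 : 0 < B) (Kh0 : 0 <= Kh).
Hypothesis PsiE : forall t, 0 <= t -> Psi t = (psi t)%:E.
Hypothesis psi_unbounded : forall z, exists2 w, 0 <= w & z <= psi w.

Let th := alpha / n%:R.
Definition osc_const : R := B * (2 * n.+1%:R) ^+ n.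
Let A := osc_const.
Let D : R := 2 ^+ n.
Definition jn_Rn : R := jn_exponent A D.
Let e0 := jn_Rn.

Hypothesis hedberg : forall a m, 0 < a -> 0 < m ->
  phi a * m <= cube_const r cl P k e0 -> psi (m `^ th * a) <= Kh * phi a.

Variable b : E -> R.
Hypotheses (bmob : bmo b) (bB : (bmo_norm b <= B%:E)%E).
Variable f : E -> R.
Hypotheses (mf : measurable_fun [set: E] f) (f0 : forall x, 0 <= f x).
Hypotheses (mphif : measurable_fun [set: E] (phi \o f)).
Hypothesis phif1 : (\int[mu]_y (phi (f y))%:E <= 1)%E.

Let A0 : 0 < A. Proof. by rewrite mulr_gt0// exprn_gt0// mulr_gt0. Qed.
Let e00 : 0 < e0.
Proof. by rewrite divr_gt0 ?ln_gt0 ?ltr1n// addr_gt0// !mulr_gt0// exprn_gt0. Qed.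
Let mb : measurable_fun [set: E] b. Proof. by case: bmob => -[]. Qed.

Let side (N : nat) : R := 2 ^+ N.
Let side0 N : 0 < side N. Proof. by rewrite exprn_gt0. Qed.
Let code N sg := grid_code (side N) sg : nat -> E -> n.-tuple int.
Let G N sg : grid mu (code N sg) D := shifted_grid sg (side0 N).
Let oscb N sg j x := @grid_oscillation R n (side N) sg (side0 N) b B bmob B0 bB j x.
Let cc := commutator_const D r cl P k A P' k' Kh.
Let maj N sg := commutator_majorant mu (code N sg) D phi r A f b (2 * N).
Let Z N y := \sum_(sg : {ffun 'I_n -> bool}) (cc * maj N sg y).

Let cc0 : 0 <= cc.
Proof.
have rgt1 : 1 < r by case/andP: r1.
rewrite /cc /commutator_const mulr_ge0//; last exact: (cube_const_ge0 gphi rgt1 e00).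
by rewrite mulr_ge0// mulr_ge0 ?powR_ge0// ltW// (growth_k gpsi).
Qed.

Let maj0 N sg y : 0 <= cc * maj N sg y.
Proof. by rewrite mulr_ge0// commutator_majorant_ge0. Qed.

(** The cost of replacing the power of the measure of a ball of radius [t] by that
    of a cube of side at most [12 t]. *)
Definition radius_const : R := ((6 * n.+1%:R) ^+ n) `^ (1 - th).

Let rc0 : 0 < radius_const.
Proof. by rewrite powR_gt0// exprn_gt0// mulr_gt0. Qed.

Let th1 : th < 1.
Proof. by rewrite /th ltr_pdivrMr ?ltr0n// mul1r. Qed.

(** The one-third trick needs a cube of side between [6 t] and [12 t]. The
    coarsest side [2 ^ N] and the number [2 N] of levels grow together, so that
    every radius is eventually covered. *)
Lemma scale_exists (t : R) : 0 < t -> exists N0, forall N, (N0 <= N)%N ->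
  exists2 j, (j <= 2 * N)%N & 6 * t * 2 ^+ j <= side N < 12 * t * 2 ^+ j.
Proof.
move=> t0; have t60 : 0 < 6 * t by rewrite mulr_gt0.
have big (u : R) N : ((Num.truncn u).+1 <= N)%N -> u <= 2 ^+ N.
  move=> uN; apply: (le_trans (ltW (truncnS_gt u))); rewrite -natrX ler_nat.
  by apply: (leq_trans uN); rewrite ltnW// ltn_expl.
exists (maxn (Num.truncn (6 * t)).+1 (Num.truncn (6 * t)^-1).+1) => N.
rewrite geq_max => /andP[/big N1 /big N2].
pose fits j := 6 * t * 2 ^+ j <= side N.
have exP : exists j, fits j by exists 0%N; rewrite /fits expr0 mulr1.
have ubP j : fits j -> (j <= 2 * N)%N.
  rewrite /fits leqNgt => tj; apply/negP => Nj.
  have : (2 ^+ N.*2.+1 <= 2 ^+ j :> R) by rewrite ler_eXn2l ?ltr1n// -mul2n.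
  rewrite -(ler_pM2l t60) => /le_trans /(_ tj).
  have : 1 <= 6 * t * 2 ^+ N by rewrite -ler_pdivrMl// mulr1.
  rewrite exprS -addnn exprD -/(side N); have := side0 N; nra.
have [j tj jmax] := ex_maxnP exP ubP.
exists j; first exact: ubP.
apply/andP; split; first exact: tj.
rewrite ltNge; apply/negP => tj1.
have /jmax : fits j.+1 by rewrite /fits exprS; move: tj1; lra.
by rewrite ltnn.
Qed.

Lemma fractional_average_majorant x t : 0 < t -> exists N0, forall N, (N0 <= N)%N ->
  exists w, [/\ 0 <= w,
    (fractional_average alpha b (EFin \o f) t x <= (radius_const * w)%:E)%E &
    psi w <= Z N x].
Proof.
move=> t0; have [N0 HN] := scale_exists t0; exists N0 => N /HN[j jN /andP[j1 j2]].
have [sg Hsg] := one_third_trick x (side0 N) t0 j1.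
have [m m0 mE] := cube_measureE (G N sg) j x.
have [w [w0 wle wpsi]] := commutator_cube_le (G N sg) gphi gpsi r1 A0 e00 Kh0 hedberg
  mf f0 mphif phif1 mb (oscb N sg) jN mE m0.
exists w; split => //; last first.
  have Zsg : cc * maj N sg x <= Z N x.
    by rewrite /Z (bigD1 sg)// lerDl; apply: sumr_ge0 => s _; exact: maj0.
  exact: le_trans wpsi Zsg.
have mE' : m = (side N / 2 ^+ j) ^+ n.
  by apply/EFin_inj; rewrite -mE; exact: (lebesgue_grid_cube sg (side0 N)).
have [Bt BE /andP[B1 _]] := lebesgue_eballE x t0.
have Bm : m / (6 * n.+1%:R) ^+ n <= Bt.
  apply: le_trans B1; rewrite mE' -expr_div_n lerXn2r ?nnegrE//.
  - by rewrite !divr_ge0 ?mulr_ge0 ?exprn_ge0 ?ltW.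
  - by rewrite mulr_ge0// divr_ge0// ltW.
  rewrite ler_pdivrMr ?mulr_gt0//.
  have q0 : n.+1%:R != 0 :> R by rewrite pnatr_eq0.
  rewrite (_ : 2 * _ * _ = 12 * t); last first.
    by move: (n.+1%:R) q0 => q q0; field.
  by rewrite ler_pdivrMr ?exprn_gt0// ltW.
have m60 : 0 < m / (6 * n.+1%:R) ^+ n by rewrite divr_gt0// exprn_gt0// mulr_gt0.
have Bt0 : 0 < Bt by apply: lt_le_trans Bm.
have powB : Bt `^ (- 1 + th) <= radius_const * m `^ (th - 1).
  have powE (u : R) : u `^ (th - 1) = (u `^ (1 - th))^-1 by rewrite -powRN opprB.
  rewrite (addrC (- 1)).
  apply: (@le_trans _ _ ((m / (6 * n.+1%:R) ^+ n) `^ (th - 1))).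
    rewrite !powE lef_pV2 ?posrE ?powR_gt0//.
    apply: ge0_ler_powR; rewrite ?nnegrE ?(ltW m60) ?(ltW Bt0)//.
    by rewrite subr_ge0 ltW.
  rewrite powRM ?(ltW m0) ?invr_ge0 ?exprn_ge0 ?mulr_ge0// mulrC ler_wpM2r ?powR_ge0//.
  rewrite -powR_inv1 ?exprn_ge0 ?mulr_ge0// -powRrM mulN1r opprB.
  exact: lexx.
rewrite /fractional_average BE /= -/th EFinM.
apply: (@le_trans _ _ ((radius_const * m `^ (th - 1))%:E *
    \int[mu]_(y in grid_cube (code N sg) j x) (`|b x - b y| * f y)%:E)%E).
  apply: lee_pmul => //.
  - by rewrite lee_fin powR_ge0.
  - by apply: integral_ge0 => y _; rewrite mule_ge0.
  rewrite (eq_integral (fun y => (`|b x - b y| * f y)%:E)); last first.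
    by move=> y _ /=; rewrite [`|f y|]ger0_norm.
  apply: rint_subset.
  - exact: measurable_eball.
  - exact: (measurable_cube (G N sg)).
  - apply: measurable_funM => //; apply: measurableT_comp => //.
    exact: measurable_funB.
  - by move=> y; rewrite mulr_ge0.
  - by apply: subset_trans Hsg; exact: eball_open_box.
by rewrite EFinM -muleA lee_wpmul2l// lee_fin ltW.
Qed.

Definition modular_const : R :=
  #|{ffun 'I_n -> bool}|%:R * (cc * (4 * doob_const r)).

Lemma integral_majorant_sum N : (\int[mu]_y (Z N y)%:E <= modular_const%:E)%E.
Proof.
have mmaj sg : measurable_fun [set: E] (maj N sg).
  exact: (measurable_commutator_majorant (G N sg)).
under eq_integral do rewrite /Z -sumEFin.
rewrite ge0_integral_sum//; last 2 first.
- by move=> sg; apply: measurable_real_integrand; exact: measurable_funM.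
- by move=> sg y _; rewrite lee_fin.
rewrite /modular_const -sum1_card natr_sum big_distrl/= -sumEFin lee_sum// => sg _.
rewrite mul1r rintZ//; last by move=> y; exact: commutator_majorant_ge0.
rewrite [leRHS]EFinM lee_wpmul2l ?lee_fin//.
exact: (integral_commutator_majorant (G N sg) gphi r1 A0 e00 f0 mphif phif1 mb (oscb N sg)).
Qed.

(** Fatou's lemma in [N]. The factor two in [2 * radius_const] leaves room to pick
    a single radius that almost attains the supremum. *)
Theorem modular_bound :
  (\int[mu]_x young_ext Psi
     (`|frac_max_commutator alpha b (EFin \o f) x| * ((2 * radius_const)^-1)%:E)
   <= modular_const%:E)%E.
Proof.
set M := frac_max_commutator alpha b (EFin \o f).
have M0 x : (0 <= M x)%E.
  apply: le_trans (fractional_average_ge0 alpha b (EFin \o f) 1 x) _.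
  by apply: ereal_sup_ubound; exists 1 => //=.
have mM : measurable_fun [set: E] M.
  by apply: measurable_frac_max_commutator => //; exact/measurable_EFinP.
have rc20 : 0 < 2 * radius_const by rewrite mulr_gt0.
have F0 x : (0 <= `|M x| * ((2 * radius_const)^-1)%:E)%E.
  by rewrite mule_ge0// lee_fin invr_ge0 ltW.
apply: (integral_le_eventually (f:=fun N x => (Z N x)%:E)) => //.
- move=> N; apply: measurable_real_integrand; apply: (@measurable_sum _ E R setT _ _
    (fun sg y => cc * maj N sg y)) => sg.
  apply: measurable_funM => //.
  exact: (measurable_commutator_majorant (G N sg)).
- by move=> N x _; rewrite lee_fin sumr_ge0.
- apply: (measurable_young_ext (growth_nd gpsi) PsiE) => //.
  apply: emeasurable_funM => //; exact: measurableT_comp.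
- move=> x _; case: (_ * _)%E (F0 x) => [u||]//=; rewrite lee_fin => u0.
  by rewrite PsiE// lee_fin (growth_ge0 gpsi).
- move=> x z _ zF.
  have [z0|z0] := leP z 0.
    by exists 0%N => N _; rewrite lee_fin (le_trans z0)// sumr_ge0.
  suff [w [t [w0 t0 wt zw]]] : exists w t, [/\ 0 <= w, 0 < t,
      ((radius_const * w)%:E < fractional_average alpha b (EFin \o f) t x)%E & z <= psi w].
    have [N0 HN] := fractional_average_majorant x t0.
    exists N0 => N /HN[w' [w'0 w'le w'psi]].
    rewrite lee_fin (le_trans zw)// (le_trans _ w'psi)//; apply: (growth_nd gpsi w0).
    have := lt_le_trans wt w'le; rewrite lte_fin ltr_pM2l// => /ltW.
    done.
  have supM u : (u < M x)%E -> exists2 t, 0 < t &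
      (u < fractional_average alpha b (EFin \o f) t x)%E.
    by move=> /ereal_sup_gt[_ [t /= t0 <-] ut]; exists t.
  have [Moo|Mfin] := eqVneq (M x) +oo%E.
    have [w w0 zw] := psi_unbounded z.
    have [|t t0 ut] := supM (radius_const * w)%:E; first by rewrite Moo ltry.
    by exists w, t.
  move: zF (supM); rewrite gee0_abs//; case: (M x) (M0 x) Mfin => [u||]// u0 _.
  rewrite lee_fin in u0; rewrite -EFinM/= PsiE; last by rewrite divr_ge0// ltW.
  rewrite lte_fin => zu sup.
  have un0 : u != 0.
    by apply: contraTneq zu => ->; rewrite mul0r (growth0 gpsi) -leNgt ltW.
  have ugt0 : 0 < u by rewrite lt_neqAle eq_sym un0.
  have [|t t0 ut] := sup (u / 2)%:E; first by rewrite lte_fin; lra.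
  exists (u / (2 * radius_const)), t; split => //.
  - by rewrite divr_ge0// ltW.
  - rewrite (_ : radius_const * _ = u / 2)//.
    by field; rewrite gt_eqF.
  - exact: ltW.
- exact: integral_majorant_sum.
Qed.

End modular_bound.

(** * Young functions in Delta_2 and nabla_2 *)

Section young.
Variable R : realType.
Implicit Types (Phi : R -> \bar R) (s t : R).

Lemma young_scale Phi (c t : R) : young Phi -> 0 <= c <= 1 -> 0 <= t ->
  (Phi (c * t)%R <= c%:E * Phi t)%E.
Proof.
move=> yPhi c01 t0; have := young_convex yPhi t0 (lexx 0) c01.
by rewrite mulr0 addr0 (young0 yPhi) mule0 adde0.
Qed.

Lemma young_nd Phi s t : young Phi -> 0 <= s -> s <= t -> (Phi s <= Phi t)%E.
Proof.
move=> yPhi s0 st; have t0 : 0 <= t by exact: le_trans st.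
have [t00|tn0] := eqVneq t 0.
  by rewrite (_ : s = t)//; apply/eqP; rewrite eq_le st t00 s0.
have tp : 0 < t by rewrite lt_neqAle eq_sym tn0.
have st01 : 0 <= s / t <= 1 by rewrite divr_ge0//= ler_pdivrMr// mul1r.
have := young_scale yPhi st01 t0; rewrite divfK// => /le_trans; apply.
by apply: gee_pMl; rewrite ?(young_ge0 yPhi)//; case/andP: st01.
Qed.

Lemma young_unbounded Phi (z : R) : young Phi -> exists2 w, 0 < w & (z%:E <= Phi w)%E.
Proof.
move=> yPhi; have [w [w0 zw]] : exists w, 0 < w /\ (z%:E <= Phi w)%E.
  apply: (@filter_ex _ (+oo%R : set_system R)); apply: filterI.
    exact: nbhs_pinfty_gt.
  exact: cvgey_ge (young_cvgy yPhi) z.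
by exists w.
Qed.

Lemma young_finite_point Phi : young Phi -> exists2 w, 0 < w & (Phi w < +oo)%E.
Proof.
move=> yPhi; have [w [w0 zw]] : exists w, 0 < w /\ (Phi w < 1)%E.
  apply: (@filter_ex _ (0%R^'+ : set_system R)); apply: filterI.
    exact: nbhs_right_gt.
  have n1 : nbhs (0%E : \bar R) [set y | (y < 1)%E].
    by apply: open_nbhs_nbhs; split; [exact: open_ereal_lt_ereal|rewrite /= lte_fin].
  exact: (young_cvg0 yPhi n1).
by exists w => //; rewrite (lt_trans zw)// ltry.
Qed.

Lemma Delta2_iter Phi C : young Phi -> 1 < C ->
  (forall t, 0 < t -> (Phi (2 * t)%R <= C%:E * Phi t)%E) ->
  forall (k : nat) t, 0 < t -> (Phi (2 ^+ k * t)%R <= (C ^+ k)%:E * Phi t)%E.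
Proof.
move=> yPhi C1 d2; elim=> [|k IH] t t0; first by rewrite !expr0 !mul1r mul1e.
have C0 : 0 < C by exact: lt_trans C1.
rewrite exprS -mulrA (le_trans (d2 _ _))//; first by rewrite mulr_gt0// exprn_gt0.
by rewrite exprS EFinM -muleA lee_wpmul2l ?IH// lee_fin ltW.
Qed.

Lemma le_pow2_mul (t u : R) : 0 < u -> exists k : nat, t <= 2 ^+ k * u.
Proof.
move=> u0; exists (Num.truncn (t / u)).+1; rewrite -ler_pdivrMr//.
rewrite (le_trans (ltW (truncnS_gt _)))// -natrX ler_nat.
by rewrite ltnW// ltn_expl.
Qed.

(** Delta_2 propagates finiteness from small arguments to all. *)
Lemma young_finE Phi : young Phi -> Delta2 Phi ->
  forall t, 0 <= t -> Phi t = (fine (Phi t))%:E.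
Proof.
move=> yPhi [C C1 d2] t t0.
have [w w0 fw] := young_finite_point yPhi.
have [k tk] := le_pow2_mul t w0.
rewrite fineK// ge0_fin_numE ?(young_ge0 yPhi)//.
apply: (le_lt_trans (young_nd yPhi t0 tk)).
apply: (le_lt_trans (Delta2_iter yPhi C1 d2 k w0)).
apply: lte_mul_pinfty => //.
by rewrite lee_fin exprn_ge0// (le_trans ler01)// ltW.
Qed.

(** By Delta_2, a zero at one positive point would make [Phi] vanish. *)
Lemma young_gt0 Phi : young Phi -> Delta2 Phi -> forall t, 0 < t -> 0 < fine (Phi t).
Proof.
move=> yPhi d2Phi t t0; have [C C1 d2] := d2Phi.
rewrite lt_neqAle fine_ge0 ?(young_ge0 yPhi) ?ltW// andbT eq_sym.
apply/eqP => Pt0.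
have [w w0 fw] := young_unbounded 1 yPhi.
have [k wk] := le_pow2_mul w t0.
have := le_trans (le_trans fw (young_nd yPhi (ltW w0) wk)) (Delta2_iter yPhi C1 d2 k t0).
by rewrite (young_finE yPhi d2Phi (ltW t0)) Pt0 mule0 lee_fin ler10.
Qed.

Lemma pow_bracket (a l : R) : 1 < a -> 1 <= l -> exists2 k : nat, a ^+ k <= l & l < a ^+ k.+1.
Proof.
move=> a1 l1; have a0 : 0 < a by exact: lt_trans a1.
have la : 0 < ln a by rewrite ln_gt0.
have l0 : 0 < l by exact: lt_le_trans l1.
have ll : 0 <= ln l by rewrite ln_ge0.
have q0 : 0 <= ln l / ln a by rewrite divr_ge0// ltW.
have powE (k : nat) : a ^+ k = expR (k%:R * ln a) by rewrite expRM_natl lnK.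
have lE : l = expR (ln l) by rewrite lnK.
exists (Num.truncn (ln l / ln a)).
  by rewrite powE [leRHS]lE ler_expR -ler_pdivlMr//; have /andP[] := truncn_itv q0.
by rewrite powE [ltLHS]lE ltr_expR -ltr_pdivrMr// truncnS_gt.
Qed.

(** Iterating nabla_2 along the powers of its constant [a] gives the lower exponent
    [q = ln (2 a) / ln a > 1]; it is lowered to [r * r] with [r <= 2]. Iterating
    Delta_2 along the powers of 2 gives the upper exponent [ln C / ln 2]. *)
Lemma young_growth Phi : young Phi -> Delta2 Phi -> nabla2 Phi ->
  exists r c P k, 1 < r <= 2 /\ growth (fine \o Phi) (r * r) c P k.
Proof.
move=> yPhi d2Phi [a a1 n2]; have [C C1 d2] := d2Phi.
have finE := young_finE yPhi d2Phi.
set phi := fine \o Phi.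
have phi0 t : 0 <= t -> 0 <= phi t by move=> t0; rewrite fine_ge0// (young_ge0 yPhi).
have phi_nd s t : 0 <= s -> s <= t -> phi s <= phi t.
  move=> s0 st; rewrite -lee_fin -finE// -finE ?(le_trans s0)//.
  exact: young_nd.
have a0 : 0 < a by exact: lt_trans a1.
have a20 : 0 < 2 * a by rewrite mulr_gt0.
have C0 : 0 < C by exact: lt_trans C1.
have la : 0 < ln a by rewrite ln_gt0.
have l2 : 0 < ln 2 :> R by rewrite ln_gt0// ltr1n.
have lC : 0 < ln C by rewrite ln_gt0.
pose q := ln (2 * a) / ln a.
have q1 : 1 < q by rewrite /q ltr_pdivlMr// mul1r ltr_ln ?posrE//; lra.
have nabk (k : nat) t : 0 <= t -> (2 * a) ^+ k * phi t <= phi (a ^+ k * t).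
  move=> t0; elim: k => [|k IH]; first by rewrite !expr0 !mul1r.
  rewrite exprS -mulrA (le_trans (ler_wpM2l (ltW a20) IH))//.
  have akt : 0 <= a ^+ k * t by rewrite mulr_ge0// exprn_ge0// ltW.
  have aakt : 0 <= a * (a ^+ k * t) by rewrite mulr_ge0// ltW.
  have := n2 _ akt; rewrite (finE _ akt) (finE _ aakt).
  rewrite -EFinM lee_fin ler_pdivlMl// exprS -mulrA.
  exact.
have delk (k : nat) t : 0 <= t -> phi (2 ^+ k * t) <= C ^+ k * phi t.
  rewrite le_eqVlt => /predU1P[<-|t0]; first by rewrite mulr0 /phi /= (young0 yPhi) mulr0.
  have := Delta2_iter yPhi C1 d2 k t0.
  have kt0 : 0 <= 2 ^+ k * t by rewrite mulr_ge0// ltW.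
  by rewrite (finE _ (ltW t0)) (finE _ kt0) -EFinM lee_fin.
have powE (k : nat) (u p : R) : 0 < u -> (u ^+ k) `^ p = (u `^ p) ^+ k.
  move=> u0; rewrite -powR_mulrn ?(ltW u0)// powRAC powR_mulrn ?powR_ge0//.
have aq : a `^ q = 2 * a.
  by rewrite /powR gt_eqF// /q divfK ?gt_eqF// lnK// posrE.
pose P := ln C / ln 2.
have P2 : 2 `^ P = C by rewrite /powR gt_eqF// /P divfK ?gt_eqF// lnK// posrE.
pose r := Num.min 2 (Num.sqrt q).
have r12 : 1 < r <= 2.
  rewrite /r lt_min ge_min lexx/= andbT ltr1n/=.
  by rewrite -sqrtr1 ltr_sqrt// (lt_trans ltr01).
have rq : r * r <= q.
  have r0 : 0 <= r by case/andP: r12 => /(lt_trans ltr01)/ltW.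
  rewrite -[leRHS]sqr_sqrtr; last by rewrite (le_trans ler01)// ltW.
  by rewrite expr2 ler_pM// /r ge_min lexx orbT.
exists r, (a `^ (- q)), P, C; split => //; split => //.
- by rewrite /phi /= (young0 yPhi).
- exact: young_gt0.
- exact: powR_gt0.
- by rewrite divr_ge0 ?ltW.
- move=> l t l1 t0; have [k kl lk] := pow_bracket a1 l1.
  have l0 : 0 < l by exact: lt_le_trans l1.
  apply: (@le_trans _ _ ((2 * a) ^+ k * phi t)).
    rewrite ler_wpM2r ?phi0//; apply: (@le_trans _ _ (a `^ (- q) * l `^ q)).
      by rewrite ler_wpM2l ?powR_ge0// ler_powR.
    rewrite powRN ler_pdivrMl ?powR_gt0// aq -exprS.
    rewrite -aq -powE//; apply: ge0_ler_powR; rewrite ?nnegrE ?exprn_ge0 ?(ltW a0) ?(ltW l0) ?(ltW lk)//.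
    by rewrite (le_trans ler01)// ltW.
  apply: (le_trans (nabk k t t0)); apply: phi_nd.
    by rewrite mulr_ge0// exprn_ge0// ltW.
  by rewrite ler_wpM2r.
- move=> l t l1 t0; have [|k kl lk] := @pow_bracket 2 l _ l1; first by rewrite ltr1n.
  have l0 : 0 < l by exact: lt_le_trans l1.
  apply: (@le_trans _ _ (phi (2 ^+ k.+1 * t))).
    by apply: phi_nd; [rewrite mulr_ge0// ltW|rewrite ler_wpM2r// ltW].
  apply: (le_trans (delk k.+1 t t0)); rewrite ler_wpM2r ?phi0//.
  rewrite exprS ler_wpM2l ?(ltW C0)// -P2 -powE//.
  by apply: ge0_ler_powR; rewrite ?nnegrE ?exprn_ge0 ?(ltW l0)// divr_ge0 ?ltW.
Qed.

End young.

(** * Hedberg's inequality and sufficiency *)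

Section hedberg.
Variable R : realType.

(** Hedberg's trick at the level of one cube: the measure [m] is eliminated
    through [phi a * m <= K], and the hypothesis on the inverses does the rest. *)
Lemma hedberg_inequality (Phi Psi : R -> \bar R) (th C K p c P k : R) :
  young Phi -> Delta2 Phi -> young Psi -> Delta2 Psi ->
  growth (fine \o Psi) p c P k -> 0 < th -> 0 < C -> 0 <= K ->
  (forall s : R, 0 < s ->
     ((s `^ (- th))%:E * young_inv Phi s%:E <= C%:E * young_inv Psi s%:E)%E) ->
  exists2 Kh : R, 0 <= Kh & forall a m : R, 0 < a -> 0 < m ->
    fine (Phi a) * m <= K -> fine (Psi (m `^ th * a)) <= Kh * fine (Phi a).
Proof.
move=> yPhi d2Phi yPsi d2Psi gpsi th0 C0 K0 inv.
pose l := Num.max 1 (2 * (K `^ th * C)).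
have l1 : 1 <= l by rewrite le_max lexx.
exists (k * l `^ P).
  by rewrite mulr_ge0 ?powR_ge0// ltW// (growth_k gpsi).
move=> a m a0 m0 aK.
set s := fine (Phi a); have s0 : 0 < s by exact: young_gt0.
have aE : (a%:E <= young_inv Phi s%:E)%E.
  apply: le_ereal_inf_tmp => _ [u /= [u0 su] <-]; rewrite lee_fin leNgt; apply/negP => ua.
  have := young_nd yPhi u0 (ltW ua).
  by rewrite (young_finE yPhi d2Phi (ltW a0)) leNgt su.
pose y := m `^ th * a; have y0 : 0 < y by rewrite mulr_gt0// powR_gt0.
have yS : (y%:E <= (K `^ th * C)%:E * young_inv Psi s%:E)%E.
  have m_th : m `^ th <= K `^ th * s `^ (- th).
    rewrite powRN -powR_inv1 ?powR_ge0// -powRrM mulrN1 powRN ler_pdivlMr ?powR_gt0//.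
    rewrite -powRM ?(ltW m0) ?(ltW s0)//; apply: ge0_ler_powR; rewrite ?nnegrE ?(ltW th0)//.
      by rewrite mulr_ge0 ?ltW.
    by rewrite mulrC.
  apply: (@le_trans _ _ ((K `^ th * s `^ (- th))%:E * a%:E)%E).
    by rewrite -EFinM lee_fin ler_wpM2r// ltW.
  rewrite !EFinM -!muleA lee_wpmul2l ?lee_fin ?powR_ge0//.
  by apply: le_trans (inv s s0); rewrite lee_wpmul2l ?lee_fin ?powR_ge0.
have l0 : 0 < l by exact: lt_le_trans l1.
(* the factor 2 in [l] makes [y / l] smaller than the inverse of [Psi] at [s] *)
have small : fine (Psi (y / l)) <= s.
  rewrite -lee_fin -(young_finE yPsi d2Psi); last by rewrite divr_ge0 ?ltW.
  rewrite leNgt; apply/negP => sPsi.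
  have : (young_inv Psi s%:E <= (y / l)%:E)%E.
    by apply: ereal_inf_lbound; exists (y / l) => //; split => //; rewrite divr_ge0 ?ltW.
  have kc0 : (0 <= (K `^ th * C)%:E)%E by rewrite lee_fin mulr_ge0 ?powR_ge0// ltW.
  move=> /(lee_wpmul2l kc0)/(le_trans yS); rewrite -EFinM lee_fin => yle.
  have : K `^ th * C * (y / l) <= y / 2.
    rewrite mulrCA ler_pM2l// ler_pdivrMr//.
    have : 2 * (K `^ th * C) <= l by rewrite le_max lexx orbT.
    lra.
  by move/(le_trans yle); lra.
have yl0 : 0 <= y / l by rewrite divr_ge0 ?ltW.
have := growth_upper gpsi l1 yl0.
rewrite (mulrC l) divfK ?gt_eqF// => /le_trans; apply.
by rewrite ler_wpM2l// mulr_ge0 ?powR_ge0// ltW// (growth_k gpsi).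
Qed.

End hedberg.

Section orlicz.
Local Open Scope ereal_scope.
Variables (R : realType) (n : nat).
Notation E := (Rn R n).
Notation mu := (lebesgue_Rn R n).
Implicit Types (Phi Psi : R -> \bar R) (f : E -> \bar R).

Lemma young_ext_ge0 Phi x : young Phi -> 0 <= x -> 0 <= young_ext Phi x.
Proof. by move=> yPhi; case: x => [u||]//=; rewrite lee_fin; exact: young_ge0. Qed.

Lemma young_ext_scale Phi (c : R) x : young Phi -> (0 < c <= 1)%R -> 0 <= x ->
  young_ext Phi (x * c%:E) <= c%:E * young_ext Phi x.
Proof.
move=> yPhi /andP[c0 c1]; case: x => [u||]//= u0.
  by rewrite mulrC; apply: young_scale => //; rewrite (ltW c0).
by rewrite gt0_mulye ?lte_fin//= gt0_muley ?lte_fin.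
Qed.

Lemma measurable_young_abs Phi f (c : R) : young Phi -> Delta2 Phi -> (0 <= c)%R ->
  measurable_fun [set: E] f ->
  measurable_fun [set: E] (fun x => young_ext Phi (`|f x| * c%:E)).
Proof.
move=> yPhi d2Phi c0 mf.
apply: (@measurable_young_ext _ _ _ (fine \o Phi) Phi _ (fun x => `|f x| * c%:E)).
- move=> s t s0 st; rewrite /= -lee_fin -!young_finE//; last exact: le_trans st.
  exact: young_nd.
- exact: young_finE.
- by apply: emeasurable_funM => //; exact: measurableT_comp.
- by move=> x; rewrite mule_ge0.
Qed.

Lemma in_orlicz_modular Phi f : young Phi -> Delta2 Phi -> in_orlicz Phi f ->
  exists2 l : R, (0 < l)%R & \int[mu]_x young_ext Phi (`|f x| * (l^-1)%:E) <= 1.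
Proof.
move=> yPhi d2Phi [mf [k k0 Ik]].
have ge0 (c : R) x : (0 <= c)%R -> 0 <= young_ext Phi (`|f x| * c%:E).
  by move=> c0; apply: young_ext_ge0 => //; rewrite mule_ge0.
have I0 : 0 <= \int[mu]_x young_ext Phi (`|f x| * k%:E).
  by apply: integral_ge0 => x _; apply: ge0; exact: ltW.
have [M M1 IM] : exists2 M : R, (1 <= M)%R &
    \int[mu]_x young_ext Phi (`|f x| * k%:E) <= M%:E.
  move: Ik I0; under eq_integral do rewrite muleC.
  case: (integral _ _ _) => [J||]// _ _; exists (Num.max 1 J)%R.
    by rewrite le_max lexx.
  by rewrite lee_fin le_max lexx orbT.
have M0 : (0 < M)%R by exact: lt_le_trans M1.
have M'1 : (0 < M^-1 <= 1)%R by rewrite invr_gt0 M0 invf_le1.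
exists (M / k)%R; first by rewrite divr_gt0.
apply: (@le_trans _ _ (\int[mu]_x ((M^-1)%:E * young_ext Phi (`|f x| * k%:E)))).
  apply: ge0_le_integral => //.
  - by move=> x _; apply: ge0; rewrite invr_ge0 divr_ge0 ?ltW.
  - by apply: measurable_young_abs => //; rewrite invr_ge0 divr_ge0 ?ltW.
  - by apply: measurable_funeM; apply: measurable_young_abs => //; exact: ltW.
  move=> x _; rewrite invf_div (_ : `|f x| * (k / M)%:E = (`|f x| * k%:E) * (M^-1)%:E).
    by apply: young_ext_scale => //; rewrite mule_ge0// lee_fin ltW.
  by rewrite -muleA -EFinM.
rewrite ge0_integralZl//; first last.
- by rewrite lee_fin invr_ge0 ltW.
- by move=> x _; apply: ge0; exact: ltW.
- by apply: measurable_young_abs => //; exact: ltW.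
by rewrite lee_pdivrMl// mule1.
Qed.

Lemma finite_ae_of_modular Phi f (c : R) : young Phi -> Delta2 Phi -> (0 < c)%R ->
  measurable_fun [set: E] f ->
  \int[mu]_x young_ext Phi (`|f x| * c%:E) < +oo ->
  {ae mu, forall x, f x \is a fin_num}.
Proof.
move=> yPhi d2Phi c0 mf If.
have mF := measurable_young_abs yPhi d2Phi (ltW c0) mf.
have F0 x : 0 <= young_ext Phi (`|f x| * c%:E).
  by apply: young_ext_ge0 => //; rewrite mule_ge0// lee_fin ltW.
have iF : mu.-integrable [set: E] (fun x => young_ext Phi (`|f x| * c%:E)).
  by apply/integrableP; split => //; under eq_integral do rewrite gee0_abs//.
have := integrable_ae measurableT iF.
apply: filterS => x /(_ I).
by case: (f x) => [u||]//=; rewrite gt0_mulye ?lte_fin.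
Qed.

Lemma frac_max_commutator_le (alpha : R) (b : E -> R) f (g : E -> R) (l : R) :
  measurable_fun [set: E] b -> measurable_fun [set: E] f ->
  measurable_fun [set: E] g -> (forall x, 0 <= g x)%R -> (0 < l)%R ->
  {ae mu, forall x, `|f x| = (l * g x)%:E} ->
  forall x, frac_max_commutator alpha b f x <=
            l%:E * frac_max_commutator alpha b (EFin \o g) x.
Proof.
move=> mb mf mg g0 l0 fg x; apply: ub_ereal_sup => _ [t /= t0 <-].
apply: (@le_trans _ _ (l%:E * fractional_average alpha b (EFin \o g) t x)); last first.
  by rewrite lee_pmul2l//; apply: ereal_sup_ubound; exists t.
rewrite /fractional_average muleCA; apply: lee_wpmul2l.
  by rewrite lee_fin powR_ge0.
have mB := measurable_eball x t.
have mbx : measurable_fun [set: E] (fun y => `|b x - b y|%:E).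
  by apply/measurable_EFinP; apply: measurableT_comp => //; exact: measurable_funB.
have mbg : measurable_fun [set: E] (fun y => `|b x - b y|%:E * `|(EFin \o g) y|).
  apply: emeasurable_funM => //; apply: measurableT_comp => //.
  exact/measurable_EFinP.
rewrite -ge0_integralZl//; last 2 first.
- exact: measurable_funS mbg.
- by rewrite lee_fin ltW.
rewrite le_eqVlt; apply/orP; left; apply/eqP; apply: ge0_ae_eq_integral => //.
- apply: measurable_funS (emeasurable_funM mbx (measurableT_comp _ mf)) => //.
- by apply: measurable_funS (measurable_funeM l%:E mbg).
- by move=> y _; rewrite mule_ge0// lee_fin ltW.
apply: filterS fg => y fy _; rewrite fy /= [`|g y|%R]ger0_norm// EFinM.
by rewrite muleCA.
Qed.

End orlicz.

Section sufficiency.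
Variables (R : realType) (n : nat) (alpha : R) (Phi Psi : R -> \bar R).
Notation E := (Rn R n).
Notation mu := (lebesgue_Rn R n).
Hypotheses (alpha0 : 0 < alpha) (alphan : alpha < n%:R).
Hypotheses (yPhi : young Phi) (yPsi : young Psi).
Hypotheses (d2Phi : Delta2 Phi) (n2Phi : nabla2 Phi).
Hypotheses (d2Psi : Delta2 Psi) (n2Psi : nabla2 Psi).

(** Apply the modular bound to [g = |f| / l], for any [l] admissible in the norm of
    [f]; convexity absorbs the constant [K] of the modular bound into the norm. *)
Theorem commutator_sufficiency (b : E -> R) : bmo b ->
  (exists2 C : R, 0 < C & forall s : R, 0 < s ->
     ((s `^ (- (alpha / n%:R)))%:E * young_inv Phi s%:E
        <= C%:E * young_inv Psi s%:E)%E) ->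
  orlicz_bounded Phi Psi (frac_max_commutator alpha b).
Proof.
move=> bmob [C C0 inv].
have n0 : (0 < n)%N by rewrite -(@ltr0n R) (lt_trans alpha0).
have [r [cl [P [k [r12 gphi]]]]] := young_growth yPhi d2Phi n2Phi.
have [r' [c' [P' [k' [_ gpsi]]]]] := young_growth yPsi d2Psi n2Psi.
have [mb bfin] := bmob.
have {}mb : measurable_fun [set: E] b by case: mb.
pose B := Num.max 1 (fine (bmo_norm b)).
have B0 : 0 < B by rewrite lt_max ltr01.
have bB : (bmo_norm b <= B%:E)%E.
  move: bfin; rewrite /B; case: (bmo_norm b) => [u||]//= _.
  - by rewrite lee_fin le_max lexx orbT.
  - exact: leNye.
have rgt1 : 1 < r by case/andP: r12.
have A0 : 0 < osc_const n B by rewrite mulr_gt0// exprn_gt0// mulr_gt0.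
have e00 : 0 < jn_Rn n B.
  by rewrite divr_gt0 ?ln_gt0 ?ltr1n// addr_gt0// !mulr_gt0// exprn_gt0.
have th0 : 0 < alpha / n%:R by rewrite divr_gt0// ltr0n.
have [Kh Kh0 hed] := hedberg_inequality yPhi d2Phi yPsi d2Psi gpsi th0 C0
  (cube_const_ge0 gphi rgt1 e00) inv.
pose K := Num.max 1 (modular_const n r cl P k P' k' Kh B).
have K0 : 0 < K by rewrite lt_max ltr01.
have K1 : 0 < K^-1 <= 1 by rewrite invr_gt0 K0 invf_le1// le_max lexx.
pose rc := 2 * radius_const n alpha.
have rc0 : 0 < rc.
  by rewrite mulr_gt0// powR_gt0// exprn_gt0// mulr_gt0.
have PsiE t : 0 <= t -> Psi t = ((fine \o Psi) t)%:E by exact: young_finE.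
have psi_unb z : exists2 w, 0 <= w & z <= (fine \o Psi) w.
  have [w w0 zw] := young_unbounded z yPsi; exists w; first exact: ltW.
  by rewrite -lee_fin -PsiE// ltW.
have key f l : measurable_fun [set: E] f -> 0 < l ->
    (\int[mu]_x young_ext Phi (`|f x| * (l^-1)%:E) <= 1)%E ->
    (\int[mu]_x young_ext Psi (`|frac_max_commutator alpha b f x| *
        ((rc * K * l)^-1)%:E) <= 1)%E.
  move=> mf l0 If.
  have rKl : 0 < rc * K * l by rewrite mulr_gt0// mulr_gt0.
  pose g x := fine `|f x| / l.
  have g0 x : 0 <= g x by rewrite divr_ge0 ?fine_ge0// ltW.
  have mg : measurable_fun [set: E] g.
    apply: measurable_funM => //; apply: measurableT_comp => //.
    exact: measurableT_comp.
  have fg : {ae mu, forall x, `|f x|%E = (l * g x)%:E}.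
    apply: filterS (finite_ae_of_modular yPhi d2Phi (_ : 0 < l^-1) mf
      (le_lt_trans If (ltry _))) => [x|]; last by rewrite invr_gt0.
    by rewrite /g; case: (f x) => [u||]//= _; rewrite mulrC divfK// gt_eqF.
  have Ig : (\int[mu]_x (fine (Phi (g x)))%:E <= 1)%E.
    apply: le_trans If; apply: ge0_le_integral => //.
    - by move=> x _; rewrite lee_fin; exact: (growth_ge0 gphi (g0 x)).
    - apply: measurable_real_integrand; exact: (measurable_nd_comp (growth_nd gphi) mg g0).
    - by apply: measurable_young_abs => //; rewrite invr_ge0 ltW.
    move=> x _; rewrite -young_finE// /g.
    case: (f x) => [u||]//=; rewrite ?mul0r ?(young0 yPhi)//.
    + by apply: young_ext_ge0 => //; rewrite mule_ge0// lee_fin invr_ge0 ltW.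
    + by apply: young_ext_ge0 => //; rewrite mule_ge0// lee_fin invr_ge0 ltW.
  have mphig : measurable_fun [set: E] ((fine \o Phi) \o g).
    exact: (measurable_nd_comp (growth_nd gphi) mg g0).
  have Mg := modular_bound n0 alphan gphi gpsi r12 B0 Kh0 PsiE psi_unb hed bmob bB
    mg g0 mphig Ig.
  set M := frac_max_commutator alpha b (EFin \o g) in Mg.
  have mM : measurable_fun [set: E] M.
    by apply: measurable_frac_max_commutator => //; exact/measurable_EFinP.
  have mMf : measurable_fun [set: E] (frac_max_commutator alpha b f).
    exact: measurable_frac_max_commutator.
  have M0 h x : (0 <= frac_max_commutator alpha b h x)%E.
    apply: le_trans (fractional_average_ge0 alpha b h 1 x) _.
    by apply: ereal_sup_ubound; exists 1 => //=.
  have rcV0 : 0 < rc^-1 by rewrite invr_gt0.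
  apply: (@le_trans _ _ (\int[mu]_x ((K^-1)%:E *
      young_ext Psi (`|M x| * (rc^-1)%:E)))%E).
    apply: ge0_le_integral => //.
    - move=> x _; apply: young_ext_ge0 => //; rewrite mule_ge0// lee_fin.
      by rewrite invr_ge0 (ltW rKl).
    - apply: measurable_young_abs => //.
      by rewrite invr_ge0 (ltW rKl).
    - by apply: measurable_funeM; apply: measurable_young_abs => //; exact: ltW.
    move=> x _; apply: le_trans (young_ext_scale yPsi K1 _); last first.
      by rewrite mule_ge0// lee_fin ltW.
    have ext_nd (u v : \bar R) : (0 <= u)%E -> (u <= v)%E ->
        (young_ext Psi u <= young_ext Psi v)%E.
      case: u => [u||]//; case: v => [v||]//=; rewrite ?leey// !lee_fin.
      exact: young_nd.
    apply: ext_nd.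
      by rewrite mule_ge0// lee_fin invr_ge0 (ltW rKl).
    rewrite !gee0_abs//; last exact: M0.
    apply: (@le_trans _ _ ((l%:E * M x) * ((rc * K * l)^-1)%:E)%E).
      apply: lee_wpmul2r; first by rewrite lee_fin invr_ge0 (ltW rKl).
      exact: frac_max_commutator_le.
    rewrite (muleC l%:E) -!muleA -!EFinM.
    rewrite (_ : l * (rc * K * l)^-1 = rc^-1 * K^-1)//.
    by field; rewrite !gt_eqF.
  rewrite ge0_integralZl//; first last.
  - by rewrite lee_fin invr_ge0 ltW.
  - by move=> x _; apply: young_ext_ge0 => //; rewrite mule_ge0// lee_fin ltW.
  - by apply: measurable_young_abs => //; exact: ltW.
  rewrite lee_pdivrMl// mule1; apply: (le_trans Mg).
  by rewrite lee_fin le_max lexx orbT.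
exists (rc * K); first exact: mulr_gt0.
move=> f inf; have [mf _] := inf; split.
  have [l l0 If] := in_orlicz_modular yPhi d2Phi inf.
  split; first exact: measurable_frac_max_commutator.
  exists (rc * K * l)^-1; first by rewrite invr_gt0 mulr_gt0// mulr_gt0.
  under eq_integral do rewrite muleC.
  by apply: (le_lt_trans (key f l mf l0 If)); exact: ltry.
have rK0 : 0 < rc * K by exact: mulr_gt0.
rewrite -lee_pdivrMl//; apply: le_ereal_inf_tmp => _ [l /= [l0 If] <-].
rewrite lee_pdivrMl// -EFinM; apply: ereal_inf_lbound.
exists (rc * K * l) => //; split; first by rewrite mulr_gt0.
exact: key.
Qed.

End sufficiency.

(** * Necessity *)

Section necessity.
Variables (R : realType) (n : nat) (alpha : R) (i0 : 'I_n).
Notation E := (Rn R n).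
Notation mu := (lebesgue_Rn R n).

Definition half_space (y : E) : R := (0 <= (tnth y i0 : R))%R%:R.

Let hs0 y : 0 <= half_space y. Proof. exact: ler0n. Qed.
Let hs1 y : half_space y <= 1. Proof. by rewrite lern1 leq_b1. Qed.

Lemma measurable_half_space : measurable_fun [set: E] half_space.
Proof.
rewrite (_ : half_space = fun y => if (0 <= (tnth y i0 : R)) then 1 else 0); last first.
  by apply/funext => y; rewrite /half_space; case: (0 <= _).
apply: measurable_fun_ifT => //.
apply: measurable_fun_ler => //; exact: measurable_tnth.
Qed.

Lemma bmo_half_space : bmo half_space.
Proof.
have mh := measurable_half_space.
have le_mu (x : E) t : (\int[mu]_(y in eball x t) (half_space y)%:E <= mu (eball x t))%E.
  rewrite -[leRHS]mul1e -rint_cst; last exact: measurable_eball.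
  apply: rint_le => //; exact: measurable_eball.
split; first (split => // x t).
  apply/integrableP; split; first exact: measurable_real_integrand.
  under eq_integral do rewrite /= ger0_norm//.
  apply: (le_lt_trans (le_mu x t)).
  have [t0|t0] := ltP 0 t; first by have [m ->] := lebesgue_eballE x t0; rewrite ltry.
  rewrite (_ : eball x t = set0) ?measure0 ?ltry//.
  apply/seteqP; split=> // y; rewrite /eball /= => /lt_le_trans/(_ t0).
  by rewrite ltNge sqrtr_ge0.
apply: (@le_lt_trans _ _ 1%E); last exact: ltry.
apply: ub_ereal_sup => _ [[x t] /= t0 <-].
have [m mE /andP[m1 _]] := lebesgue_eballE x t0.
have m0 : 0 < m by apply: lt_le_trans m1; rewrite exprn_gt0// mulr_gt0// divr_gt0.
rewrite mE /= lee_pdivrMl// mule1 -mE.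
have [a0 a1] : 0 <= average half_space (eball x t) /\ average half_space (eball x t) <= 1.
  have i0' : (0 <= \int[mu]_(y in eball x t) (half_space y)%:E)%E by exact: rint_ge0.
  have := le_mu x t; rewrite /average /Rintegral mE /= ler_pdivrMl// mulr1.
  move: i0'; case: (integral _ _ _) => [u||]//=; rewrite !lee_fin => u0 um.
  by rewrite mulr_ge0// invr_ge0 ltW.
rewrite -[leRHS]mul1e -rint_cst; last exact: measurable_eball.
apply: rint_le => //.
- exact: measurable_eball.
- by apply: measurableT_comp => //; exact: measurable_funB.
move=> y _; rewrite ler_norml; have := hs0 y; have := hs1 y.
by move=> ? ?; apply/andP; split; lra.
Qed.

Variables (Phi Psi : R -> \bar R).
Hypothesis alphan : alpha < n%:R.
Hypotheses (yPhi : young Phi) (yPsi : young Psi).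
Hypotheses (d2Phi : Delta2 Phi) (d2Psi : Delta2 Psi).
Let th := alpha / n%:R.

Section test_function.
Variable s : R.
Hypothesis s0 : 0 < s.
(* the side of the cubes of measure [s^-1] *)
Let a := s `^ (- n%:R^-1).
Let n0 : (0 < n)%N. Proof. exact: leq_ltn_trans (ltn_ord i0). Qed.
Let a0 : 0 < a. Proof. exact: powR_gt0. Qed.
Let an : a ^+ n = s^-1.
Proof.
rewrite -powR_mulrn ?powR_ge0// -powRrM mulNr mulVf ?pnatr_eq0 -?lt0n//.
by rewrite powR_inv1// ltW.
Qed.

(** Two mirror cubes on the two sides of the jump of [half_space]. *)
Definition left_cube : set E :=
  box (fun i => if i == i0 then [set` `[- a, (0 : R)[] else [set` `[0, a[]).
Definition right_cube : set E := box (fun _ : 'I_n => [set` `[0, a[]).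

Lemma measurable_left_cube : measurable left_cube.
Proof. by apply: measurable_box => i; case: ifP => _; exact: measurable_itv. Qed.

Lemma measurable_right_cube : measurable right_cube.
Proof. exact: (measurable_box (fun i => measurable_itv _)). Qed.

Lemma lebesgue_left_cube : mu left_cube = (s^-1)%:E.
Proof.
rewrite /left_cube (lebesgue_box (l:=fun=> a)).
- by rewrite prodr_const card_ord an.
- by move=> i; case: ifP => _; exact: measurable_itv.
move=> i; case: ifP => _; rewrite lebesgue_measure_itv/= lte_fin.
  by rewrite oppr_lt0 a0 -EFinB sub0r opprK.
by rewrite a0 -EFinB subr0.
Qed.

Lemma lebesgue_right_cube : mu right_cube = (s^-1)%:E.
Proof.
rewrite /right_cube (lebesgue_box (l:=fun=> a)).
- by rewrite prodr_const card_ord an.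
- by move=> i; exact: measurable_itv.
by move=> i; rewrite lebesgue_measure_itv/= lte_fin a0 -EFinB subr0.
Qed.

Let f : E -> \bar R := EFin \o \1_left_cube.

Let mf : measurable_fun [set: E] f.
Proof.
apply/measurable_EFinP; apply: measurable_indic.
exact: measurable_left_cube.
Qed.

Definition test_const : R := ((4 * n.+1%:R) ^+ n) `^ (th - 1).

(** A ball around [x] of radius comparable to the side contains the left cube,
    where [half_space] differs by one from its value at [x]. *)
Lemma frac_max_commutator_ge x : right_cube x ->
  ((test_const * s `^ (- th))%:E <= frac_max_commutator alpha half_space f x)%E.
Proof.
move=> xr; pose t := 2 * a * n.+1%:R.
have t0 : 0 < t by rewrite !mulr_gt0.
apply: (@le_trans _ _ (fractional_average alpha half_space f t x)); last first.
  by apply: ereal_sup_ubound; exists t.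
have [B BE /andP[B1 B2]] := lebesgue_eballE x t0.
have B0 : 0 < B by apply: lt_le_trans B1; rewrite exprn_gt0// mulr_gt0// divr_gt0.
have lb : left_cube `<=` eball x t.
  move=> y yl; apply: open_box_eball => //; apply/open_boxP => i.
  rewrite /t mulfK ?pnatr_eq0//; have := xr i; have := yl i; rewrite /= in_itv/=.
  case: ifP => _; rewrite /= in_itv/= => /andP[? ?] /andP[? ?];
    by rewrite ltr_norml; apply/andP; split; lra.
have hxy y : left_cube y -> `|half_space x - half_space y| = 1.
  move=> yl; have := xr i0; have := yl i0; rewrite /= eqxx /= !in_itv/=.
  by rewrite /half_space => /andP[_ y0] /andP[-> _]; rewrite leNgt y0/= subr0 normr1.
rewrite /fractional_average BE /= -/th.
apply: (@le_trans _ _ ((B `^ (- 1 + th))%:E * (s^-1)%:E)%E); last first.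
  rewrite lee_wpmul2l ?lee_fin ?powR_ge0// -lebesgue_left_cube.
  rewrite -[leLHS]mul1e -rint_cst; last exact: measurable_left_cube.
  rewrite (eq_integral (fun y => (`|half_space x - half_space y|%:E * `|f y|)%E)); last first.
    move=> y /set_mem yl; rewrite hxy// mul1e /f /= indicE mem_set//.
    by rewrite normr1.
  apply: ge0_subset_integral => //.
  - exact: measurable_left_cube.
  - exact: measurable_eball.
  - apply: emeasurable_funM; last first.
      by apply: measurableT_comp => //; exact: measurable_funS mf.
    apply: measurable_real_integrand; apply: measurableT_comp => //; apply: measurable_funB => //.
    exact: measurable_half_space.
rewrite -EFinM lee_fin.
have th1 : th < 1 by rewrite /th ltr_pdivrMr ?ltr0n// mul1r.
have powE (u : R) : u `^ (th - 1) = (u `^ (1 - th))^-1 by rewrite -powRN opprB.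
have Bs : B <= (4 * n.+1%:R) ^+ n * s^-1.
  apply: (le_trans B2); rewrite -an -exprMn /t.
  by rewrite (_ : 2 * _ = 4 * n.+1%:R * a)//; ring.
have N0 : 0 < (4 * n.+1%:R) ^+ n :> R by rewrite exprn_gt0// mulr_gt0.
have sV0 : 0 < s^-1 by rewrite invr_gt0.
apply: (@le_trans _ _ (((4 * n.+1%:R) ^+ n * s^-1) `^ (th - 1) * s^-1)); last first.
  rewrite (addrC (- 1)) ler_wpM2r ?(ltW sV0)// !powE lef_pV2 ?posrE ?powR_gt0 ?mulr_gt0//.
  by apply: ge0_ler_powR; rewrite ?nnegrE ?(ltW B0) ?subr_ge0 ?(ltW th1)// mulr_ge0 ?ltW.
rewrite powRM ?(ltW N0) ?(ltW sV0)// -/test_const -mulrA ler_pM2l ?powR_gt0//.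
rewrite -[X in _ <= _ * X](powRr1 (ltW sV0)) -powRD; last by rewrite (gt_eqF sV0) implybT.
by rewrite subrK -[s^-1](powR_inv1 (ltW s0)) -powRrM mulN1r.
Qed.

Let young_f (l : R) (x : E) : 0 < l ->
  young_ext Phi (`|f x| * l%:E) = (((fun=> Phi l) : E -> \bar R) \_ left_cube) x.
Proof.
move=> l0; rewrite /f /= indicE /patch; case: (x \in left_cube) => /=.
  by rewrite normr1 mul1r.
by rewrite normr0 mul0r (young0 yPhi).
Qed.

Let int_young_f (l : R) : 0 < l ->
  (\int[mu]_x young_ext Phi (`|f x| * l%:E) = Phi l * (s^-1)%:E)%E.
Proof.
move=> l0; under eq_integral do rewrite young_f//.
rewrite -integral_mkcond (young_finE yPhi d2Phi (ltW l0)) rint_cst.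
  by congr (_ * _)%E; exact: lebesgue_left_cube.
exact: measurable_left_cube.
Qed.

(** On the cubes of measure [s^-1], the norm of the test function is at most the
    inverse of [Phi^-1 s], while that of its image is at least a multiple of
    [s^(- th) / Psi^-1 s]. *)
Lemma young_inv_le_of_bounded (C : R) : 0 < C ->
  (forall f : E -> \bar R, in_orlicz Phi f ->
    in_orlicz Psi (frac_max_commutator alpha half_space f) /\
    (orlicz_norm Psi (frac_max_commutator alpha half_space f) <=
     C%:E * orlicz_norm Phi f)%E) ->
  ((s `^ (- th))%:E * young_inv Phi s%:E <=
   (4 * C / test_const)%:E * young_inv Psi s%:E)%E.
Proof.
move=> C0 HC.
have c0 : 0 < test_const by rewrite powR_gt0// exprn_gt0// mulr_gt0.
have sth0 : 0 < s `^ (- th) by rewrite powR_gt0.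
have inv0 (P : R -> \bar R) : (0 <= young_inv P s%:E)%E.
  by apply: le_ereal_inf_tmp => _ [u /= [u0 _] <-]; rewrite lee_fin.
have inf : in_orlicz Phi f.
  split => //; exists 1 => //.
  under eq_integral do rewrite muleC.
  rewrite int_young_f// (young_finE yPhi d2Phi ler01) -EFinM.
  exact: ltry.
have [_ norm_le] := HC f inf.
have Ify : (young_inv Phi s%:E < +oo)%E.
  have [w w0 sw] := young_unbounded (s + 1) yPhi.
  apply: (@le_lt_trans _ _ w%:E); last exact: ltry.
  apply: ereal_inf_lbound; exists w => //; split; first exact: ltW.
  by apply: lt_le_trans sw; rewrite lte_fin ltrDl.
move: (inv0 Phi) Ify; case IE : (young_inv Phi s%:E) => [I||]// I0 _.
rewrite lee_fin le_eqVlt in I0; case/predU1P : I0 => [<-|I0].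
  by rewrite mule0 mule_ge0// lee_fin divr_ge0 ?(ltW c0)// mulr_ge0 ?ltW.
(* any value below the inverse does, up to the factor two in the constant *)
have Pu : (Phi (I / 2) <= s%:E)%E.
  rewrite leNgt; apply/negP => sP.
  have : (young_inv Phi s%:E <= (I / 2)%:E)%E.
    by apply: ereal_inf_lbound; exists (I / 2) => //; split => //; rewrite divr_ge0 ?ltW.
  by rewrite IE lee_fin; lra.
have I20 : 0 < I / 2 by rewrite divr_gt0.
have nf : (orlicz_norm Phi f <= ((I / 2)^-1)%:E)%E.
  apply: ereal_inf_lbound; exists ((I / 2)^-1) => //; split; first by rewrite invr_gt0.
  rewrite invrK int_young_f//.
  by rewrite -[leRHS](_ : s%:E * (s^-1)%:E = 1)%E ?lee_wpmul2r ?lee_fin ?invr_ge0 ?(ltW s0)//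
    -EFinM divff// gt_eqF.
have : (orlicz_norm Psi (frac_max_commutator alpha half_space f) <
    (2 * C / (I / 2))%:E)%E.
  apply: (le_lt_trans norm_le).
  apply: (@le_lt_trans _ _ (C / (I / 2))%:E).
    by rewrite EFinM lee_wpmul2l// lee_fin ltW.
  by rewrite lte_fin ltr_pM2r ?invr_gt0//; lra.
move=> /ereal_inf_lt[_ [l /= [l0 Il] <-]]; rewrite lte_fin => lC.
pose w := test_const * s `^ (- th) / l.
have w0 : 0 < w by rewrite divr_gt0// mulr_gt0.
have lV0 : 0 <= l^-1 by rewrite invr_ge0 ltW.
have Pw : (Psi w <= s%:E)%E.
  suff : (Psi w * (s^-1)%:E <= 1)%E.
    rewrite (young_finE yPsi d2Psi (ltW w0)) -EFinM !lee_fin.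
    by rewrite ler_pdivrMr// mul1r.
  apply: le_trans Il.
  rewrite (young_finE yPsi d2Psi (ltW w0)) -lebesgue_right_cube.
  rewrite -[leLHS](rint_cst mu _ measurable_right_cube).
  have mM := measurable_frac_max_commutator alphan measurable_half_space mf.
  have ext0 x : (0 <= young_ext Psi (`|frac_max_commutator alpha half_space f x| *
      (l^-1)%:E))%E.
    by apply: young_ext_ge0 => //; rewrite mule_ge0.
  apply: (@le_trans _ _ (\int[mu]_(x in right_cube) young_ext Psi
      (`|frac_max_commutator alpha half_space f x| * (l^-1)%:E))%E).
    apply: ge0_le_integral => //.
    - exact: measurable_right_cube.
    - by move=> x _; rewrite lee_fin fine_ge0// (young_ge0 yPsi)// ltW.
    - exact: measurable_funS (measurable_young_abs yPsi d2Psi lV0 mM).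
    move=> x xr; have Mx := frac_max_commutator_ge xr.
    have M0 : (0 <= frac_max_commutator alpha half_space f x)%E.
      by apply: le_trans Mx; rewrite lee_fin (mulr_ge0 (ltW c0) (ltW sth0)).
    rewrite gee0_abs// -(young_finE yPsi d2Psi (ltW w0)).
    move: Mx; case: (frac_max_commutator _ _ _ _) => [u|_|] /=.
    - rewrite lee_fin => cu; apply: young_nd => //; first exact: ltW.
      by rewrite ler_wpM2r.
    - by rewrite gt0_mulye ?lte_fin ?invr_gt0//= leey.
    - by rewrite leeNy_eq.
  apply: ge0_subset_integral => //.
  - exact: measurable_right_cube.
  - exact: (measurable_young_abs yPsi d2Psi lV0 mM).
have wS : (w%:E <= young_inv Psi s%:E)%E.
  apply: le_ereal_inf_tmp => _ [u /= [u0 su] <-]; rewrite lee_fin leNgt; apply/negP => uw.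
  by have := le_trans (young_nd yPsi u0 (ltW uw)) Pw; rewrite leNgt su.
apply: (@le_trans _ _ ((4 * C / test_const)%:E * w%:E)%E).
  rewrite -!EFinM lee_fin.
  have -> : 4 * C / test_const * w = s `^ (- th) * (4 * C / l).
    by rewrite /w; field; rewrite !gt_eqF.
  rewrite ler_wpM2l ?(ltW sth0)// ler_pdivlMr//.
  move: lC; rewrite ltr_pdivlMr//; lra.
by rewrite lee_wpmul2l// lee_fin divr_ge0 ?(ltW c0)// mulr_ge0 ?ltW.
Qed.

End test_function.

Theorem commutator_necessity :
  orlicz_bounded Phi Psi (frac_max_commutator alpha half_space) ->
  exists2 C : R, 0 < C & forall s : R, 0 < s ->
     ((s `^ (- th))%:E * young_inv Phi s%:E <= C%:E * young_inv Psi s%:E)%E.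
Proof.
move=> [C C0 HC]; exists (4 * C / test_const).
  by rewrite divr_gt0 ?mulr_gt0// powR_gt0// exprn_gt0// mulr_gt0.
by move=> s s0; exact: young_inv_le_of_bounded.
Qed.

End necessity.

Unset Implicit Arguments.

Theorem theorem3p10 (R : realType) (n : nat) (alpha : R) (Phi Psi : R -> \bar R)
    (halpha0 : 0 < alpha) (halphan : alpha < n%:R)
    (yPhi : young Phi) (yPsi : young Psi)
    (d2Phi : Delta2 Phi) (n2Phi : nabla2 Phi)
    (d2Psi : Delta2 Psi) (n2Psi : nabla2 Psi) :
  (exists2 C : R, 0 < C & forall r : R, 0 < r ->
     ((r `^ (- (alpha / n%:R)))%:E * young_inv Phi r%:E
        <= C%:E * young_inv Psi r%:E)%E)
  <->
  (forall b : Rn R n -> R, bmo b ->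
     orlicz_bounded Phi Psi (frac_max_commutator alpha b)).
Proof.
split=> [inv b bmob|bounded].
  exact: commutator_sufficiency.
have n0 : (0 < n)%N by rewrite -(@ltr0n R) (lt_trans halpha0).
by apply: (@commutator_necessity R n alpha (Ordinal n0)) => //; exact/bounded/bmo_half_space.
Qed.
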